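(* Every virtual knot has a semimeander diagram.
   Context: A virtual knot diagram is a generic closed curve in the plane $\mathbb{R}^2$ (the image of a circle under a generic, piecewise smooth immersion) with finitely many transverse double points, called crossings, each of which is either a classical crossing (equipped with over/under information) or a virtual crossing (drawn with a small circle around it, with no over/under information). Two virtual knot diagrams are equivalent if they are related by planar isotopy and a finite sequence of the three classical Reidemeister moves (applied to classical crossings) and the four virtual Reidemeister moves: the versions of the three Reidemeister moves in which all crossings are virtual, and the mixed third move, in which a strand having only virtual crossings with two other strands is moved past a classical crossing of those two strands. A virtual knot is an equivalence class of virtual knot diagrams, and a diagram of a virtual knot is a representative of the class. A diagram is composed of two arcs if the closed curve is the union of two consecutive arcs sharing their two endpoints, these endpoints not being crossings; the curve need not be smooth at these endpoints. A diagram of a virtual knot is called semimeander if it is composed of two smooth arcs such that every self-intersection of each of the two arcs is a virtual crossing (equivalently, every classical crossing is a crossing between the two different arcs). *)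

(* Defs.v *)
From HB Require Import structures.
From mathcomp Require Import all_boot all_order all_algebra.
From mathcomp Require Import all_classical all_reals all_analysis.
From Stdlib Require Import Relations.Relation_Operators.

Set Implicit Arguments.
Unset Strict Implicit.
Unset Printing Implicit Defensive.

Import Order.TTheory GRing.Theory Num.Theory.
Import numFieldNormedType.Exports.

Local Open Scope classical_set_scope.
Local Open Scope ring_scope.

(* The plane is R * R and the circle is R / Z: closed curves are 1-periodic
   functions on R, and two parameters denote the same point of the circle iff
   they differ by an integer. *)

Section Curves.
Variable R : realType.
Implicit Types (c : R -> R * R) (s t a b : R).

Definition smooth (f : R -> R) : Prop :=
  forall (n : nat) (x : R), derivable (derive1n n f) x 1.

Definition velocity (x y : R -> R) t : R * R := (derive1 x t, derive1 y t).

(* Smoothness on a closed interval means being the restriction of a smooth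
   map on the line, so one-sided derivatives are available at the ends. *)
Definition regular_by c (x y : R -> R) a b : Prop :=
  [/\ smooth x, smooth y,
      forall t, a <= t <= b -> c t = (x t, y t) &
      forall t, a <= t <= b -> velocity x y t <> (0, 0)].

Definition smooth_arc c a b : Prop :=
  exists x y : R -> R, regular_by c x y a b.

Definition smooth_at c t : Prop :=
  exists2 e : R, 0 < e & smooth_arc c (t - e) (t + e).

Definition opposite_directions (v w : R * R) : Prop :=
  exists2 k : R, 0 < k & w = (- (k * v.1), - (k * v.2)).

(* A regular curve on either side of t, possibly with a corner at t; cusps,
   where the curve turns back on itself, are excluded. *)
Definition immersed_at c t : Prop :=
  exists (e : R) (x1 y1 x2 y2 : R -> R),
    [/\ 0 < e, regular_by c x1 y1 (t - e) t, regular_by c x2 y2 t (t + e) &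
        ~ opposite_directions (velocity x1 y1 t) (velocity x2 y2 t)].

Definition piecewise_smooth_immersion c : Prop :=
  [/\ forall t, c (t + 1) = c t,
      forall t, immersed_at c t &
      finite_set [set t | 0 <= t < 1 /\ ~ smooth_at c t]].

Definition same_point s t : Prop := s - t \is a Num.int.

Definition crossing_pair c s t : Prop := ~ same_point s t /\ c s = c t.

Definition at_crossing c t : Prop := exists s, crossing_pair c s t.

Definition transverse c s t : Prop :=
  let v u := velocity (fun r => (c r).1) (fun r => (c r).2) u in
  [/\ smooth_at c s, smooth_at c t &
      (v s).1 * (v t).2 - (v s).2 * (v t).1 <> 0].

Definition generic c : Prop :=
  [/\ forall r s t, c r = c s -> c s = c t ->
        [\/ same_point r s, same_point s t | same_point r t],
      finite_set [set t | 0 <= t < 1 /\ at_crossing c t] &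
      forall s t, crossing_pair c s t -> transverse c s t].

End Curves.

Variant passage : Set := Over | Under | Virtual.

Definition other_passage (p : passage) : passage :=
  match p with Over => Under | Under => Over | Virtual => Virtual end.

(* [level t] says how the branch of the curve at the parameter t passes through
   its crossing; it carries no information away from crossings. *)
Record diagram (R : realType) := Diagram {
  curve :> R -> R * R ;
  level : R -> passage ;
  curve_immersion : piecewise_smooth_immersion curve ;
  curve_generic : generic curve ;
  level_periodic : forall t, level (t + 1) = level t ;
  level_opposite : forall s t,
    crossing_pair curve s t -> level t = other_passage (level s)
}.

Section Equivalence.
Variable R : realType.
Local Notation plane := (R * R)%type.
Implicit Types D : diagram R.

Definition homeomorphism (h : plane -> plane) : Prop :=
  continuous h /\
  exists g : plane -> plane, [/\ continuous g, cancel h g & cancel g h].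

Definition ambient_isotopy (H : R -> plane -> plane) : Prop :=
  [/\ {within `[0, 1] `*` [set: plane],
         continuous (fun q : R * plane => H q.1 q.2)},
      forall u, 0 <= u <= 1 -> homeomorphism (H u) &
      forall p, H 0 p = p].

(* Lift to the line of a homeomorphism of the circle; diagrams are unoriented
   images of a circle, so reversing the direction is allowed. *)
Definition circle_homeo (f : R -> R) : Prop :=
  [/\ continuous f, bijective f &
      (forall t, f (t + 1) = f t + 1) \/ (forall t, f (t + 1) = f t - 1)].

Definition planar_isotopic D D' : Prop :=
  exists (H : R -> plane -> plane) (f : R -> R),
    [/\ ambient_isotopy H, circle_homeo f,
        forall t, D' (f t) = H 1 (D t) &
        forall t, at_crossing D t -> level D' (f t) = level D t].

Definition square : set plane := [set p | `|p.1| <= 1 /\ `|p.2| <= 1].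

Definition segment (p q : plane) : set plane :=
  [set r | exists2 u : R, 0 <= u <= 1 &
     r = (p.1 + u * (q.1 - p.1), p.2 + u * (q.2 - p.2))].

Fixpoint polyline (p : plane) (s : seq plane) : set plane :=
  if s is q :: s' then segment p q `|` polyline q s' else [set p].

(* A tangle with n strands is given by the images of its strands in the square;
   a tangle diagram is moreover carried to the plane by a map that embeds the
   square as a closed disc. Reflections are allowed, hence each picture below
   also stands for its mirror image. *)

Definition disc_embedding (phi : plane -> plane) : Prop :=
  {within square, continuous phi} /\
  forall p q, square p -> square q -> phi p = phi q -> p = q.

Definition on_strand n (a b : 'I_n -> R) (i : 'I_n) (t : R) : Prop :=
  exists m : int, a i <= t + m%:~R <= b i.

(* The two diagrams are parametrized alike outside the disc; reparametrizing is
   part of [planar_isotopic]. Outside phi(square), D and D' coincide; inside it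
   they consist of the strands a_i <= t <= b_i, drawn as T in D and T' in D'. *)
Definition tangle_replacement n (T T' : 'I_n -> set plane) (a b : 'I_n -> R)
    D D' : Prop :=
  exists phi : plane -> plane,
    [/\ disc_embedding phi,
        forall i, a i < b i < a i + 1,
        forall i j t, on_strand a b i t -> on_strand a b j t -> i = j,
        forall i, D @` `[a i, b i] = phi @` T i /\
                  D' @` `[a i, b i] = phi @` T' i &
        forall t, (forall i, ~ on_strand a b i t) ->
          [/\ ~ (phi @` square) (D t), D' t = D t &
              at_crossing D t -> level D' t = level D t]].

Definition line_tangle (i : 'I_1) : set plane := segment (-1, 0) (1, 0).

Definition kink_tangle (i : 'I_1) : set plane :=
  polyline (-1, 0) [:: (2^-1, 0); (0, 2^-1); (0, - 2^-1); (1, 0)].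

(* The new crossing of a kink is unrestricted: classical of either kind, or
   virtual. *)
Definition reidemeister1 D D' : Prop :=
  exists a b : 'I_1 -> R, tangle_replacement line_tangle kink_tangle a b D D'.

Definition parallel_tangle (i : 'I_2) : set plane :=
  if i == ord0 then segment (-1, - 2^-1) (1, - 2^-1)
  else segment (-1, 2^-1) (1, 2^-1).

Definition bigon_tangle (i : 'I_2) : set plane :=
  if i == ord0 then polyline (-1, - 2^-1) [:: (0, 2^-1); (1, - 2^-1)]
  else polyline (-1, 2^-1) [:: (0, - 2^-1); (1, 2^-1)].

(* A strand passes in the same way through both new crossings: over, under or
   virtually. *)
Definition reidemeister2 D D' : Prop :=
  exists (a b : 'I_2 -> R) (l : passage),
    tangle_replacement parallel_tangle bigon_tangle a b D D' /\
    forall t, on_strand a b ord0 t -> at_crossing D' t -> level D' t = l.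

(* Two diagonals and a third strand (index 2) passing on one side, [y < 0] or
   [y > 0], of their crossing. *)
Definition triangle_tangle (y : R) (i : 'I_3) : set plane :=
  match val i with
  | 0%N => segment (-1, -1) (1, 1)
  | 1%N => segment (-1, 1) (1, -1)
  | _ => polyline (-1, 0) [:: (0, y); (1, 0)]
  end.

(* [l i j] is how strand i passes through its crossing with strand j. *)
Definition strand_levels n (a b : 'I_n -> R) (l : 'I_n -> 'I_n -> passage) D
    : Prop :=
  forall (i j : 'I_n) (s t : R), i <> j ->
    on_strand a b i s -> on_strand a b j t -> D s = D t -> level D s = l i j.

Definition classical3 (l : 'I_3 -> 'I_3 -> passage) : Prop :=
  exists2 h : 'I_3 -> nat, injective h &
    forall i j, i <> j -> l i j = if (h j < h i)%N then Over else Under.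

Definition virtual3 (l : 'I_3 -> 'I_3 -> passage) : Prop :=
  forall i j, i <> j -> l i j = Virtual.

(* Strand 2, the one that is moved in the picture, is virtual with respect to
   both others, whose mutual crossing is classical. *)
Definition mixed3 (l : 'I_3 -> 'I_3 -> passage) : Prop :=
  forall i j, i <> j -> l i j = Virtual <-> (i = ord_max \/ j = ord_max).

Definition reidemeister3 D D' : Prop :=
  exists (a b : 'I_3 -> R) (l : 'I_3 -> 'I_3 -> passage),
    [/\ tangle_replacement (triangle_tangle (- 2^-1)) (triangle_tangle 2^-1)
          a b D D',
        strand_levels a b l D, strand_levels a b l D' &
        [\/ classical3 l, virtual3 l | mixed3 l]].

Definition elementary_move D D' : Prop :=
  [\/ planar_isotopic D D', reidemeister1 D D', reidemeister2 D D' |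
      reidemeister3 D D'].

Definition equivalent : diagram R -> diagram R -> Prop :=
  clos_refl_sym_trans (diagram R) elementary_move.

Definition virtual_knot (K : set (diagram R)) : Prop :=
  exists D, K = [set D' | equivalent D D'].

Definition virtual_self_intersections D (a b : R) : Prop :=
  forall s t, a <= s <= b -> a <= t <= b ->
    crossing_pair D s t -> level D s = Virtual.

Definition semimeander D : Prop :=
  exists a b : R,
    [/\ a < b < a + 1, ~ at_crossing D a /\ ~ at_crossing D b,
        smooth_arc D a b /\ smooth_arc D b (a + 1),
        virtual_self_intersections D a b &
        virtual_self_intersections D b (a + 1)].

End Equivalence.

(* Main.v *)
Require Import Defs.
From mathcomp Require Import all_boot all_order all_algebra.
From mathcomp Require Import all_classical all_reals all_analysis.
From mathcomp Require Import ring lra.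
From Stdlib Require Import Relations.Relation_Operators.

(** Every diagram is equivalent to one composed of two smooth arcs neither of which crosses
    itself at all, which is more than the theorem asks for.

    Cut the circle into n arcs without self-crossings; this is possible since a diagram
    has finitely many crossings. As long as n is at least 3, the number of arcs can be
    lowered. Let A be the first arc and X the second one. If the first crossing along A is
    a crossing with X, the common end of A and of the last arc is moved past it: the last
    arc meets X once more, but not itself ([shift_start]). If A has no crossing with X,
    their union has no self-crossing ([merge_disjoint]). Otherwise A has a crossing x with
    X that comes right after a crossing y with some other arc. It suffices to exchange x and
    y along A, for then x moves step by step to the start of A ([exchange_crossings],
    [merge_arcs]).

    For the exchange, one of the two strands that cross A at x and y is pushed over the
    crossing of A with the other one: a second Reidemeister move makes a bigon of the two
    strands, and a third one moves one strand over the crossing ([slide]). The two new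
    crossings are between X and an arc that is neither A nor X, as x is a crossing with X
    and y is not; so no arc acquires a self-crossing. The moving strand passes through its
    crossings with the other strand as it does through the one with A; the third move is
    then permitted if this passage is virtual or if the crossing of A with the other
    strand is classical ([levels3_pattern]). At least one of the two strands may be pushed
    in this way ([exchange]).

    Curves being actual maps to the plane, these moves are carried out in a chart around
    the part of A between x and y, in which A is the axis h = 0 and the two strands are
    the lines s = 0 and s = 1 ([chart_exists]). The strands are replaced by graphs of
    piecewise affine functions ([surgery_diagram]), chosen so as to be piecewise affine
    images of the pictures of the two moves ([first_move], [second_move]).

    Since surgery leaves corners, and smooth arcs are asked for, corners are rounded by
    planar isotopies after each exchange ([smooth_representative]). Near a corner some
    linear function increases along the curve, so the corner and its rounding are graphs
    over the same interval and a shear of the plane takes one to the other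
    ([corner_isotopy]). *)

Set Implicit Arguments.
Unset Strict Implicit.
Unset Printing Implicit Defensive.

Import Order.TTheory GRing.Theory Num.Theory.
Import numFieldNormedType.Exports.

Local Open Scope classical_set_scope.
Local Open Scope ring_scope.

(** * Smooth functions of one variable *)

Section SmoothFunctions.
Variable R : realType.
Implicit Types (f g : R -> R) (x : R).

(** Families of functions that are closed under differentiation consist of smooth
    functions; this avoids formulas for higher derivatives. *)
Lemma smooth_coind (P : (R -> R) -> Prop) :
  (forall f, P f -> exists2 g, (forall x, is_derive x 1 f (g x)) & P g) ->
  forall f, P f -> smooth f.
Proof.
move=> Pstep f Pf n; elim: n f Pf => [|n IH] f Pf x.
  by have [g fg _] := Pstep f Pf; have [] := fg x.
have [g fg Pg] := Pstep f Pf; rewrite derive1Sn.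
suff -> : derive1 f = g by exact: IH.
by apply/funext => y; rewrite derive1E; exact: derive_val.
Qed.

Lemma smooth_derivable f : smooth f -> forall x, derivable f x 1.
Proof. by move=> sf x; exact: (sf 0%N x). Qed.

Lemma smooth_is_derive f : smooth f -> forall x, is_derive x 1 f (derive1 f x).
Proof.
by move=> sf x; apply: DeriveDef; [exact: smooth_derivable|rewrite derive1E].
Qed.

Lemma smooth_derive1 f : smooth f -> smooth (derive1 f).
Proof. by move=> sf n x; rewrite -derive1Sn; exact: sf. Qed.

Lemma smooth_continuous f : smooth f -> continuous f.
Proof.
by move=> sf x; exact/differentiable_continuous/derivable1_diffP/smooth_derivable.
Qed.

(** The derivative of a member is again a member, whatever the operation it was built
    with, so that [smooth_coind] applies to all operations at once. *)
Inductive smooth_closure : (R -> R) -> Prop :=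
| closure_base f : smooth f -> smooth_closure f
| closure_add f g :
    smooth_closure f -> smooth_closure g -> smooth_closure (fun x => f x + g x)
| closure_mul f g :
    smooth_closure f -> smooth_closure g -> smooth_closure (fun x => f x * g x)
| closure_comp f g :
    smooth f -> smooth_closure g -> smooth_closure (fun x => f (g x))
| closure_inv f : smooth_closure f -> (forall x, f x != 0) ->
    smooth_closure (fun x => (f x)^-1).

Lemma smooth_closed f : smooth_closure f -> smooth f.
Proof.
move: f; apply: smooth_coind => f.
elim=> {f} [f sf|f g cf [f' df cf'] cg [g' dg cg']|f g cf [f' df cf'] cg [g' dg cg']
  |f g sf cg [g' dg cg']|f cf [f' df cf'] f0].
- exists (derive1 f); first exact: smooth_is_derive.
  exact/closure_base/smooth_derive1.
- exists (fun x => f' x + g' x); last exact: closure_add.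
  by move=> x; exact: is_deriveD.
- exists (fun x => f x * g' x + g x * f' x); last first.
    by apply: closure_add; exact: closure_mul.
  by move=> x; exact: is_deriveM.
- exists (fun x => derive1 f (g x) * g' x); last first.
    by apply: closure_mul cg'; apply: closure_comp cg; exact: smooth_derive1.
  by move=> x; apply: is_derive1_comp; exact: smooth_is_derive.
- exists (fun x => (- ((f x)^-1 * (f x)^-1)) * f' x); last first.
    apply: closure_mul => //.
    have -> : (fun x => - ((f x)^-1 * (f x)^-1)) =
              (fun x => (- 1) * ((f x)^-1 * (f x)^-1)).
      by apply/funext => x; rewrite mulN1r.
    apply: closure_mul; last by apply: closure_mul; exact: closure_inv.
    apply: closure_base; apply: (@smooth_coind (fun f => exists c, f = cst c)).
      move=> _ [c ->]; exists (cst 0); last by exists 0.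
      by move=> x; exact: is_derive_cst.
    by exists (-1).
  move=> x.
  have -> : - ((f x)^-1 * (f x)^-1) * f' x = - (f x) ^- 2 *: f' x.
    by rewrite expr2 invfM.
  exact: is_deriveV.
Qed.

Lemma smooth_cst (c : R) : smooth (fun=> c).
Proof.
apply: (@smooth_coind (fun f => exists c, f = cst c)); last by exists c.
move=> _ [d ->]; exists (cst 0); last by exists 0.
by move=> x; exact: is_derive_cst.
Qed.

Lemma smooth_id : smooth (fun x : R => x).
Proof.
apply: (@smooth_coind (fun f => f = id \/ exists c, f = cst c)); last by left.
move=> _ [->|[d ->]].
- exists (cst 1); last by right; exists 1.
  by move=> x; exact: is_derive_id.
- exists (cst 0); last by right; exists 0.
  by move=> x; exact: is_derive_cst.
Qed.

Lemma smoothD f g : smooth f -> smooth g -> smooth (fun x => f x + g x).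
Proof. by move=> sf sg; apply/smooth_closed/closure_add; exact: closure_base. Qed.

Lemma smoothM f g : smooth f -> smooth g -> smooth (fun x => f x * g x).
Proof. by move=> sf sg; apply/smooth_closed/closure_mul; exact: closure_base. Qed.

Lemma smooth_comp f g : smooth f -> smooth g -> smooth (fun x => f (g x)).
Proof. by move=> sf sg; apply/smooth_closed/closure_comp=> //; exact: closure_base. Qed.

Lemma smoothV f : smooth f -> (forall x, f x != 0) -> smooth (fun x => (f x)^-1).
Proof. by move=> sf f0; apply/smooth_closed/closure_inv=> //; exact: closure_base. Qed.

Lemma smoothN f : smooth f -> smooth (fun x => - f x).
Proof.
move=> sf; rewrite (_ : (fun x => - f x) = (fun x => (-1) * f x)).
  by apply: smoothM; [exact: smooth_cst|exact: sf].
by apply/funext => x; rewrite mulN1r.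
Qed.

Lemma smoothB f g : smooth f -> smooth g -> smooth (fun x => f x - g x).
Proof. by move=> sf sg; apply: smoothD; [exact: sf|exact: smoothN]. Qed.

Lemma smooth_affine (a b : R) : smooth (fun x => a + b * x).
Proof.
apply: smoothD; first exact: smooth_cst.
by apply: smoothM; [exact: smooth_cst|exact: smooth_id].
Qed.

Lemma smooth_expR : smooth (@expR R).
Proof.
apply: (@smooth_coind (fun f => f = @expR R)) => // _ ->.
by exists (@expR R) => // x; exact: is_derive_expR.
Qed.

Lemma smooth_local f :
  (forall x, exists2 g, smooth g & \forall y \near x, f y = g y) -> smooth f.
Proof.
move: f; apply: (@smooth_coind (fun f =>
  forall x, exists2 g, smooth g & \forall y \near x, f y = g y)) => f lf; exists (derive1 f) => x.
  have [g sg fg] := lf x.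
  rewrite derive1E (near_eq_derive _ fg) -derive1E.
  apply: near_eq_is_derive (smooth_is_derive sg x).
  by near do apply/esym.
have [g sg fg] := lf x; exists (derive1 g); first exact: smooth_derive1.
near=> y; rewrite !derive1E; apply: near_eq_derive.
near: y; exact: (near_join fg).
Unshelve. all: by end_near. Qed.

(** The functions p(1/x) exp(-1/x) on x > 0 have derivatives of the same form, and the
    exponential makes them flat at 0. *)
Definition flat_poly (p : {poly R}) x : R :=
  if 0 < x then p.[x^-1] * expR (- x^-1) else 0.

Lemma flat_poly_bound p :
  exists2 C, 0 <= C & forall x, `|flat_poly p x| <= C * `|x|.
Proof.
exists (\sum_(i < size p) `|p`_i| * (i.+1)`!%:R).
  by apply: sumr_ge0 => i _; rewrite mulr_ge0.
move=> x; rewrite /flat_poly; case: ifPn => [x0|_]; last first.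
  by rewrite normr0 mulr_ge0// sumr_ge0// => i _; rewrite mulr_ge0.
rewrite normrM [`|expR _|]gtr0_norm ?expR_gt0// horner_coef.
apply: (@le_trans _ _ ((\sum_(i < size p) `|p`_i * x^-1 ^+ i|) * expR (- x^-1))).
  by rewrite ler_wpM2r ?expR_ge0// ler_norm_sum.
rewrite !mulr_suml; apply: ler_sum => i _.
rewrite normrM -!mulrA ler_wpM2l// gtr0_norm ?exprn_gt0 ?invr_gt0//.
rewrite gtr0_norm// expRN ler_pdivrMr ?expR_gt0//.
have xV0 : 0 <= x^-1 by rewrite invr_ge0 ltW.
have := expR_ge1Dxn i xV0; move=> /(le_trans _) H.
have {H} H : x^-1 ^+ i.+1 / (i.+1)`!%:R <= expR x^-1.
  by apply: (H); rewrite lerDr.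
move: H; rewrite ler_pdivrMr ?ltr0n ?fact_gt0// => H.
apply: (@le_trans _ _ (x * (expR x^-1 * (i.+1)`!%:R))).
  have -> : x^-1 ^+ i = x * x^-1 ^+ i.+1 by rewrite exprS mulrA mulfV ?mul1r ?gt_eqF.
  by rewrite ler_wpM2l// ltW.
by rewrite le_eqVlt; apply/orP; left; apply/eqP; ring.
Qed.

Lemma derive_flat_poly p x :
  is_derive x 1 (flat_poly p) (flat_poly ((p - p^`()) * 'X^2) x).
Proof.
have [x0|x0|->] := ltgtP x 0.
- rewrite [X in is_derive _ _ _ X]/flat_poly ifF; last by rewrite ltNge ltW.
  apply: (@near_eq_is_derive _ _ _ (cst 0)).
  near=> y; rewrite /flat_poly ifF// ltNge; apply/negbF/ltW.
  by near: y; exact: lt_nbhsl.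
- rewrite [X in is_derive _ _ _ X]/flat_poly x0.
  pose g := (horner p \o (fun y : R => y^-1)) * (expR \o (-%R \o (fun y : R => y^-1))).
  apply: (@near_eq_is_derive _ _ _ g).
    near=> y; rewrite /flat_poly ifT//.
    by near: y; exact: lt_nbhsr.
  have dV : is_derive x 1 (fun y : R => y^-1) (- x ^- 2 *: 1).
    by apply: is_deriveV; rewrite gt_eqF.
  have d1 : is_derive x 1 (horner p \o (fun y : R => y^-1))
       (p^`().[x^-1] * (- x ^- 2 *: 1)).
    exact: is_derive1_comp.
  have d2 : is_derive x 1 (expR \o (-%R \o (fun y : R => y^-1)))
       (expR (- x^-1) * - (- x ^- 2 *: 1)).
    by apply: is_derive1_comp.
  have := is_deriveM d1 d2; congr is_derive.
  rewrite /= /GRing.scale /= !hornerE /=.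
  by rewrite -exprVn; ring.
- rewrite [X in is_derive _ _ _ X]/flat_poly ltxx.
  have [C C0 bC] := flat_poly_bound (p * 'X).
  have lim0 : (fun h : R => h^-1 *: (flat_poly p (h *: 1 + 0) - flat_poly p 0))
      @ 0^' --> (0 : R).
    apply/cvgr0Pnorm_lt => e e0.
    near=> h.
    have h0 : h != 0 by near: h; exact: nbhs_dnbhs_neq.
    have -> : flat_poly p 0 = 0 by rewrite /flat_poly ltxx.
    rewrite subr0 addr0 /GRing.scale/= mulr1.
    have -> : h^-1 * flat_poly p h = flat_poly (p * 'X) h.
      rewrite /flat_poly; case: ifP; rewrite ?mulr0// => _.
      by rewrite hornerMX mulrCA mulrA.
    apply: le_lt_trans (bC h) _.
    have : `|h| < e / (C + 1).
      by near: h; apply: dnbhs0_lt; rewrite divr_gt0// ltr_wpDl.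
    rewrite ltr_pdivlMr ?ltr_wpDl// => he; apply: le_lt_trans he.
    by rewrite mulrC ler_wpM2l// lerDl.
  apply: DeriveDef; first by apply/cvg_ex; exists 0.
  exact: cvg_lim.
Unshelve. all: by end_near. Qed.

Lemma smooth_flat_poly p : smooth (flat_poly p).
Proof.
apply: (@smooth_coind (fun f => exists p, f = flat_poly p)); last by exists p.
move=> _ [q ->]; exists (flat_poly ((q - q^`()) * 'X^2)); last by eexists.
by move=> x; exact: derive_flat_poly.
Qed.

(** The usual smooth transition from 0 to 1 on the unit interval. *)
Definition step x : R := flat_poly 1 x / (flat_poly 1 x + flat_poly 1 (1 - x)).

Lemma flat1_ge0 x : 0 <= flat_poly 1 x.
Proof. by rewrite /flat_poly; case: ifP => // _; rewrite hornerC mul1r expR_ge0. Qed.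

Lemma flat1_gt0 x : 0 < x -> 0 < flat_poly 1 x.
Proof. by rewrite /flat_poly => ->; rewrite hornerC mul1r expR_gt0. Qed.

Lemma flat1_eq0 x : x <= 0 -> flat_poly 1 x = 0.
Proof. by rewrite /flat_poly ltNge => ->. Qed.

Lemma step_den x : 0 < flat_poly 1 x + flat_poly 1 (1 - x).
Proof.
have [x0|x0] := ltP 0 x; first by rewrite ltr_pwDl ?flat1_gt0 ?flat1_ge0.
by rewrite ltr_wpDl ?flat1_ge0// flat1_gt0//; lra.
Qed.

Lemma smooth_step : smooth step.
Proof.
apply: smoothM; first exact: smooth_flat_poly.
apply: smoothV; last by move=> x; rewrite gt_eqF ?step_den.
apply: smoothD; first exact: smooth_flat_poly.
apply: (@smooth_comp (flat_poly 1) (fun x => 1 - x)); first exact: smooth_flat_poly.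
by apply: smoothB; [exact: smooth_cst|exact: smooth_id].
Qed.

Lemma step_le0 x : x <= 0 -> step x = 0.
Proof. by move=> x0; rewrite /step flat1_eq0// mul0r. Qed.

Lemma step_ge1 x : 1 <= x -> step x = 1.
Proof.
move=> x1; rewrite /step [flat_poly 1 (1 - x)]flat1_eq0; last lra.
by rewrite addr0 mulfV// gt_eqF// flat1_gt0//; lra.
Qed.

Lemma step_bound x : 0 <= step x <= 1.
Proof.
rewrite /step; apply/andP; split.
  by rewrite divr_ge0 ?flat1_ge0// ltW// step_den.
by rewrite ler_pdivrMr ?step_den// mul1r lerDl flat1_ge0.
Qed.

Lemma step_lt1 x : x < 1 -> step x < 1.
Proof.
move=> x1; rewrite /step ltr_pdivrMr ?step_den// mul1r ltrDl flat1_gt0//; lra.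
Qed.

Lemma derive1_step x : derive1 step x =
  (flat_poly 'X^2 x * flat_poly 1 (1 - x) + flat_poly 1 x * flat_poly 'X^2 (1 - x))
  / (flat_poly 1 x + flat_poly 1 (1 - x)) ^+ 2.
Proof.
have dflat (y : R) : is_derive y 1 (flat_poly 1) (flat_poly 'X^2 y).
  by have := derive_flat_poly 1 y; rewrite derivC subr0 mul1r.
have dflat1 : is_derive x 1 (fun y => flat_poly 1 (1 - y)) (- flat_poly 'X^2 (1 - x)).
  rewrite -mulrN1; apply: (@is_derive1_comp _ (flat_poly 1) (fun y => 1 - y)).
  rewrite -[X in is_derive _ _ _ X]sub0r; apply: is_deriveB.
have dden := is_deriveD (dflat x) dflat1.
have den0 : (flat_poly 1 + (fun y => flat_poly 1 (1 - y))) x != 0.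
  by rewrite gt_eqF// step_den.
have H := is_deriveM (dflat x) (is_deriveV den0 dden).
have -> : derive1 step x = 'D_1 (flat_poly 1 *
    (fun y => ((flat_poly 1 + (fun y => flat_poly 1 (1 - y))) y)^-1)) x.
  by rewrite derive1E.
rewrite (@derive_val _ _ _ _ _ _ _ H) /GRing.scale /= !fctE.
have : flat_poly 1 x + flat_poly 1 (1 - x) != 0 by rewrite gt_eqF// step_den.
by move=> ?; field.
Qed.

Lemma derive1_step_ge0 x : 0 <= derive1 step x.
Proof.
have ge0 y : 0 <= flat_poly 'X^2 y.
  rewrite /flat_poly; case: ifP => // y0.
  by rewrite hornerXn mulr_ge0 ?expR_ge0// exprn_ge0// invr_ge0 ltW.
by rewrite derive1_step divr_ge0 ?sqr_ge0// addr_ge0// mulr_ge0 ?flat1_ge0.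
Qed.

Lemma derive1_step_gt0 x : 0 < x < 1 -> 0 < derive1 step x.
Proof.
have gt0 y : 0 < y -> 0 < flat_poly 'X^2 y.
  rewrite /flat_poly => y0; rewrite y0.
  by rewrite hornerXn mulr_gt0 ?expR_gt0// exprn_gt0// invr_gt0.
move=> /andP[x0 x1]; have x1' : 0 < 1 - x by rewrite subr_gt0.
rewrite derive1_step divr_gt0 ?exprn_gt0 ?step_den//.
by rewrite addr_gt0// mulr_gt0 ?flat1_gt0 ?gt0.
Qed.

End SmoothFunctions.

(** * Points of the circle and regular curves *)

Section Circle.
Variable R : realType.
Implicit Types (s t : R) (c : R -> R * R) (D : diagram R).

Lemma same_pointP s t : same_point s t <-> exists k : int, s = t + k%:~R.
Proof.
split=> [/intrP[k kE]|[k ->]]; first by exists k; rewrite -kE addrC subrK.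
by rewrite /same_point addrAC subrr add0r intr_int.
Qed.

Lemma same_point_refl s : same_point s s.
Proof. by rewrite /same_point subrr rpred0. Qed.

Lemma same_point_sym s t : same_point s t -> same_point t s.
Proof. by rewrite /same_point => H; rewrite -opprB rpredN. Qed.

Lemma same_point_trans s t r : same_point s t -> same_point t r -> same_point s r.
Proof.
rewrite /same_point => st tr; have := rpredD st tr.
by rewrite addrA subrK.
Qed.

Lemma same_pointDz s (k : int) : same_point (s + k%:~R) s.
Proof. by apply/same_pointP; exists k. Qed.

Lemma same_pointD s t u : same_point s t -> same_point (s + u) (t + u).
Proof. by rewrite /same_point; congr (_ \is a Num.int); ring. Qed.

Lemma periodic_int (T : Type) (f : R -> T) :
  (forall t, f (t + 1) = f t) -> forall t (k : int), f (t + k%:~R) = f t.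
Proof.
move=> f1 t k.
have fn u (n : nat) : f (u + n%:R) = f u.
  elim: n u => [|n IH] u; first by rewrite addr0.
  by rewrite -natr1 addrA f1 IH.
case: k => n; first exact: fn.
by rewrite NegzE rmorphN /= -[f (t - _)](fn _ n.+1) subrK.
Qed.

Lemma periodic_same (T : Type) (f : R -> T) s t :
  (forall t, f (t + 1) = f t) -> same_point s t -> f s = f t.
Proof. by move=> f1 /same_pointP[k ->]; exact: periodic_int. Qed.

Lemma same_point_lt1 s t : same_point s t -> `|s - t| < 1 -> s = t.
Proof.
move=> /intrP[k kE]; rewrite kE -intr_norm ltrz1.
move: kE; case: k => [[|n]|n] // E _; apply/eqP.
by rewrite -subr_eq0 E.
Qed.

(** The representative of [z] modulo 1 in [-1/2, 1/2). *)
Definition centered z : R := z - (Num.floor (z + 2^-1))%:~R.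

Lemma centered_same z : same_point (centered z) z.
Proof.
by apply/same_pointP; exists (- Num.floor (z + 2^-1)); rewrite rmorphN.
Qed.

Lemma centered_bound z : - 2^-1 <= centered z < 2^-1.
Proof.
rewrite /centered; have /andP[] := floor_itv (z + 2^-1).
by rewrite intrD => *; apply/andP; split; lra.
Qed.

Lemma centeredE z w : same_point z w -> `|w| < 2^-1 -> centered z = w.
Proof.
move=> zw w1; apply: same_point_lt1.
  exact: same_point_trans (centered_same z) zw.
have /andP[] := centered_bound z; move: w1; rewrite !ltr_norml => /andP[? ?] ? ?.
by apply/andP; split; lra.
Qed.

Lemma centered_periodic z : centered (z + 1) = centered z.
Proof.
rewrite /centered (_ : z + 1 + 2^-1 = z + 2^-1 + 1%:~R); last by ring.
rewrite floorDrz ?intr_int// intrKfloor intrD.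
by rewrite opprD addrACA subrr addr0.
Qed.

Lemma centered_eq z w : same_point z w -> centered z = centered w.
Proof. by apply: periodic_same; exact: centered_periodic. Qed.

End Circle.

Section LocalCurves.
Variable R : realType.
Implicit Types (s t : R) (c : R -> R * R) (x y : R -> R).

Lemma near_segment (P : R -> Prop) t : (\forall u \near t, P u) ->
  exists2 e, 0 < e & forall u, t - e <= u <= t + e -> P u.
Proof.
move=> /nbhs_ballP[e /= e0 eP]; exists (e / 2); first by rewrite divr_gt0.
move=> u /andP[u1 u2]; apply: eP; rewrite /ball/= ltr_norml.
by apply/andP; split; lra.
Qed.

Lemma segment_near (P : R -> Prop) t e : 0 < e ->
  (forall u, t - e < u < t + e -> P u) -> \forall u \near t, P u.
Proof.
move=> e0 eP; apply/nbhs_ballP; exists e => //= u.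
by rewrite /ball/= distrC => ue; apply: eP; move: ue; rewrite ltr_distl.
Qed.

Lemma regular_by_sub c x y a b a' b' : a <= a' -> b' <= b ->
  regular_by c x y a b -> regular_by c x y a' b'.
Proof.
move=> aa bb [sx sy ce cv]; split => // t /andP[ta tb]; [apply: ce|apply: cv];
  by apply/andP; split; lra.
Qed.

Lemma regular_by_eq c c' x y a b : (forall t, a <= t <= b -> c t = c' t) ->
  regular_by c x y a b -> regular_by c' x y a b.
Proof. by move=> cc [sx sy ce cv]; split => // t tab; rewrite -cc ?ce. Qed.

Lemma velocity_near x y t : smooth x -> smooth y -> velocity x y t <> (0, 0) ->
  \forall u \near t, velocity x y u <> (0, 0).
Proof.
move=> sx sy v0.
have cx := @smooth_continuous _ _ (smooth_derive1 sx) t.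
have cy := @smooth_continuous _ _ (smooth_derive1 sy) t.
have [x0|x0] := eqVneq (derive1 x t) 0.
  have y0 : derive1 y t != 0 by apply: contra_notN v0 => /eqP yt; rewrite /velocity x0 yt.
  near=> u => -[_]; apply/eqP; near: u.
  exact: (cvgr_neq0 _ cy y0).
near=> u => -[+ _]; apply/eqP; near: u.
exact: (cvgr_neq0 _ cx x0).
Unshelve. all: by end_near. Qed.

Lemma smooth_at_near c c' t : (\forall u \near t, c u = c' u) ->
  smooth_at c t -> smooth_at c' t.
Proof.
move=> /near_segment[d d0 cc] [e e0 [x [y H]]].
exists (Num.min d e); first by rewrite lt_min d0 e0.
exists x, y; apply: (@regular_by_eq c).
  move=> u /andP[u1 u2]; apply: cc; have := ge_min d d e; rewrite lexx /= => m.
  by apply/andP; split; lra.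
have m : Num.min d e <= e by rewrite ge_min lexx orbT.
by apply: regular_by_sub H; lra.
Qed.

Lemma immersed_at_near c c' t : (\forall u \near t, c u = c' u) ->
  immersed_at c t -> immersed_at c' t.
Proof.
move=> /near_segment[d d0 cc] [e [x1 [y1 [x2 [y2 [e0 H1 H2 H3]]]]]].
have m1 : Num.min d e <= d by rewrite ge_min lexx.
have m2 : Num.min d e <= e by rewrite ge_min lexx orbT.
have m0 : 0 < Num.min d e by rewrite lt_min d0 e0.
exists (Num.min d e), x1, y1, x2, y2; split => //.
  apply: (@regular_by_eq c).
    by move=> u /andP[u1 u2]; apply: cc; apply/andP; split; lra.
  by apply: regular_by_sub H1; lra.
apply: (@regular_by_eq c).
  by move=> u /andP[u1 u2]; apply: cc; apply/andP; split; lra.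
by apply: regular_by_sub H2; lra.
Qed.

Lemma smooth_at_intro c x y t : smooth x -> smooth y ->
  (\forall u \near t, c u = (x u, y u)) -> velocity x y t <> (0, 0) ->
  smooth_at c t.
Proof.
move=> sx sy cE v0.
have [e e0 eP] : exists2 e, 0 < e & forall u, t - e <= u <= t + e ->
    c u = (x u, y u) /\ velocity x y u <> (0, 0).
  apply: near_segment; near=> u; split; first by near: u.
  by near: u; exact: velocity_near.
by exists e => //; exists x, y; split => // u /eP[].
Unshelve. all: by end_near. Qed.

(** A linear functional that is positive on both one-sided velocities excludes a cusp. *)
Lemma not_opposite (v w : R * R) (a b : R) :
  0 < a * v.1 + b * v.2 -> 0 < a * w.1 + b * w.2 -> ~ opposite_directions v w.
Proof.
move=> H1 H2 [k k0 wE]; rewrite wE /= in H2.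
suff : a * - (k * v.1) + b * - (k * v.2) = - (k * (a * v.1 + b * v.2)) by nra.
by ring.
Qed.

Lemma immersed_at_intro c x1 y1 x2 y2 t e : 0 < e ->
  smooth x1 -> smooth y1 -> smooth x2 -> smooth y2 ->
  (forall u, t - e <= u <= t -> c u = (x1 u, y1 u)) ->
  (forall u, t <= u <= t + e -> c u = (x2 u, y2 u)) ->
  velocity x1 y1 t <> (0, 0) -> velocity x2 y2 t <> (0, 0) ->
  ~ opposite_directions (velocity x1 y1 t) (velocity x2 y2 t) ->
  immersed_at c t.
Proof.
move=> e0 sx1 sy1 sx2 sy2 c1 c2 v1 v2 v12.
have [d d0 dP] : exists2 d, 0 < d & forall u, t - d <= u <= t + d ->
    velocity x1 y1 u <> (0, 0) /\ velocity x2 y2 u <> (0, 0).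
  by apply: near_segment; near=> u; split; near: u; exact: velocity_near.
have m1 : Num.min d e <= d by rewrite ge_min lexx.
have m2 : Num.min d e <= e by rewrite ge_min lexx orbT.
have m0 : 0 < Num.min d e by rewrite lt_min d0 e0.
exists (Num.min d e), x1, y1, x2, y2; split => //; split => //.
- by move=> u /andP[? ?]; apply: c1; apply/andP; split; lra.
- by move=> u /andP[? ?]; have [] // := dP u; apply/andP; split; lra.
- by move=> u /andP[? ?]; apply: c2; apply/andP; split; lra.
- by move=> u /andP[? ?]; have [] // := dP u; apply/andP; split; lra.
Unshelve. all: by end_near. Qed.

Lemma smooth_at_regular c t : smooth_at c t ->
  exists x y, [/\ smooth x, smooth y, \forall u \near t, c u = (x u, y u) &
                  velocity x y t <> (0, 0)].
Proof.
move=> [e e0 [x [y [sx sy ce cv]]]]; exists x, y; split => //.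
  by apply: (@segment_near _ t e) => // u /andP[? ?]; apply: ce; apply/andP; split; lra.
by apply: cv; apply/andP; split; lra.
Qed.

Lemma smooth_at_immersed c t : smooth_at c t -> immersed_at c t.
Proof.
move=> /smooth_at_regular[x [y [sx sy ce cv]]].
have [e e0 eP] := near_segment ce.
apply: (@immersed_at_intro c x y x y t e) => //.
- by move=> u /andP[? ?]; apply: eP; apply/andP; split; lra.
- by move=> u /andP[? ?]; apply: eP; apply/andP; split; lra.
- move=> [k k0]; rewrite /velocity /= => -[E1 E2]; apply: cv.
  have x0 : derive1 x t = 0 by nra.
  have y0 : derive1 y t = 0 by nra.
  by rewrite /velocity x0 y0.
Qed.

Lemma velocity_eq (x y x' y' : R -> R) t : (\forall u \near t, x u = x' u) ->
  (\forall u \near t, y u = y' u) -> velocity x y t = velocity x' y' t.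
Proof.
by move=> xx yy; rewrite /velocity !derive1E (near_eq_derive _ xx) (near_eq_derive _ yy).
Qed.

(** A curve that is smooth at each parameter is a single global regular parametrization
    of itself, hence of each of its arcs. *)
Lemma smooth_coordinates c : (forall t, smooth_at c t) ->
  [/\ smooth (fun u => (c u).1), smooth (fun u => (c u).2) &
      forall t, velocity (fun u => (c u).1) (fun u => (c u).2) t <> (0, 0)].
Proof.
move=> sc; split.
- apply: smooth_local => t; have [x [y [sx sy ce _]]] := smooth_at_regular (sc t).
  by exists x => //; near=> u; have -> : c u = (x u, y u) by near: u.
- apply: smooth_local => t; have [x [y [sx sy ce _]]] := smooth_at_regular (sc t).
  by exists y => //; near=> u; have -> : c u = (x u, y u) by near: u.
- move=> t; have [x [y [sx sy ce v0]]] := smooth_at_regular (sc t).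
  by rewrite (@velocity_eq _ _ x y)//; near=> u; have -> : c u = (x u, y u) by near: u.
Unshelve. all: by end_near. Qed.

End LocalCurves.

(** * Separated sums and piecewise affine functions *)

Section SeparatedSums.
Variable R : realType.
Implicit Types (s h t : R) (l : seq ((R -> R) * (R -> R))).

(** Charts are sums of products [u s * v h]: this class is closed under both partial
    derivatives, and all the calculus that is needed is that of one variable. *)
Fixpoint sep l s h : R :=
  if l is uv :: l' then uv.1 s * uv.2 h + sep l' s h else 0.

Fixpoint smooth_sep l : Prop :=
  if l is uv :: l' then [/\ smooth uv.1, smooth uv.2 & smooth_sep l'] else True.

Definition sep_ds l := map (fun uv : (R -> R) * (R -> R) => (derive1 uv.1, uv.2)) l.
Definition sep_dh l := map (fun uv : (R -> R) * (R -> R) => (uv.1, derive1 uv.2)) l.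

Lemma smooth_sep_ds l : smooth_sep l -> smooth_sep (sep_ds l).
Proof.
elim: l => [//|uv l IH /= [su sv /IH sl]].
by split; [exact: smooth_derive1|exact: sv|exact: sl].
Qed.

Lemma smooth_sep_dh l : smooth_sep l -> smooth_sep (sep_dh l).
Proof.
elim: l => [//|uv l IH /= [su sv /IH sl]].
by split; [exact: su|exact: smooth_derive1|exact: sl].
Qed.

Lemma smooth_sep_curve l (a b : R -> R) : smooth_sep l -> smooth a -> smooth b ->
  smooth (fun t => sep l (a t) (b t)).
Proof.
move=> + sa sb; elim: l => [_|uv l IH /= [su sv /IH sl]]; first exact: smooth_cst.
apply: smoothD; last exact: sl.
by apply: smoothM; [apply: (@smooth_comp _ uv.1)|apply: (@smooth_comp _ uv.2)]; assumption.
Qed.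

Lemma is_derive_sep_curve l (a b : R -> R) t a' b' : smooth_sep l ->
  is_derive t 1 a a' -> is_derive t 1 b b' ->
  is_derive t 1 (fun u => sep l (a u) (b u))
    (sep (sep_ds l) (a t) (b t) * a' + sep (sep_dh l) (a t) (b t) * b').
Proof.
move=> + da db; elim: l => [_|uv l IH /= [su sv /IH dl]].
  by rewrite /= !mul0r addr0; exact: is_derive_cst.
have du : is_derive t 1 (fun u => uv.1 (a u)) (derive1 uv.1 (a t) * a').
  by apply: is_derive1_comp; exact: smooth_is_derive.
have dv : is_derive t 1 (fun u => uv.2 (b u)) (derive1 uv.2 (b t) * b').
  by apply: is_derive1_comp; exact: smooth_is_derive.
have := is_deriveD (is_deriveM du dv) dl.
by congr is_derive; rewrite /GRing.scale /=; ring.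
Qed.

Lemma continuous_sep l : smooth_sep l -> continuous (fun p : R * R => sep l p.1 p.2).
Proof.
elim: l => [_|uv l IH /= [su sv /IH cl]] p; first exact: cvg_cst.
apply: cvgD; last exact: cl.
apply: cvgM.
  by apply: (cvg_comp _ _ cvg_fst); exact: smooth_continuous.
by apply: (cvg_comp _ _ cvg_snd); exact: smooth_continuous.
Qed.

End SeparatedSums.

Section PiecewiseAffine.
Variable R : realType.
Implicit Types (f g : R -> R) (h a b e : R).

(** In terms of increments, so that both one-sided slopes can be read off at a corner. *)
Definition affine_germ f h a b := exists2 e, 0 < e &
  forall u, 0 <= u <= e -> f (h - u) = f h - a * u /\ f (h + u) = f h + b * u.

Definition piecewise_affine f := forall h, exists a b, affine_germ f h a b.

Lemma piecewise_affine_affine (p q : R) : piecewise_affine (fun h => p + q * h).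
Proof. by move=> h; exists q, q, 1 => // u _; split; ring. Qed.

Lemma piecewise_affineD f g : piecewise_affine f -> piecewise_affine g ->
  piecewise_affine (fun h => f h + g h).
Proof.
move=> pf pg h; have [a [b [e e0 fE]]] := pf h; have [a' [b' [e' e'0 gE]]] := pg h.
have m1 : Num.min e e' <= e by rewrite ge_min lexx.
have m2 : Num.min e e' <= e' by rewrite ge_min lexx orbT.
exists (a + a'), (b + b'), (Num.min e e'); first by rewrite lt_min e0.
move=> u /andP[u0 ue].
have [|-> ->] := fE u; first by apply/andP; split; lra.
have [|-> ->] := gE u; first by apply/andP; split; lra.
by split; ring.
Qed.

Lemma piecewise_affineN f : piecewise_affine f -> piecewise_affine (fun h => - f h).
Proof.
move=> pf h; have [a [b [e e0 fE]]] := pf h.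
by exists (- a), (- b), e => // u /fE[-> ->]; split; ring.
Qed.

Lemma affine_germ_pos f h a b : 0 <= f h -> affine_germ f h a b ->
  exists a' b', affine_germ (fun h => Num.max 0 (f h)) h a' b'.
Proof.
rewrite le_eqVlt => /predU1P[f0 [e e0 fE]|f0 [e e0 fE]].
  exists (- Num.max 0 (- a)), (Num.max 0 b), e => // u ue.
  have [-> ->] := fE u ue; rewrite -f0 maxxx.
  move/andP: ue => [u0 _].
  rewrite !sub0r !add0r; split.
    by rewrite mulNr opprK maxr_pMl// mul0r mulNr.
  by rewrite maxr_pMl// mul0r.
have [d d0 dP] : exists2 d, 0 < d & forall u, u <= d -> `|a| * u <= f h /\ `|b| * u <= f h.
  exists (f h / (`|a| + `|b| + 1)).
    by rewrite divr_gt0// ltr_wpDl// addr_ge0.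
  move=> u; rewrite ler_pdivlMr ?ltr_wpDl ?addr_ge0// => uf.
  have := normr_ge0 a; have := normr_ge0 b.
  by move=> ? ?; split; nra.
exists a, b, (Num.min d e); first by rewrite lt_min d0.
move=> u /andP[u0 ue].
have m1 : Num.min d e <= d by rewrite ge_min lexx.
have m2 : Num.min d e <= e by rewrite ge_min lexx orbT.
have [|-> ->] := fE u; first by apply/andP; split; lra.
have [|da db] := dP u; first by lra.
have := ler_norm a; have := ler_norm b; have := ler_norm (- a); have := ler_norm (- b).
rewrite !normrN => *.
rewrite (max_r (ltW f0)) !max_r//; nra.
Qed.

Lemma affine_germ_neg f h a b : f h < 0 -> affine_germ f h a b ->
  affine_germ (fun h => Num.max 0 (f h)) h 0 0.
Proof.
move=> f0 [e e0 fE].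
have [d d0 dP] : exists2 d, 0 < d & forall u, u <= d -> `|a| * u <= - f h /\ `|b| * u <= - f h.
  exists (- f h / (`|a| + `|b| + 1)).
    by rewrite divr_gt0 ?oppr_gt0// ltr_wpDl// addr_ge0.
  move=> u; rewrite ler_pdivlMr ?ltr_wpDl ?addr_ge0// => uf.
  have := normr_ge0 a; have := normr_ge0 b.
  by move=> ? ?; split; nra.
exists (Num.min d e); first by rewrite lt_min d0.
move=> u /andP[u0 ue].
have m1 : Num.min d e <= d by rewrite ge_min lexx.
have m2 : Num.min d e <= e by rewrite ge_min lexx orbT.
have [|-> ->] := fE u; first by apply/andP; split; lra.
have [|da db] := dP u; first by lra.
have := ler_norm a; have := ler_norm b; have := ler_norm (- a); have := ler_norm (- b).
rewrite !normrN => *.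
rewrite (max_l (ltW f0)) !max_l; first by split; ring.
all: by nra.
Qed.

(** Maxima and minima, from which all profiles are built, only need the case of the
    maximum with 0. *)
Lemma piecewise_affine_max f g : piecewise_affine f -> piecewise_affine g ->
  piecewise_affine (fun h => Num.max (f h) (g h)).
Proof.
move=> pf pg.
rewrite (_ : (fun h => _) = (fun h => f h + Num.max 0 (g h + - f h))); last first.
  by apply/funext => h; rewrite addr_maxr addr0 addrC subrK.
apply: piecewise_affineD => // h.
have [a [b H]] := piecewise_affineD pg (piecewise_affineN pf) h.
have [k0|k0] := leP 0 (g h + - f h); first exact: affine_germ_pos H.
by exists 0, 0; exact: affine_germ_neg H.
Qed.

Lemma piecewise_affine_min f g : piecewise_affine f -> piecewise_affine g ->
  piecewise_affine (fun h => Num.min (f h) (g h)).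
Proof.
move=> pf pg.
rewrite (_ : (fun h => _) = (fun h => - Num.max (- f h) (- g h))).
  by apply/piecewise_affineN/piecewise_affine_max; exact: piecewise_affineN.
by apply/funext => h; rewrite oppr_max !opprK.
Qed.

End PiecewiseAffine.

(** * Strand charts and surgery *)

Section Chart.
Variable R : realType.

(** The crossings of the axis with the two strands are at s = 0 and s = 1; the box leaves
    room for detours of the strands on either side. *)
Definition chart_domain (s h : R) : Prop := -2 <= s <= 4 /\ -12 <= h <= 12.

Definition chart_map (lx ly : seq ((R -> R) * (R -> R))) (s h : R) : R * R :=
  (sep lx s h, sep ly s h).

Definition chart_jacobian (lx ly : seq ((R -> R) * (R -> R))) (s h : R) : R :=
  sep (sep_ds lx) s h * sep (sep_dh ly) s h -
  sep (sep_ds ly) s h * sep (sep_dh lx) s h.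

(** A chart around the segment of a curve between two consecutive crossings: the segment
    lies on the line h = 0 (the axis), the two strands that it crosses are the lines s = 0
    and s = 1, and the curve meets the chart in these three strands only. *)
Record strand_chart (c : R -> R * R) := StrandChart {
  chart_x : seq ((R -> R) * (R -> R)) ;
  chart_y : seq ((R -> R) * (R -> R)) ;
  axis : R -> R ;
  lbase : R ; lscale : R ; rbase : R ; rscale : R ;
  chart_x_smooth : smooth_sep chart_x ;
  chart_y_smooth : smooth_sep chart_y ;
  axis_smooth : smooth axis ;
  axis_mono : (forall s s', s < s' -> axis s < axis s') \/
              (forall s s', s < s' -> axis s' < axis s) ;
  axis_short : `|axis 4 - axis (-2)| < 1 ;
  lscale_neq0 : lscale != 0 ; lscale_small : `|lscale| < 24^-1 ;
  rscale_neq0 : rscale != 0 ; rscale_small : `|rscale| < 24^-1 ;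
  chart_axis : forall s, chart_map chart_x chart_y s 0 = c (axis s) ;
  chart_left : forall h,
    chart_map chart_x chart_y 0 h = c (lbase + lscale * h) ;
  chart_right : forall h,
    chart_map chart_x chart_y 1 h = c (rbase + rscale * h) ;
  chart_inj : forall s h s' h', chart_domain s h -> chart_domain s' h' ->
    chart_map chart_x chart_y s h = chart_map chart_x chart_y s' h' ->
    s = s' /\ h = h' ;
  chart_jac : forall s h, chart_domain s h -> chart_jacobian chart_x chart_y s h != 0 ;
  chart_only : forall t s h, chart_domain s h ->
    c t = chart_map chart_x chart_y s h ->
    [\/ exists2 s', -2 <= s' <= 4 & same_point t (axis s'),
        exists2 h', -12 <= h' <= 12 & same_point t (lbase + lscale * h') |
        exists2 h', -12 <= h' <= 12 & same_point t (rbase + rscale * h')] ;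
  axis_left : forall s h, chart_domain s h ->
    ~ same_point (axis s) (lbase + lscale * h) ;
  axis_right : forall s h, chart_domain s h ->
    ~ same_point (axis s) (rbase + rscale * h) ;
  left_right : forall h h', -12 <= h <= 12 -> -12 <= h' <= 12 ->
    ~ same_point (lbase + lscale * h) (rbase + rscale * h')
}.

Variables (c : R -> R * R) (K : strand_chart c).
Implicit Types (s h t : R) (f g : R -> R).

Local Notation Psi := (chart_map (chart_x K) (chart_y K)).
Local Notation th := (axis K).
Local Notation lb := (lbase K).
Local Notation ls := (lscale K).
Local Notation rb := (rbase K).
Local Notation rs := (rscale K).

Definition on_left t h : Prop := -12 <= h <= 12 /\ same_point t (lb + ls * h).
Definition on_right t h : Prop := -12 <= h <= 12 /\ same_point t (rb + rs * h).
Definition on_axis t s : Prop := -2 <= s <= 4 /\ same_point t (th s).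
Definition off_chart t : Prop :=
  [/\ forall h, ~ on_left t h, forall h, ~ on_right t h & forall s, ~ on_axis t s].

Variant position t : Prop :=
| PosLeft h of on_left t h | PosRight h of on_right t h
| PosAxis s of on_axis t s | PosOff of off_chart t.

Lemma positionP t : position t.
Proof.
have [[h H]|nl] := pselect (exists h, on_left t h); first exact: PosLeft H.
have [[h H]|nr] := pselect (exists h, on_right t h); first exact: PosRight H.
have [[s H]|na] := pselect (exists s, on_axis t s); first exact: PosAxis H.
by apply: PosOff; split=> u H; [apply: nl|apply: nr|apply: na]; exists u.
Qed.

(** Height of a parameter on the left strand; meaningful when it lies in [-12, 12], where
    the smallness of [lscale] makes the centered representative the right one. *)
Definition left_height t := centered (t - lb) / ls.
Definition right_height t := centered (t - rb) / rs.

Lemma height_eq (b e t h : R) : e != 0 -> `|e| < 24^-1 -> -12 <= h <= 12 ->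
  same_point t (b + e * h) -> centered (t - b) / e = h.
Proof.
move=> e0 e1 h12 te; rewrite (@centeredE _ _ (e * h)).
- by rewrite mulrAC divff// mul1r.
- by have := same_pointD (- b) te; rewrite addrAC subrr add0r.
have h12' : `|h| <= 12 by rewrite ler_norml.
rewrite normrM (le_lt_trans (ler_wpM2l (normr_ge0 e) h12'))//; lra.
Qed.

Lemma on_height (b e t h : R) : e != 0 -> centered (t - b) / e = h ->
  same_point t (b + e * h).
Proof.
move=> e0 <-; rewrite mulrCA divff// mulr1 addrC.
have := same_pointD b (same_point_sym (centered_same (t - b))).
by rewrite subrK.
Qed.

Lemma left_heightE t h : on_left t h -> left_height t = h.
Proof. by case=> ? ?; apply: height_eq => //; [exact: lscale_neq0|exact: lscale_small]. Qed.

Lemma right_heightE t h : on_right t h -> right_height t = h.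
Proof. by case=> ? ?; apply: height_eq => //; [exact: rscale_neq0|exact: rscale_small]. Qed.

Lemma on_left_height t : -12 <= left_height t <= 12 -> on_left t (left_height t).
Proof. by move=> ?; split=> //; apply: on_height => //; exact: lscale_neq0. Qed.

Lemma on_right_height t : -12 <= right_height t <= 12 -> on_right t (right_height t).
Proof. by move=> ?; split=> //; apply: on_height => //; exact: rscale_neq0. Qed.

Lemma on_left_right t h h' : on_left t h -> ~ on_right t h'.
Proof.
case=> h12 th [h12' th']; apply: (@left_right c K h h') => //.
exact: same_point_trans (same_point_sym th) th'.
Qed.

Lemma on_axis_left t s h : on_axis t s -> ~ on_left t h.
Proof.
case=> s4 ts [h12 tb]; apply: (@axis_left c K s h) => //.
exact: same_point_trans (same_point_sym ts) tb.
Qed.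

Lemma on_axis_right t s h : on_axis t s -> ~ on_right t h.
Proof.
case=> s4 ts [h12 tb]; apply: (@axis_right c K s h) => //.
exact: same_point_trans (same_point_sym ts) tb.
Qed.

Lemma on_left_uniq t t' h : on_left t h -> on_left t' h -> same_point t t'.
Proof. by case=> _ ? [_ ?]; apply: same_point_trans (same_point_sym _); eassumption. Qed.

Lemma on_right_uniq t t' h : on_right t h -> on_right t' h -> same_point t t'.
Proof. by case=> _ ? [_ ?]; apply: same_point_trans (same_point_sym _); eassumption. Qed.

Lemma on_axis_uniq t t' s : on_axis t s -> on_axis t' s -> same_point t t'.
Proof. by case=> _ ? [_ ?]; apply: same_point_trans (same_point_sym _); eassumption. Qed.

(** The strands are redrawn as the graphs s = g h and s = f h, with the axis and the rest
    of the curve unchanged. *)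
Definition surgery f g t : R * R :=
  if -12 <= left_height t <= 12 then Psi (g (left_height t)) (left_height t)
  else if -12 <= right_height t <= 12 then Psi (f (right_height t)) (right_height t)
  else c t.

Lemma surgery_left f g t h : on_left t h -> surgery f g t = Psi (g h) h.
Proof. by move=> H; rewrite /surgery (left_heightE H); case: H => ->. Qed.

Lemma surgery_right f g t h : on_right t h -> surgery f g t = Psi (f h) h.
Proof.
move=> H; rewrite /surgery; case: ifPn => [/on_left_height/on_left_right/(_ H)//|_].
by rewrite (right_heightE H); case: H => ->.
Qed.

Hypothesis c_periodic : forall t, c (t + 1) = c t.

Lemma surgery_axis f g t s : on_axis t s -> surgery f g t = Psi s 0.
Proof.
move=> H; rewrite /surgery.
case: ifPn => [/on_left_height/(on_axis_left H)//|_].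
case: ifPn => [/on_right_height/(on_axis_right H)//|_].
by case: H => _ /(periodic_same c_periodic) ->; rewrite chart_axis.
Qed.

Lemma surgery_off f g t : off_chart t -> surgery f g t = c t.
Proof.
case=> nl nr _; rewrite /surgery.
case: ifPn => [/on_left_height/nl//|_].
by case: ifPn => [/on_right_height/nr//|_].
Qed.

Lemma off_chart_neq t s h : off_chart t -> chart_domain s h -> c t <> Psi s h.
Proof.
case=> nl nr na sh /(chart_only sh)[[s' ? ?]|[h' ? ?]|[h' ? ?]].
- exact: (na s').
- exact: (nl h').
- exact: (nr h').
Qed.

Lemma on_left_curve t h : on_left t h -> c t = Psi 0 h.
Proof. by case=> _ /(periodic_same c_periodic) ->; rewrite chart_left. Qed.

Lemma on_right_curve t h : on_right t h -> c t = Psi 1 h.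
Proof. by case=> _ /(periodic_same c_periodic) ->; rewrite chart_right. Qed.

Lemma surgery_id : surgery (cst 1) (cst 0) = c.
Proof.
apply/funext => t; case: (positionP t) => [h H|h H|s H|H].
- by rewrite (surgery_left _ _ H) (on_left_curve H).
- by rewrite (surgery_right _ _ H) (on_right_curve H).
- by rewrite (surgery_axis _ _ H); case: H => _ /(periodic_same c_periodic) ->; rewrite chart_axis.
- by rewrite surgery_off.
Qed.

Section Surgery.
Variables f g : R -> R.
Hypothesis f_range : forall h, -12 <= h <= 12 -> -2 <= f h <= 4.
Hypothesis g_range : forall h, -12 <= h <= 12 -> -2 <= g h <= 4.

Local Notation c' := (surgery f g).

Lemma surgery_periodic t : c' (t + 1) = c' t.
Proof.
have E b : centered (t + 1 - b) = centered (t - b).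
  by rewrite addrAC centered_periodic.
by rewrite /surgery /left_height /right_height !E c_periodic.
Qed.

Variant surgery_crossing t t' : Prop :=
| CrossOff of off_chart t & off_chart t' & crossing_pair c t t'
| CrossLR h of on_left t h & on_right t' h & f h = g h
| CrossRL h of on_right t h & on_left t' h & f h = g h
| CrossLA of on_left t 0 & on_axis t' (g 0)
| CrossAL of on_axis t (g 0) & on_left t' 0
| CrossRA of on_right t 0 & on_axis t' (f 0)
| CrossAR of on_axis t (f 0) & on_right t' 0.

Let dom_left t h : on_left t h -> chart_domain (g h) h.
Proof. by case=> h12 _; split=> //; exact: g_range. Qed.

Let dom_right t h : on_right t h -> chart_domain (f h) h.
Proof. by case=> h12 _; split=> //; exact: f_range. Qed.

Let dom_axis t s : on_axis t s -> chart_domain s 0.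
Proof. by case=> s4 _; split=> //; apply/andP; split; lra. Qed.

(** Since the chart is injective and nothing else enters it, the crossings inside are the
    solutions of equations between [f], [g] and 0, and those outside are the old ones. *)
Lemma surgery_crossingP t t' : crossing_pair c' t t' <-> surgery_crossing t t'.
Proof.
split=> [[nst]|].
- case: (positionP t) => [h H|h H|s H|H]; case: (positionP t') => [h' H'|h' H'|s' H'|H'].
  + rewrite (surgery_left _ _ H) (surgery_left _ _ H') => /(chart_inj (dom_left H) (dom_left H'))[_ E].
    by case: nst; apply: (@on_left_uniq _ _ h) => //; rewrite E.
  + rewrite (surgery_left _ _ H) (surgery_right _ _ H') => /(chart_inj (dom_left H) (dom_right H'))[E1 E2].
    by subst h'; apply: CrossLR H H' _.
  + rewrite (surgery_left _ _ H) (surgery_axis _ _ H') => /(chart_inj (dom_left H) (dom_axis H'))[E1 E2].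
    by subst h; subst s'; exact: CrossLA.
  + rewrite (surgery_left _ _ H) (surgery_off _ _ H') => /esym/(off_chart_neq H' (dom_left H)) [].
  + rewrite (surgery_right _ _ H) (surgery_left _ _ H') => /(chart_inj (dom_right H) (dom_left H'))[E1 E2].
    by subst h'; apply: CrossRL H H' _.
  + rewrite (surgery_right _ _ H) (surgery_right _ _ H') => /(chart_inj (dom_right H) (dom_right H'))[_ E].
    by case: nst; apply: (@on_right_uniq _ _ h) => //; rewrite E.
  + rewrite (surgery_right _ _ H) (surgery_axis _ _ H') => /(chart_inj (dom_right H) (dom_axis H'))[E1 E2].
    by subst h; subst s'; exact: CrossRA.
  + rewrite (surgery_right _ _ H) (surgery_off _ _ H') => /esym/(off_chart_neq H' (dom_right H)) [].
  + rewrite (surgery_axis _ _ H) (surgery_left _ _ H') => /(chart_inj (dom_axis H) (dom_left H'))[E1 E2].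
    by subst h'; subst s; exact: CrossAL.
  + rewrite (surgery_axis _ _ H) (surgery_right _ _ H') => /(chart_inj (dom_axis H) (dom_right H'))[E1 E2].
    by subst h'; subst s; exact: CrossAR.
  + rewrite (surgery_axis _ _ H) (surgery_axis _ _ H') => /(chart_inj (dom_axis H) (dom_axis H'))[E _].
    by case: nst; apply: (@on_axis_uniq _ _ s) => //; rewrite E.
  + rewrite (surgery_axis _ _ H) (surgery_off _ _ H') => /esym/(off_chart_neq H' (dom_axis H)) [].
  + rewrite (surgery_off _ _ H) (surgery_left _ _ H') => /(off_chart_neq H (dom_left H')) [].
  + rewrite (surgery_off _ _ H) (surgery_right _ _ H') => /(off_chart_neq H (dom_right H')) [].
  + rewrite (surgery_off _ _ H) (surgery_axis _ _ H') => /(off_chart_neq H (dom_axis H')) [].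
  + by rewrite !surgery_off// => E; exact: CrossOff.
- have tr u u' : same_point u u' -> forall v, same_point u v -> same_point u' v.
    by move=> uu v; exact/same_point_trans/same_point_sym.
  have tl u u' h : same_point u u' -> on_left u h -> on_left u' h.
    by move=> uu [h12 E]; split=> //; exact: tr E.
  have tR u u' h : same_point u u' -> on_right u h -> on_right u' h.
    by move=> uu [h12 E]; split=> //; exact: tr E.
  case=> [H H' [n E]|h H H' E|h H H' E|H H'|H H'|H H'|H H']; split.
  + by [].
  + by rewrite !surgery_off.
  + by move=> /tl/(_ H)/on_left_right/(_ H').
  + by rewrite (surgery_left _ _ H) (surgery_right _ _ H') E.
  + by move=> /tR/(_ H)/(on_left_right H').
  + by rewrite (surgery_right _ _ H) (surgery_left _ _ H') E.
  + by move=> /tl/(_ H)/(on_axis_left H').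
  + by rewrite (surgery_left _ _ H) (surgery_axis _ _ H').
  + by move=> /same_point_sym/tl/(_ H')/(on_axis_left H).
  + by rewrite (surgery_left _ _ H') (surgery_axis _ _ H).
  + by move=> /tR/(_ H)/(on_axis_right H').
  + by rewrite (surgery_right _ _ H) (surgery_axis _ _ H').
  + by move=> /same_point_sym/tR/(_ H')/(on_axis_right H).
  + by rewrite (surgery_right _ _ H') (surgery_axis _ _ H).
Qed.

End Surgery.
End Chart.

(** * Germs of curves in a chart *)

Section Finiteness.
Variable R : realType.
Implicit Types (f : R -> R) (A : set R) (t : R).

Definition straight_at f h := exists a, affine_germ f h a a.

(** Each point has a neighbourhood in which it is the only possible breakpoint; finitely
    many of these cover the segment. *)
Lemma finite_breakpoints f (l r : R) : piecewise_affine f ->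
  finite_set [set h | l <= h <= r /\ ~ straight_at f h].
Proof.
move=> pf.
have isolated x : exists e : R, 0 < e /\ forall u, `|u - x| < e -> u <> x -> straight_at f u.
  have [a [b [e e0 fE]]] := pf x; exists e; split=> // u ue ux.
  have [xu|xu] := ltP x u.
    exists b; exists (Num.min (u - x) (x + e - u)).
      by rewrite lt_min subr_gt0 xu /=; move: ue; rewrite ltr_norml => /andP[? ?]; lra.
    move=> v /andP[v0 vm].
    have m1 : Num.min (u - x) (x + e - u) <= u - x by rewrite ge_min lexx.
    have m2 : Num.min (u - x) (x + e - u) <= x + e - u by rewrite ge_min lexx orbT.
    have E w : 0 <= w <= e -> f (x + w) = f x + b * w by move=> /fE[].
    have -> : u - v = x + (u - x - v) by ring.
    have -> : u + v = x + (u - x + v) by ring.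
    have {2 4}-> : u = x + (u - x) by ring.
    rewrite !E; [by split; ring|by apply/andP; split; lra ..].
  have {}xu : u < x by rewrite lt_neqAle xu andbT; apply/eqP.
  exists a; exists (Num.min (x - u) (e - x + u)).
    by rewrite lt_min subr_gt0 xu /=; move: ue; rewrite ltr_norml => /andP[? ?]; lra.
  move=> v /andP[v0 vm].
  have m1 : Num.min (x - u) (e - x + u) <= x - u by rewrite ge_min lexx.
  have m2 : Num.min (x - u) (e - x + u) <= e - x + u by rewrite ge_min lexx orbT.
  have E w : 0 <= w <= e -> f (x - w) = f x - a * w by move=> /fE[].
  have -> : u - v = x - (x - u + v) by ring.
  have -> : u + v = x - (x - u - v) by ring.
  have {2 4}-> : u = x - (x - u) by ring.
  rewrite !E; [by split; ring|by apply/andP; split; lra ..].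
have [e eP] := choice isolated.
have := @segment_compact R l r; rewrite compact_cover.
move=> /(_ R setT (fun x => ball x (e x)))[].
- by move=> x _; apply: ball_open; exact: (eP x).1.
- by move=> x _; exists x => //; apply: ballxx; exact: (eP x).1.
move=> F _ cF; apply: sub_finite_set (finite_fset F).
move=> h /= [lhr nh]; have [x xF] := cF h lhr.
rewrite /ball/= distrC => hx; have [->//|/eqP hnx] := eqVneq h x.
by case: nh; apply: (eP x).2.
Qed.

Definition fracpart t : R := t - (Num.floor t)%:~R.

Lemma fracpart_same t t' : 0 <= t < 1 -> same_point t t' -> t = fracpart t'.
Proof.
move=> /andP[t0 t1] tt'; apply: same_point_lt1.
  apply: same_point_trans tt' _; apply/same_pointP.
  by exists (Num.floor t'); rewrite /fracpart subrK.
have /andP[] := floor_itv t'; rewrite intrD /fracpart => *.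
by rewrite ltr_norml; apply/andP; split; lra.
Qed.

Lemma finite_params (A B : set R) : finite_set B ->
  (forall t, A t -> 0 <= t < 1 /\ exists2 u, B u & same_point t u) -> finite_set A.
Proof.
move=> fB AB; apply: (@sub_finite_set _ _ (fracpart @` B)); last exact: finite_image.
move=> t /AB[t01 [u Bu tu]]; exists u => //.
by rewrite -(fracpart_same t01 tu).
Qed.

End Finiteness.

Section ChartGerms.
Variable R : realType.
Variables (c : R -> R * R) (K : strand_chart c).
Implicit Types (s h t : R) (f g : R -> R).

Local Notation Psi := (chart_map (chart_x K) (chart_y K)).
Local Notation jac := (chart_jacobian (chart_x K) (chart_y K)).
Local Notation th := (axis K).

Definition chart_ds s h : R * R := (sep (sep_ds (chart_x K)) s h, sep (sep_ds (chart_y K)) s h).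
Definition chart_dh s h : R * R := (sep (sep_dh (chart_x K)) s h, sep (sep_dh (chart_y K)) s h).

(** The velocity of a curve of the chart that climbs at unit speed with slope [a]. *)
Definition slanted (a s h : R) : R * R :=
  (a * (chart_ds s h).1 + (chart_dh s h).1, a * (chart_ds s h).2 + (chart_dh s h).2).

Lemma slanted_curve (k a s h t : R) :
  let x u := sep (chart_x K) (s + a * k * (u - t)) (h + k * (u - t)) in
  let y u := sep (chart_y K) (s + a * k * (u - t)) (h + k * (u - t)) in
  [/\ smooth x, smooth y &
    velocity x y t = (k * (slanted a s h).1, k * (slanted a s h).2)].
Proof.
move=> x y.
have sa (p q : R) : smooth (fun u => p + q * (u - t)).
  rewrite (_ : (fun u => _) = (fun u => p - q * t + q * u)); first exact: smooth_affine.
  by apply/funext => u; ring.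
have da (p q : R) : is_derive t 1 (fun u => p + q * (u - t)) q.
  have := smooth_is_derive (sa p q) t; congr is_derive.
  rewrite (_ : (fun u => _) = (fun u => p - q * t + q * u)); last first.
    by apply/funext => u; ring.
  rewrite derive1E; apply: derive_val.
  have := is_deriveD (is_derive_cst (p - q * t) t 1) (is_deriveM (is_derive_cst q t 1) (is_derive_id t 1)).
  by congr is_derive; rewrite /GRing.scale /=; ring.
split.
- apply: smooth_sep_curve; [exact: chart_x_smooth|exact: sa|exact: sa].
- apply: smooth_sep_curve; [exact: chart_y_smooth|exact: sa|exact: sa].
have dx := is_derive_sep_curve (chart_x_smooth K) (da s (a * k)) (da h k).
have dy := is_derive_sep_curve (chart_y_smooth K) (da s (a * k)) (da h k).
rewrite /velocity !derive1E /x /y (@derive_val _ _ _ _ _ _ _ dx) (@derive_val _ _ _ _ _ _ _ dy).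
rewrite !subrr !mulr0 !addr0 /slanted /=.
by congr pair; ring.
Qed.

Lemma slanted_cross a b s h :
  (slanted a s h).1 * (slanted b s h).2 - (slanted a s h).2 * (slanted b s h).1 =
  (a - b) * jac s h.
Proof. by rewrite /slanted /chart_jacobian /=; ring. Qed.

Lemma slanted_neq0 k a s h : chart_domain s h -> k != 0 ->
  (k * (slanted a s h).1, k * (slanted a s h).2) <> (0, 0).
Proof.
move=> sh k0 H.
have [E1 E2] : (slanted a s h).1 = 0 /\ (slanted a s h).2 = 0.
  by case: H => /eqP + /eqP; rewrite !mulf_eq0 !(negbTE k0) !orFb => /eqP ? /eqP ?.
have := slanted_cross (a + 1) a s h; rewrite E1 E2 !mulr0 subrr => /esym/eqP.
by rewrite mulf_eq0 (negbTE (chart_jac K sh)) orbF addrC addKr oner_eq0.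
Qed.

Definition germ_curve f (k h t u : R) : R * R := Psi (f (h + k * (u - t))) (h + k * (u - t)).

(** Both one-sided velocities climb in the chart: up to the sign of the Jacobian, the
    functional that vanishes in the direction of s is positive on them. *)
Lemma germ_curve_immersed f k h t : k != 0 -> chart_domain (f h) h ->
  (exists a b, affine_germ f h a b) -> immersed_at (germ_curve f k h t) t.
Proof.
move=> k0 dom [a [b [e e0 fE]]].
pose a' := if 0 < k then a else b; pose b' := if 0 < k then b else a.
have [sx1 sy1 v1] := slanted_curve k a' (f h) h t.
have [sx2 sy2 v2] := slanted_curve k b' (f h) h t.
have ke : 0 < e / `|k| by rewrite divr_gt0// normr_gt0.
apply: (immersed_at_intro ke sx1 sy1 sx2 sy2).
- move=> u /andP[u1 u2]; rewrite /germ_curve /chart_map.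
  suff -> : f (h + k * (u - t)) = f h + a' * k * (u - t) by [].
  have tu : 0 <= t - u <= e / `|k| by apply/andP; split; lra.
  move: tu; rewrite ler_pdivlMr ?normr_gt0// => /andP[tu0 tue].
  rewrite /a'; case: ltP => k1.
    have -> : h + k * (u - t) = h - k * (t - u) by ring.
    have [|-> _] := fE (k * (t - u)); last by ring.
    by rewrite mulr_ge0 ?(ltW k1)//= mulrC -[X in _ * X]gtr0_norm.
  have -> : h + k * (u - t) = h + (- k) * (t - u) by ring.
  have [|_ ->] := fE (- k * (t - u)); last by ring.
  by rewrite mulr_ge0 ?oppr_ge0//= mulrC -(ler0_norm k1).
- move=> u /andP[u1 u2]; rewrite /germ_curve /chart_map.
  suff -> : f (h + k * (u - t)) = f h + b' * k * (u - t) by [].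
  have tu : 0 <= u - t <= e / `|k| by apply/andP; split; lra.
  move: tu; rewrite ler_pdivlMr ?normr_gt0// => /andP[tu0 tue].
  rewrite /b'; case: ltP => k1.
    have [|_ ->] := fE (k * (u - t)); last by ring.
    by rewrite mulr_ge0 ?(ltW k1)//= mulrC -[X in _ * X]gtr0_norm.
  have -> : h + k * (u - t) = h - (- k) * (u - t) by ring.
  have [|-> _] := fE (- k * (u - t)); last by ring.
  by rewrite mulr_ge0 ?oppr_ge0//= mulrC -(ler0_norm k1).
- by rewrite v1; exact: slanted_neq0.
- by rewrite v2; exact: slanted_neq0.
- rewrite v1 v2; have J0 := chart_jac K dom.
  pose w := k * jac (f h) h.
  apply: (@not_opposite _ _ _ (- (chart_ds (f h) h).2 * w) ((chart_ds (f h) h).1 * w)).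
    rewrite (_ : _ + _ = w ^+ 2); first by rewrite exprn_even_gt0//= mulf_neq0.
    by rewrite /w /slanted /chart_jacobian /=; ring.
  rewrite (_ : _ + _ = w ^+ 2); first by rewrite exprn_even_gt0//= mulf_neq0.
  by rewrite /w /slanted /chart_jacobian /=; ring.
Qed.

Lemma germ_curve_smooth f k h t a : k != 0 -> chart_domain (f h) h ->
  affine_germ f h a a ->
  smooth_at (germ_curve f k h t) t /\
  velocity (fun u => (germ_curve f k h t u).1) (fun u => (germ_curve f k h t u).2) t =
    (k * (slanted a (f h) h).1, k * (slanted a (f h) h).2).
Proof.
move=> k0 dom [e e0 fE].
have [sx sy v] := slanted_curve k a (f h) h t.
have ke : 0 < e / `|k| by rewrite divr_gt0// normr_gt0.
have near_eq : \forall u \near t, f (h + k * (u - t)) = f h + a * k * (u - t).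
  apply: (segment_near ke) => u /andP[u1 u2].
  have : `|k * (u - t)| <= e.
    rewrite normrM mulrC -ler_pdivlMr ?normr_gt0// ler_norml.
    by apply/andP; split; lra.
  have [k1|k1] := leP 0 (k * (u - t)).
    rewrite ger0_norm// => k2; have [|_ ->] := fE (k * (u - t)); last by ring.
    by rewrite k1.
  rewrite ltr0_norm// => k2; have [|H _] := fE (- (k * (u - t))).
    by rewrite k2 oppr_ge0 ltW.
  by rewrite -[k * (u - t)]opprK H; ring.
split.
  apply: (smooth_at_intro sx sy); last by rewrite v; exact: slanted_neq0.
  by near=> u; rewrite /germ_curve /chart_map; have -> : f (h + k * (u - t)) = f h + a * k * (u - t) by near: u.
rewrite -v; apply: velocity_eq.
  by near=> u; rewrite /germ_curve /chart_map; have -> : f (h + k * (u - t)) = f h + a * k * (u - t) by near: u.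
by near=> u; rewrite /germ_curve /chart_map; have -> : f (h + k * (u - t)) = f h + a * k * (u - t) by near: u.
Unshelve. all: by end_near. Qed.

End ChartGerms.

(** * Regularity of the curve after surgery *)

Lemma curve_periodic (R : realType) (D : diagram R) t : D (t + 1) = D t.
Proof. by have [+ _ _] := curve_immersion D; apply. Qed.

Lemma level_same (R : realType) (D : diagram R) s t : same_point s t -> level D s = level D t.
Proof. by apply: periodic_same; exact: level_periodic. Qed.

(** Conditions on the profiles under which surgery yields a diagram: straight strands near
    both ends of the chart, transverse intersections away from breakpoints, and none of
    these on the axis. The list [zs] makes their finiteness immediate. *)
Record admissible (R : realType) (f g : R -> R) (zs : seq R) : Prop := Admissible {
  adm_f : piecewise_affine f ;
  adm_g : piecewise_affine g ;
  adm_f_range : forall h, -12 <= h <= 12 -> -2 <= f h <= 4 ;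
  adm_g_range : forall h, -12 <= h <= 12 -> -2 <= g h <= 4 ;
  adm_f_end : forall h, 11 <= `|h| -> f h = 1 ;
  adm_g_end : forall h, 11 <= `|h| -> g h = 0 ;
  adm_f0 : straight_at f 0 ;
  adm_g0 : straight_at g 0 ;
  adm_f0_neq0 : f 0 != 0 ;
  adm_g0_eq0 : g 0 = 0 ;
  adm_meet : forall h, -12 <= h <= 12 -> f h = g h ->
    h \in zs /\ exists a b, [/\ a != b, affine_germ f h a a & affine_germ g h b b]
}.

Section SurgeryDiagram.
Variables (R : realType) (D : diagram R) (K : strand_chart D).
Hypothesis D_smooth : forall t, smooth_at D t.
Variables (f g : R -> R) (zs : seq R).
Hypothesis adm : admissible f g zs.
Implicit Types (s h t u : R).

Local Notation Psi := (chart_map (chart_x K) (chart_y K)).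
Local Notation th := (axis K).
Local Notation lb := (lbase K).
Local Notation ls := (lscale K).
Local Notation rb := (rbase K).
Local Notation rs := (rscale K).
Local Notation per := (curve_periodic D).
Local Notation c' := (surgery K f g).

Lemma nearby_height (b e t h : R) : e != 0 -> -12 < h < 12 ->
  same_point t (b + e * h) -> \forall u \near t,
  -12 <= h + e^-1 * (u - t) <= 12 /\ same_point u (b + e * (h + e^-1 * (u - t))).
Proof.
move=> e0 /andP[h1 h2] tb.
pose d := `|e| * Num.min (h + 12) (12 - h).
have d0 : 0 < d by rewrite mulr_gt0 ?normr_gt0// lt_min; apply/andP; split; lra.
apply: (segment_near d0) => u /andP[u1 u2].
have m1 : Num.min (h + 12) (12 - h) <= h + 12 by rewrite ge_min lexx.
have m2 : Num.min (h + 12) (12 - h) <= 12 - h by rewrite ge_min lexx orbT.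
have : `|e^-1 * (u - t)| <= Num.min (h + 12) (12 - h).
  rewrite normrM normfV mulrC ler_pdivrMr ?normr_gt0// mulrC -/d ler_norml.
  by apply/andP; split; lra.
rewrite ler_norml => /andP[? ?]; split; first by apply/andP; split; lra.
rewrite mulrDr mulrA mulfV// mul1r addrA.
by have := same_pointD (u - t) tb; rewrite (_ : t + (u - t) = u) //; ring.
Qed.

Lemma near_left t h : on_left K t h -> -12 < h < 12 ->
  \forall u \near t, germ_curve K g ls^-1 h t u = c' u.
Proof.
move=> [_ tb] h12; near=> u; rewrite (@surgery_left _ _ K f g u (h + ls^-1 * (u - t)))//.
near: u; exact: nearby_height (lscale_neq0 K) h12 tb.
Unshelve. all: by end_near. Qed.

Lemma near_right t h : on_right K t h -> -12 < h < 12 ->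
  \forall u \near t, germ_curve K f rs^-1 h t u = c' u.
Proof.
move=> [_ tb] h12; near=> u; rewrite (@surgery_right _ _ K f g u (h + rs^-1 * (u - t)))//.
near: u; exact: nearby_height (rscale_neq0 K) h12 tb.
Unshelve. all: by end_near. Qed.

(** At the ends of the strands the new profiles agree with the old ones, so the curve is
    unchanged there as well. *)
Lemma near_unchanged t : (forall h, -12 < h < 12 -> ~ on_left K t h) ->
  (forall h, -12 < h < 12 -> ~ on_right K t h) -> \forall u \near t, D u = c' u.
Proof.
move=> nl nr.
have ls0 : 0 < `|ls| by rewrite normr_gt0 lscale_neq0.
have rs0 : 0 < `|rs| by rewrite normr_gt0 rscale_neq0.
have inner (b e u h : R) : e != 0 -> t - `|e| < u < t + `|e| -> `|h| < 11 ->
    same_point u (b + e * h) -> exists2 h', -12 < h' < 12 & same_point t (b + e * h').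
  move=> e0 /andP[u1 u2] h11 ub; exists (h + e^-1 * (t - u)).
    have : `|e^-1 * (t - u)| <= 1.
      rewrite normrM normfV mulrC ler_pdivrMr ?normr_gt0// mul1r ler_norml.
      by apply/andP; split; lra.
    move: h11; rewrite ltr_norml ler_norml => /andP[? ?] /andP[? ?].
    by apply/andP; split; lra.
  rewrite mulrDr mulrA mulfV// mul1r addrA.
  by have := same_pointD (t - u) ub; rewrite (_ : u + (t - u) = t) //; ring.
have m0 : 0 < Num.min `|ls| `|rs| by rewrite lt_min ls0.
have m1 : Num.min `|ls| `|rs| <= `|ls| by rewrite ge_min lexx.
have m2 : Num.min `|ls| `|rs| <= `|rs| by rewrite ge_min lexx orbT.
apply: (segment_near m0) => u /andP[u1 u2].
case: (positionP K u) => [h H|h H|s H|H].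
- rewrite (surgery_left _ _ H) (on_left_curve per H).
  have [h11|h11] := leP 11 `|h|; first by rewrite (adm_g_end adm).
  case: H => _ ub; have [||h' h'12 tb] := inner lb ls u h _ _ h11 ub.
  + exact: lscale_neq0.
  + by apply/andP; split; lra.
  case: (nl h') => //; split=> //; case/andP: h'12 => *; apply/andP; split; lra.
- rewrite (surgery_right _ _ H) (on_right_curve per H).
  have [h11|h11] := leP 11 `|h|; first by rewrite (adm_f_end adm).
  case: H => _ ub; have [||h' h'12 tb] := inner rb rs u h _ _ h11 ub.
  + exact: rscale_neq0.
  + by apply/andP; split; lra.
  case: (nr h') => //; split=> //; case/andP: h'12 => *; apply/andP; split; lra.
- rewrite (surgery_axis per _ _ H).
  by case: H => _ /(periodic_same per) ->; rewrite chart_axis.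
- by rewrite surgery_off.
Qed.

Let dom_left t h : on_left K t h -> chart_domain (g h) h.
Proof. by case=> h12 _; split=> //; exact: (adm_g_range adm). Qed.

Let dom_right t h : on_right K t h -> chart_domain (f h) h.
Proof. by case=> h12 _; split=> //; exact: (adm_f_range adm). Qed.

Let lsV : ls^-1 != 0. Proof. by rewrite invr_neq0// lscale_neq0. Qed.
Let rsV : rs^-1 != 0. Proof. by rewrite invr_neq0// rscale_neq0. Qed.

Lemma surgery_immersed t : immersed_at c' t.
Proof.
have [[h h12 H]|nl] := pselect (exists2 h, -12 < h < 12 & on_left K t h).
  apply: immersed_at_near (near_left H h12) _.
  by apply: germ_curve_immersed => //; [exact: (dom_left H)|exact: (adm_g adm)].
have [[h h12 H]|nr] := pselect (exists2 h, -12 < h < 12 & on_right K t h).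
  apply: immersed_at_near (near_right H h12) _.
  by apply: germ_curve_immersed => //; [exact: (dom_right H)|exact: (adm_f adm)].
have near_eq : \forall u \near t, D u = c' u.
  by apply: near_unchanged => h h12 H; [apply: nl|apply: nr]; exists h.
by apply: immersed_at_near near_eq _; apply: smooth_at_immersed.
Qed.

Lemma surgery_smooth_left t h : on_left K t h -> -12 < h < 12 -> straight_at g h ->
  smooth_at c' t.
Proof.
move=> H h12 [a ga]; apply: smooth_at_near (near_left H h12) _.
by have [] := germ_curve_smooth K t lsV (dom_left H) ga.
Qed.

Lemma surgery_smooth_right t h : on_right K t h -> -12 < h < 12 -> straight_at f h ->
  smooth_at c' t.
Proof.
move=> H h12 [a fa]; apply: smooth_at_near (near_right H h12) _.
by have [] := germ_curve_smooth K t rsV (dom_right H) fa.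
Qed.

Lemma surgery_smooth_rest t : (forall h, -12 < h < 12 -> ~ on_left K t h) ->
  (forall h, -12 < h < 12 -> ~ on_right K t h) -> smooth_at c' t.
Proof.
move=> nl nr; apply: smooth_at_near (near_unchanged nl nr) _; exact: D_smooth.
Qed.

Lemma surgery_piecewise_smooth : piecewise_smooth_immersion c'.
Proof.
split; [exact: surgery_periodic per _ _|exact: surgery_immersed|].
apply: (@finite_params _ _
  ((fun h => lb + ls * h) @` [set h | -12 <= h <= 12 /\ ~ straight_at g h] `|`
   (fun h => rb + rs * h) @` [set h | -12 <= h <= 12 /\ ~ straight_at f h])).
  rewrite finite_setU; split; apply/finite_image/finite_breakpoints.
    exact: (adm_g adm).
  exact: (adm_f adm).
move=> t /= [t01 nsm]; split=> //.
have [[h h12 H]|nl] := pselect (exists2 h, -12 < h < 12 & on_left K t h).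
  exists (lb + ls * h); last by case: H.
  left; exists h => //; split; first by case: H.
  by apply: contra_not nsm; exact: surgery_smooth_left H h12.
have [[h h12 H]|nr] := pselect (exists2 h, -12 < h < 12 & on_right K t h).
  exists (rb + rs * h); last by case: H.
  right; exists h => //; split; first by case: H.
  by apply: contra_not nsm; exact: surgery_smooth_right H h12.
by case: nsm; apply: surgery_smooth_rest => h h12 H; [apply: nl|apply: nr]; exists h.
Qed.

Local Notation vel c t := (velocity (fun u => (c u).1) (fun u => (c u).2) t).

Lemma vel_near (p q : R -> R * R) t : (\forall u \near t, p u = q u) -> vel p t = vel q t.
Proof.
by move=> pq; apply: velocity_eq; near=> u; have -> : p u = q u by near: u.
Unshelve. all: by end_near. Qed.

Lemma vel_left t h a : on_left K t h -> -12 < h < 12 -> affine_germ g h a a ->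
  vel c' t = (ls^-1 * (slanted K a (g h) h).1, ls^-1 * (slanted K a (g h) h).2).
Proof.
move=> H h12 ga; rewrite -(vel_near (near_left H h12)).
by have [] := germ_curve_smooth K t lsV (dom_left H) ga.
Qed.

Lemma vel_right t h a : on_right K t h -> -12 < h < 12 -> affine_germ f h a a ->
  vel c' t = (rs^-1 * (slanted K a (f h) h).1, rs^-1 * (slanted K a (f h) h).2).
Proof.
move=> H h12 fa; rewrite -(vel_near (near_right H h12)).
by have [] := germ_curve_smooth K t rsV (dom_right H) fa.
Qed.

Lemma vel_axis t s : on_axis K t s ->
  (vel c' t).1 * derive1 th s = (chart_ds K s 0).1 /\
  (vel c' t).2 * derive1 th s = (chart_ds K s 0).2.
Proof.
move=> H; have near_eq : \forall u \near t, D u = c' u.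
  by apply: near_unchanged => h _; [exact: on_axis_left H|exact: on_axis_right H].
rewrite -(vel_near near_eq).
have [sx sy _] := smooth_coordinates D_smooth.
case: H => _ /same_pointP[k tE].
have shift : vel D t = vel D (th s).
  have E (x : R -> R) : smooth x -> (forall u, x (u + 1) = x u) ->
      derive1 x t = derive1 x (th s).
    move=> smx x1; rewrite tE.
    have d : is_derive (th s) 1 (fun u => x (u + k%:~R)) (derive1 x (th s + k%:~R) * (1 + 0)).
      by apply: is_derive1_comp; exact: smooth_is_derive.
    have := @derive_val _ _ _ _ _ _ _ d; rewrite addr0 mulr1 => <-; rewrite -derive1E.
    have -> : (fun u => x (u + k%:~R)) = x by apply/funext => u; exact: periodic_int x1 u k.
    by [].
  by rewrite /velocity !E// => u; rewrite per.
rewrite shift /velocity /=.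
have key (x : R -> R) (l : seq ((R -> R) * (R -> R))) : smooth x -> smooth_sep l ->
    (forall s, sep l s 0 = x (th s)) -> derive1 x (th s) * derive1 th s = sep (sep_ds l) s 0.
  move=> smx sl lx.
  have d1 : is_derive s 1 (fun u => x (th u)) (derive1 x (th s) * derive1 th s).
    apply: is_derive1_comp; first exact: smooth_is_derive smx _.
    by apply: smooth_is_derive; exact: axis_smooth.
  have d2 := is_derive_sep_curve sl (is_derive_id s 1) (is_derive_cst (0 : R) s 1).
  rewrite -(@derive_val _ _ _ _ _ _ _ d1).
  rewrite (_ : (fun u => x (th u)) = (fun u => sep l (id u) (cst 0 u))); last first.
    by apply/funext => u; rewrite /= lx.
  by rewrite (@derive_val _ _ _ _ _ _ _ d2) mulr1 mulr0 addr0.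
split; apply: key => //.
- exact: chart_x_smooth.
- by move=> u; have := congr1 fst (chart_axis K u).
- exact: chart_y_smooth.
- by move=> u; have := congr1 snd (chart_axis K u).
Qed.

End SurgeryDiagram.

(** * Genericity and levels after surgery *)

Section SurgeryGeneric.
Variables (R : realType) (D : diagram R) (K : strand_chart D).
Hypothesis D_smooth : forall t, smooth_at D t.
Implicit Types (s h t u : R).

Local Notation Psi := (chart_map (chart_x K) (chart_y K)).
Local Notation th := (axis K).
Local Notation lb := (lbase K).
Local Notation ls := (lscale K).
Local Notation rb := (rbase K).
Local Notation rs := (rscale K).
Local Notation per := (curve_periodic D).

Lemma on_axis_inj t s s' : on_axis K t s -> on_axis K t s' -> s = s'.
Proof.
move=> [s4 ts] [s4' ts']; have [] // := @chart_inj _ _ K s 0 s' 0.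
- by split=> //; apply/andP; split; lra.
- by split=> //; apply/andP; split; lra.
- by rewrite !chart_axis; apply: (periodic_same per); apply: same_point_trans (same_point_sym ts) ts'.
Qed.

Lemma off_left t h : off_chart K t -> ~ on_left K t h.
Proof. by case. Qed.
Lemma off_right t h : off_chart K t -> ~ on_right K t h.
Proof. by case. Qed.
Lemma off_axis t s : off_chart K t -> ~ on_axis K t s.
Proof. by case. Qed.

Variables (f g : R -> R) (zs : seq R).
Hypothesis adm : admissible f g zs.
Local Notation c' := (surgery K f g).

Let crossP t t' := @surgery_crossingP _ _ K per f g (adm_f_range adm) (adm_g_range adm) t t'.

Ltac clash := exfalso; match goal with
 | H1 : on_left _ ?t _, H2 : on_right _ ?t _ |- _ => exact: (on_left_right H1 H2)
 | H1 : on_left _ ?t _, H2 : on_axis _ ?t _ |- _ => exact: (on_axis_left H2 H1)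
 | H1 : on_right _ ?t _, H2 : on_axis _ ?t _ |- _ => exact: (on_axis_right H2 H1)
 | H1 : off_chart _ ?t, H2 : on_left _ ?t _ |- _ => exact: (off_left H1 H2)
 | H1 : off_chart _ ?t, H2 : on_right _ ?t _ |- _ => exact: (off_right H1 H2)
 | H1 : off_chart _ ?t, H2 : on_axis _ ?t _ |- _ => exact: (off_axis H1 H2)
 end.

Lemma f0_neq_g0 : f 0 <> g 0.
Proof. by rewrite (adm_g0_eq0 adm); apply/eqP; exact: (adm_f0_neq0 adm). Qed.

(** Two strands of the chart and the axis would have to meet at height 0, which
    [f 0 <> g 0] excludes. *)
Lemma surgery_no_triple r s t : c' r = c' s -> c' s = c' t ->
  [\/ same_point r s, same_point s t | same_point r t].
Proof.
move=> rs' st'.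
have [?|nrs] := pselect (same_point r s); first exact: Or31.
have [?|nst] := pselect (same_point s t); first exact: Or32.
have [?|nrt] := pselect (same_point r t); first exact: Or33.
have f0g0 := f0_neq_g0.
have lu u u' h h' v : on_left K u h -> on_left K u' h' -> on_right K v h -> on_right K v h' ->
    same_point u u'.
  move=> H1 H2 /right_heightE E1 /right_heightE E2.
  have E : h = h' by rewrite -E1.
  by rewrite E in H1; exact: on_left_uniq H1 H2.
have ru u u' h h' v : on_right K u h -> on_right K u' h' -> on_left K v h -> on_left K v h' ->
    same_point u u'.
  move=> H1 H2 /left_heightE E1 /left_heightE E2.
  have E : h = h' by rewrite -E1.
  by rewrite E in H1; exact: on_right_uniq H1 H2.
have l0 u h : on_left K u h -> on_left K u 0 -> f h = g h -> False.
  by move=> /left_heightE <- /left_heightE ->.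
have r0 u h : on_right K u h -> on_right K u 0 -> f h = g h -> False.
  by move=> /right_heightE <- /right_heightE ->.
have a0 u : on_axis K u (f 0) -> on_axis K u (g 0) -> False.
  by move=> H1 H2; apply: f0g0; exact: on_axis_inj H1 H2.
have /crossP RS : crossing_pair c' r s by split.
have /crossP ST : crossing_pair c' s t by split.
case: RS => [H H' [n E]|h H H' E|h H H' E|H H'|H H'|H H'|H H'];
case: ST => [G G' [m F]|k G G' F|k G G' F|G G'|G G'|G G'|G G']; try clash.
- by have [gen _ _] := curve_generic D; exact: gen E F.
- by case: nrt; exact: (lu _ _ _ _ _ H G' H' G).
- by case: (r0 _ _ H' G E).
- by case: nrt; exact: (ru _ _ _ _ _ H G' H' G).
- by case: (l0 _ _ H' G E).
- by case: nrt; exact: on_left_uniq H G'.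
- by case: (a0 _ G H').
- by case: (l0 _ _ G H' F).
- by case: nrt; exact: on_axis_uniq H G'.
- by case: (a0 _ H' G).
- by case: nrt; exact: on_right_uniq H G'.
- by case: (r0 _ _ G H' F).
- by case: nrt; exact: on_axis_uniq H G'.
Qed.

Lemma surgery_crossings_finite : finite_set [set t | 0 <= t < 1 /\ at_crossing c' t].
Proof.
apply: (@finite_params _ _ ([set t | 0 <= t < 1 /\ at_crossing D t] `|`
  ((fun h => lb + ls * h) @` [set` 0 :: zs] `|` (fun h => rb + rs * h) @` [set` 0 :: zs]
   `|` [set` [:: th (f 0); th (g 0)]]))).
  rewrite !finite_setU; split; first by have [] := curve_generic D.
  by do !split; rewrite ?finite_seq//; apply: finite_image; exact: finite_seq.
have meet h u : on_left K u h \/ on_right K u h -> f h = g h -> h \in 0 :: zs.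
  move=> H; have h12 : -12 <= h <= 12 by case: H => -[].
  by move=> /(adm_meet adm h12)[hz _]; rewrite in_cons hz orbT.
have z0 : (0 : R) \in 0 :: zs by rewrite mem_head.
move=> t /= [t01 [s /crossP st]]; split=> //.
case: st => [H H' n|h H H' E|h H H' E|H H'|H H'|H H'|H H'].
- by exists t; [left; split; [exact: t01|exists s]|exact: same_point_refl].
- exists (rb + rs * h); last by case: H'.
  by right; left; right; exists h => //=; apply: meet E; right; exact: H'.
- exists (lb + ls * h); last by case: H'.
  by right; left; left; exists h => //=; apply: meet E; left; exact: H'.
- exists (th (g 0)); last by case: H'.
  by right; right; rewrite /= !inE eqxx orbT.
- exists (lb + ls * 0); last by case: H'.
  by right; left; left; exists 0.
- exists (th (f 0)); last by case: H'.
  by right; right; rewrite /= !inE eqxx.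
- exists (rb + rs * 0); last by case: H'.
  by right; left; right; exists 0.
Qed.

Local Notation vel c t := (velocity (fun u => (c u).1) (fun u => (c u).2) t).

Lemma transverse_sym (c : R -> R * R) s t : transverse c s t -> transverse c t s.
Proof.
case=> H1 H2 H3; split=> //; apply: contra_not H3 => E.
by apply/eqP; rewrite -oppr_eq0; apply/eqP; rewrite -[RHS]E /=; ring.
Qed.

Lemma meet_inside h : -12 <= h <= 12 -> f h = g h -> -12 < h < 12.
Proof.
move=> h12 E; have [h11|h11] := leP 11 `|h|.
  by move: E; rewrite (adm_f_end adm)// (adm_g_end adm)// => /eqP; rewrite oner_eq0.
by move: h11; rewrite ltr_norml => /andP[? ?]; apply/andP; split; lra.
Qed.

Lemma transverse_left_right s t h : on_left K s h -> on_right K t h -> f h = g h ->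
  transverse c' s t.
Proof.
move=> H H' E; have h12 := meet_inside (proj1 H) E.
have [_ [a [b [ab fa gb]]]] := adm_meet adm (proj1 H) E.
have dom : chart_domain (f h) h by split; [exact: (adm_f_range adm (proj1 H))|exact: (proj1 H)].
split.
- by apply: (surgery_smooth_left adm H h12); exists b.
- by apply: (surgery_smooth_right adm H' h12); exists a.
rewrite (vel_left adm H h12 gb) (vel_right adm H' h12 fa) -E /=.
rewrite (_ : _ - _ = ls^-1 * rs^-1 * ((b - a) * chart_jacobian (chart_x K) (chart_y K) (f h) h)).
  apply/eqP; rewrite !mulf_neq0 ?invr_eq0 ?lscale_neq0 ?rscale_neq0 ?(chart_jac K dom)//.
  by rewrite subr_eq0 eq_sym.
by rewrite -slanted_cross /slanted /=; ring.
Qed.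

Let in0 : -12 < (0 : R) < 12. Proof. by apply/andP; split; lra. Qed.
Let in0' : -12 <= (0 : R) <= 12. Proof. by apply/andP; split; lra. Qed.

Lemma transverse_cross_axis (p a k : R) (w v : R * R) :
  chart_domain p 0 -> k != 0 ->
  w = (k * (slanted K a p 0).1, k * (slanted K a p 0).2) ->
  v.1 * derive1 th p = (chart_ds K p 0).1 -> v.2 * derive1 th p = (chart_ds K p 0).2 ->
  w.1 * v.2 - w.2 * v.1 <> 0.
Proof.
move=> dom k0 wE E1 E2 H.
have E : (w.1 * v.2 - w.2 * v.1) * derive1 th p =
    w.1 * (v.2 * derive1 th p) - w.2 * (v.1 * derive1 th p) by ring.
rewrite {}H mul0r {}E1 {}E2 {}wE in E.
have : k * - chart_jacobian (chart_x K) (chart_y K) p 0 = 0.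
  by rewrite [RHS]E /chart_jacobian /slanted /=; ring.
by move/eqP; rewrite mulf_eq0 oppr_eq0 (negbTE k0) (negbTE (chart_jac K dom)).
Qed.

Lemma transverse_left_axis s t : on_left K s 0 -> on_axis K t (g 0) -> transverse c' s t.
Proof.
move=> H H'; have [a ga] := adm_g0 adm.
have dom : chart_domain (g 0) 0 by split=> //; exact: (adm_g_range adm).
split.
- by apply: (surgery_smooth_left adm H in0); exists a.
- apply: (surgery_smooth_rest D_smooth adm) => h _; [exact: on_axis_left H'|exact: on_axis_right H'].
rewrite (vel_left adm H in0 ga).
have [E1 E2] := vel_axis D_smooth adm H'.
by apply: (@transverse_cross_axis (g 0) a ls^-1 _ _ dom _ (erefl _) E1 E2); rewrite invr_eq0 lscale_neq0.
Qed.

Lemma transverse_right_axis s t : on_right K s 0 -> on_axis K t (f 0) -> transverse c' s t.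
Proof.
move=> H H'; have [a fa] := adm_f0 adm.
have dom : chart_domain (f 0) 0 by split=> //; exact: (adm_f_range adm).
split.
- by apply: (surgery_smooth_right adm H in0); exists a.
- apply: (surgery_smooth_rest D_smooth adm) => h _; [exact: on_axis_left H'|exact: on_axis_right H'].
rewrite (vel_right adm H in0 fa).
have [E1 E2] := vel_axis D_smooth adm H'.
by apply: (@transverse_cross_axis (f 0) a rs^-1 _ _ dom _ (erefl _) E1 E2); rewrite invr_eq0 rscale_neq0.
Qed.

Lemma transverse_off s t : off_chart K s -> off_chart K t -> crossing_pair D s t ->
  transverse c' s t.
Proof.
move=> H H' /(let: And3 _ _ tr := curve_generic D in tr s t)[_ _ tr].
have nearD u : off_chart K u -> \forall v \near u, D v = c' v.
  by case=> nl nr _; apply: (near_unchanged adm) => h _; [exact: nl|exact: nr].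
split.
- by apply: smooth_at_near (nearD _ H) _; exact: D_smooth.
- by apply: smooth_at_near (nearD _ H') _; exact: D_smooth.
by rewrite -(vel_near (nearD _ H)) -(vel_near (nearD _ H')).
Qed.

Lemma surgery_generic : generic c'.
Proof.
split; [exact: surgery_no_triple|exact: surgery_crossings_finite|].
move=> s t /crossP[H H' E|h H H' E|h H H' E|H H'|H H'|H H'|H H'].
- exact: transverse_off.
- exact: transverse_left_right H H' E.
- by apply: transverse_sym; exact: transverse_left_right H' H E.
- exact: transverse_left_axis.
- by apply: transverse_sym; exact: transverse_left_axis.
- exact: transverse_right_axis.
- by apply: transverse_sym; exact: transverse_right_axis.
Qed.

(** Away from the axis the right strand passes as [l] through all its crossings
    with the left strand. *)
Definition surgery_level (l : passage) t : passage :=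
  if (-12 <= left_height K t <= 12) && (left_height K t != 0) then other_passage l
  else if (-12 <= right_height K t <= 12) && (right_height K t != 0) then l
  else if `[< on_axis K t (f 0) >] then other_passage (level D rb)
  else level D t.

Lemma surgery_level_left l t h : on_left K t h -> h != 0 ->
  surgery_level l t = other_passage l.
Proof. by move=> H h0; rewrite /surgery_level (left_heightE H) h0; case: H => ->. Qed.

Lemma not_left_height t : (forall h, ~ on_left K t h) -> (-12 <= left_height K t <= 12) = false.
Proof. by move=> H; apply/negP => /on_left_height/H. Qed.

Lemma not_right_height t : (forall h, ~ on_right K t h) -> (-12 <= right_height K t <= 12) = false.
Proof. by move=> H; apply/negP => /on_right_height/H. Qed.

Lemma surgery_level_right l t h : on_right K t h -> h != 0 -> surgery_level l t = l.
Proof.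
move=> H h0; rewrite /surgery_level not_left_height /=.
  by rewrite (right_heightE H) h0; case: H => ->.
by move=> k Hk; exact: on_left_right Hk H.
Qed.

Lemma surgery_level_left0 l t : on_left K t 0 -> surgery_level l t = level D lb.
Proof.
move=> H; rewrite /surgery_level (left_heightE H) eqxx andbF not_right_height /=.
  rewrite asboolF; last by move=> /on_axis_left/(_ H).
  by case: H => _; rewrite mulr0 addr0; exact: level_same.
by move=> k Hk; exact: on_left_right H Hk.
Qed.

Lemma surgery_level_right0 l t : on_right K t 0 -> surgery_level l t = level D rb.
Proof.
move=> H; rewrite /surgery_level (right_heightE H) eqxx andbF not_left_height /=.
  rewrite asboolF; last by move=> /on_axis_right/(_ H).
  by case: H => _; rewrite mulr0 addr0; exact: level_same.
by move=> k Hk; exact: on_left_right Hk H.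
Qed.

Lemma surgery_level_axis l t s : on_axis K t s ->
  surgery_level l t = if s == f 0 then other_passage (level D rb) else level D t.
Proof.
move=> H; rewrite /surgery_level not_right_height ?not_left_height /=.
- case: eqP => [E|n]; first by rewrite asboolT// -E.
  by rewrite asboolF// => /(on_axis_inj H).
- by move=> k Hk; exact: on_axis_left H Hk.
- by move=> k Hk; exact: on_axis_right H Hk.
Qed.

Lemma surgery_level_off l t : off_chart K t -> surgery_level l t = level D t.
Proof.
case=> nl nr na; rewrite /surgery_level not_left_height// not_right_height//=.
by rewrite asboolF//; exact: na.
Qed.

Lemma other_passageK : involutive other_passage. Proof. by case. Qed.

Lemma level_axis_left : level D (th 0) = other_passage (level D lb).
Proof.
apply: level_opposite; split.
  have := @axis_left _ _ K 0 0; rewrite mulr0 addr0 => H /same_point_sym.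
  by apply: H; split; apply/andP; split; lra.
by have := chart_axis K 0; have := chart_left K 0; rewrite mulr0 addr0 => -> ->.
Qed.

Lemma level_axis_right : level D (th 1) = other_passage (level D rb).
Proof.
apply: level_opposite; split.
  have := @axis_right _ _ K 1 0; rewrite mulr0 addr0 => H /same_point_sym.
  by apply: H; split; apply/andP; split; lra.
by have := chart_axis K 1; have := chart_right K 0; rewrite mulr0 addr0 => -> ->.
Qed.

Lemma meet_neq0 h : f h = g h -> h != 0.
Proof. by apply: contra_eqN => /eqP ->; apply/eqP; exact: f0_neq_g0. Qed.

(** At height 0 the levels are those of the two old crossings, wherever they have moved
    along the axis; elsewhere they are prescribed by [l]. *)
Lemma surgery_level_opposite l s t : crossing_pair c' s t ->
  surgery_level l t = other_passage (surgery_level l s).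
Proof.
have la u v : on_left K u 0 -> on_axis K v (g 0) ->
    surgery_level l v = other_passage (surgery_level l u).
  move=> H H'; rewrite (surgery_level_left0 _ H) (surgery_level_axis _ H').
  rewrite ifF; last by apply/negbTE; rewrite eq_sym; apply/eqP; exact: f0_neq_g0.
  rewrite -level_axis_left; apply: level_same.
  by case: H' => _; rewrite (adm_g0_eq0 adm).
have ra u v : on_right K u 0 -> on_axis K v (f 0) ->
    surgery_level l v = other_passage (surgery_level l u).
  by move=> H H'; rewrite (surgery_level_right0 _ H) (surgery_level_axis _ H') eqxx.
move=> /crossP[H H' E|h H H' E|h H H' E|H H'|H H'|H H'|H H'].
- by rewrite !surgery_level_off//; exact: level_opposite.
- by rewrite (surgery_level_left _ H (meet_neq0 E)) (surgery_level_right _ H' (meet_neq0 E)) other_passageK.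
- by rewrite (surgery_level_left _ H' (meet_neq0 E)) (surgery_level_right _ H (meet_neq0 E)).
- exact: la.
- by rewrite (la _ _ H' H) other_passageK.
- exact: ra.
- by rewrite (ra _ _ H' H) other_passageK.
Qed.

Lemma surgery_level_periodic l t : surgery_level l (t + 1) = surgery_level l t.
Proof.
have E b : centered (t + 1 - b) = centered (t - b).
  by rewrite addrAC centered_periodic.
have A : `[< on_axis K (t + 1) (f 0) >] = `[< on_axis K t (f 0) >].
  have tt : same_point (t + 1) t by apply/same_pointP; exists 1.
  apply/asbool_equiv_eq; split=> -[? H]; split=> //.
    exact: same_point_trans (same_point_sym tt) H.
  exact: same_point_trans tt H.
by rewrite /surgery_level /left_height /right_height !E A level_periodic.
Qed.

Definition surgery_diagram (l : passage) : diagram R :=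
  Diagram (surgery_piecewise_smooth K D_smooth adm) surgery_generic
    (surgery_level_periodic l) (@surgery_level_opposite l).

End SurgeryGeneric.

(** * The profiles of the two moves *)

Section Profiles.
Variable R : realType.
Implicit Types (h u : R).

(** The left strand bulges towards the right strand, with its top 1 at height 3. *)
Definition bulge h : R := Num.max 0 (Num.min ((h - 1) / 2) (1 - (h - 3) / 8)).

(** Position of the right strand relative to the left one after both moves. It is negative
    from height -2 to height 7, where the two strands cross, and -2/3 at height 0: the
    right strand crosses the axis beyond the left one. *)
Definition detour h : R :=
  Num.min (1 - 2 * bulge h)
    (Num.max (Num.min 1 (Num.max (- 2 - h) (- (2 / 3) - h / 9))) (h - 4)).

Variant bulge_spec h : R -> Type :=
| BulgeBelow of h <= 1 : bulge_spec h 0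
| BulgeUp of 1 <= h & h <= 3 : bulge_spec h ((h - 1) / 2)
| BulgeDown of 3 <= h & h <= 11 : bulge_spec h (1 - (h - 3) / 8)
| BulgeAbove of 11 <= h : bulge_spec h 0.

Lemma bulgeP h : bulge_spec h (bulge h).
Proof.
rewrite /bulge.
have [h1|h1] := leP h 1.
  have -> : Num.max 0 (Num.min ((h - 1) / 2) (1 - (h - 3) / 8)) = 0.
    by case: (leP ((h - 1) / 2)) => ?; case: (leP 0) => ?; lra.
  exact: BulgeBelow.
have [h3|h3] := leP h 3.
  have -> : Num.max 0 (Num.min ((h - 1) / 2) (1 - (h - 3) / 8)) = (h - 1) / 2.
    by case: (leP ((h - 1) / 2)) => ?; case: (leP 0) => ?; lra.
  by apply: BulgeUp => //; lra.
have [h11|h11] := leP h 11.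
  have -> : Num.max 0 (Num.min ((h - 1) / 2) (1 - (h - 3) / 8)) = 1 - (h - 3) / 8.
    by case: (leP ((h - 1) / 2)) => ?; case: (leP 0) => ?; lra.
  by apply: BulgeDown => //; lra.
have -> : Num.max 0 (Num.min ((h - 1) / 2) (1 - (h - 3) / 8)) = 0.
  by case: (leP ((h - 1) / 2)) => ?; case: (leP 0) => ?; lra.
by apply: BulgeAbove; lra.
Qed.

Variant detour_spec h : R -> Type :=
| DetourBelow of h <= -3 : detour_spec h 1
| DetourBack of -3 <= h & h <= - (3 / 2) : detour_spec h (- 2 - h)
| DetourUp of - (3 / 2) <= h & h <= 3 : detour_spec h (- (2 / 3) - h / 9)
| DetourAbove of 3 <= h : detour_spec h (1 - 2 * bulge h).

Lemma detourP h : detour_spec h (detour h).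
Proof.
have [h1|h1] := leP h (-3).
  have -> : detour h = 1.
    rewrite /detour (@max_l _ _ (- 2 - h)); last lra.
    rewrite (@min_l _ _ 1); last lra.
    rewrite max_l; last lra.
    by rewrite min_r//; case: bulgeP => *; lra.
  exact: DetourBelow.
have [h2|h2] := leP h (- (3 / 2)).
  have -> : detour h = - 2 - h.
    rewrite /detour (@max_l _ _ (- 2 - h)); last lra.
    rewrite (@min_r _ _ 1); last lra.
    rewrite max_l; last lra.
    by rewrite min_r//; case: bulgeP => *; lra.
  by apply: DetourBack; lra.
have [h3|h3] := leP h 3.
  have -> : detour h = - (2 / 3) - h / 9.
    rewrite /detour (@max_r _ _ (- 2 - h)); last lra.
    rewrite (@min_r _ _ 1); last lra.
    rewrite max_l; last lra.
    by rewrite min_r//; case: bulgeP => *; lra.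
  by apply: DetourUp; lra.
have -> : detour h = 1 - 2 * bulge h.
  rewrite /detour (@max_r _ _ (- 2 - h)); last lra.
  rewrite (@min_r _ _ 1); last lra.
  rewrite max_r; last lra.
  by rewrite min_l//; case: bulgeP => *; lra.
by apply: DetourAbove; lra.
Qed.

Lemma piecewise_affine_bulge : piecewise_affine bulge.
Proof.
rewrite (_ : bulge = fun h => Num.max (0 + 0 * h) (Num.min (- (1 / 2) + 1 / 2 * h) (11 / 8 + - (1 / 8) * h))).
  apply: piecewise_affine_max; first exact: piecewise_affine_affine.
  by apply: piecewise_affine_min; exact: piecewise_affine_affine.
by apply/funext => h; rewrite /bulge; congr (Num.max _ (Num.min _ _)); field.
Qed.

Lemma piecewise_affine_1B2 : piecewise_affine (fun h => 1 - 2 * bulge h).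
Proof.
rewrite (_ : (fun h => _) = fun h => (1 + 0 * h) + - (bulge h + bulge h)).
  apply: piecewise_affineD; first exact: piecewise_affine_affine.
  by apply/piecewise_affineN/piecewise_affineD; exact: piecewise_affine_bulge.
by apply/funext => h; ring.
Qed.

Lemma piecewise_affine_detour : piecewise_affine detour.
Proof.
apply: (@piecewise_affine_min _ (fun h => 1 - 2 * bulge h)); first exact: piecewise_affine_1B2.
rewrite (_ : (fun h => _) = fun h => Num.max (Num.min (1 + 0 * h) (Num.max (- 2 + - 1 * h)
    (- (2 / 3) + - (1 / 9) * h))) (- 4 + 1 * h)).
  apply: piecewise_affine_max; last exact: piecewise_affine_affine.
  apply: piecewise_affine_min; first exact: piecewise_affine_affine.
  by apply: piecewise_affine_max; exact: piecewise_affine_affine.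
by apply/funext => h; congr (Num.max (Num.min _ (Num.max _ _)) _); field.
Qed.

(** The right strand after the second and after the third Reidemeister move. *)
Definition fold2 h : R := 1 - bulge h.
Definition fold3 h : R := bulge h + detour h.

Lemma affine_germ_intro (f : R -> R) h a : (forall u, `|u| <= 4^-1 -> f (h + u) = f h + a * u) ->
  affine_germ f h a a.
Proof.
move=> fE; exists 4^-1 => // u /andP[u0 u1]; rewrite !fE ?normrN ?ger0_norm//.
by split=> //; ring.
Qed.

Let small u : `|u| <= 4^-1 -> -4^-1 <= u /\ u <= 4^-1.
Proof. by rewrite ler_norml => /andP[]. Qed.

Lemma fold3_eq h : 3 <= `|h| -> fold3 h = fold2 h.
Proof.
rewrite ler_normr /fold3 /fold2 => /orP[?|?]; case: detourP => *; case: bulgeP => *; lra.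
Qed.

Lemma bulge_germ0 : affine_germ bulge 0 0 0.
Proof.
apply: affine_germ_intro => u /small[? ?].
by case: (bulgeP 0) => *; try (exfalso; lra); case: bulgeP => *; lra.
Qed.

Lemma bulge_germ7 : affine_germ bulge 7 (- (1 / 8)) (- (1 / 8)).
Proof.
apply: affine_germ_intro => u /small[? ?].
by case: (bulgeP 7) => *; try (exfalso; lra); case: bulgeP => *; lra.
Qed.

Lemma fold2_germ7 : affine_germ fold2 7 (1 / 8) (1 / 8).
Proof.
apply: affine_germ_intro => u /small[? ?]; rewrite /fold2.
by case: (bulgeP 7) => *; try (exfalso; lra); case: bulgeP => *; lra.
Qed.

Lemma admissible_fold2 : admissible fold2 bulge [:: 2; 7].
Proof.
split.
- rewrite (_ : fold2 = fun h => (1 + 0 * h) + - bulge h).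
    apply: piecewise_affineD; first exact: piecewise_affine_affine.
    exact/piecewise_affineN/piecewise_affine_bulge.
  by apply/funext => h; rewrite /fold2; ring.
- exact: piecewise_affine_bulge.
- by move=> h /andP[? ?]; rewrite /fold2; case: bulgeP => *; apply/andP; split; lra.
- by move=> h /andP[? ?]; case: bulgeP => *; apply/andP; split; lra.
- move=> h; rewrite ler_normr /fold2 => /orP[?|?]; case: bulgeP => *; lra.
- move=> h; rewrite ler_normr => /orP[?|?]; case: bulgeP => *; lra.
- exists 0; apply: affine_germ_intro => u /small[? ?].
  by rewrite /fold2; case: (bulgeP 0) => *; case: bulgeP => *; lra.
- by exists 0; exact: bulge_germ0.
- by rewrite /fold2; case: bulgeP => *; apply/eqP; lra.
- by case: bulgeP => *; lra.
- move=> h /andP[? ?] E; have [->|->] : h = 2 \/ h = 7.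
    by move: E; rewrite /fold2; case: bulgeP => * ; [exfalso; lra|left; lra|right; lra|exfalso; lra].
  + split; first by rewrite !inE eqxx.
    exists (- (1 / 2)), (1 / 2); split; first by apply/eqP; lra.
      apply: affine_germ_intro => u /small[? ?].
      by rewrite /fold2; case: (bulgeP 2) => *; case: bulgeP => *; lra.
    apply: affine_germ_intro => u /small[? ?].
    by case: (bulgeP 2) => *; case: bulgeP => *; lra.
  + split; first by rewrite !inE eqxx orbT.
    exists (1 / 8), (- (1 / 8)); split; [by apply/eqP; lra|exact: fold2_germ7|exact: bulge_germ7].
Qed.

Lemma admissible_fold3 : admissible fold3 bulge [:: -2; 7].
Proof.
split.
- by apply: piecewise_affineD; [exact: piecewise_affine_bulge|exact: piecewise_affine_detour].
- exact: piecewise_affine_bulge.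
- by move=> h /andP[? ?]; rewrite /fold3; case: detourP; case: bulgeP => *; apply/andP; split; lra.
- by move=> h /andP[? ?]; case: bulgeP => *; apply/andP; split; lra.
- by move=> h; rewrite ler_normr /fold3 => /orP[?|?]; case: detourP; case: bulgeP => *; lra.
- by move=> h; rewrite ler_normr => /orP[?|?]; case: bulgeP => *; lra.
- exists (- (1 / 9)); apply: affine_germ_intro => u /small[? ?].
  rewrite /fold3; case: (detourP 0) => *; try (exfalso; lra).
  case: (detourP (0 + u)) => *; try (exfalso; lra).
  by case: (bulgeP 0) => *; try (exfalso; lra); case: bulgeP => *; lra.
- by exists 0; exact: bulge_germ0.
- by rewrite /fold3; case: bulgeP => *; case: detourP => *; apply/eqP; lra.
- by case: bulgeP => *; lra.
- move=> h /andP[? ?] E; have [->|->] : h = -2 \/ h = 7.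
    by move: E; rewrite /fold3; case: detourP; case: bulgeP => * ; (try (exfalso; lra)); [left; lra|right; lra].
  + split; first by rewrite !inE eqxx.
    exists (- 1), 0; split; first by apply/eqP; lra.
      apply: affine_germ_intro => u /small[? ?].
      rewrite /fold3; case: (detourP (-2)) => *; try (exfalso; lra).
      case: (detourP (-2 + u)) => *; try (exfalso; lra).
      by case: (bulgeP (-2)) => *; try (exfalso; lra); case: bulgeP => *; lra.
    apply: affine_germ_intro => u /small[? ?].
    by case: (bulgeP (-2)) => *; try (exfalso; lra); case: bulgeP => *; lra.
  + split; first by rewrite !inE eqxx orbT.
    exists (1 / 8), (- (1 / 8)); split; [by apply/eqP; lra| |exact: bulge_germ7].
    have [e e0 eP] := fold2_germ7; exists (Num.min e 1); first by rewrite lt_min e0 ltr01.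
    move=> u /andP[u0 ue]; rewrite !fold3_eq; try by rewrite ler_normr; apply/orP; left; move: ue; rewrite le_min => /andP[? ?]; lra.
    by apply: eP; rewrite u0; move: ue; rewrite le_min => /andP[].
Qed.


End Profiles.

(** * Tangle replacements between graphs *)

Section Tangles.
Variable R : realType.
Implicit Types (p F : R -> R) (t h x : R).

Definition monotone_path p : Prop := continuous p /\
  ((forall s s', s < s' -> p s < p s') \/ (forall s s', s < s' -> p s' < p s)).

Lemma monotone_path_affine (b e : R) : e != 0 -> monotone_path (fun h => b + e * h).
Proof.
move=> e0; split; first by apply: smooth_continuous; exact: smooth_affine.
have [e1|e1|e1] := ltgtP e 0.
- by right=> s s' ss; rewrite ltrD2l ltr_nM2l.
- by left=> s s' ss; rewrite ltrD2l ltr_pM2l.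
- by rewrite e1 eqxx in e0.
Qed.

Definition path_lo p h k := Num.min (p h) (p k).
Definition path_hi p h k := Num.max (p h) (p k).

Lemma path_segment p h k t : monotone_path p -> h <= k ->
  path_lo p h k <= t <= path_hi p h k <-> exists2 s, h <= s <= k & t = p s.
Proof.
move=> [cp mp] hk; split=> [H|[s /andP[hs sk] ->]].
  have [|s] := @IVT _ p h k t hk _ H; first exact: continuous_subspaceT.
  by rewrite in_itv /= => sI <-; exists s.
have le x y : x <= y -> (p x <= p y /\ (forall r r', r <= r' -> p r <= p r')) \/
   (p y <= p x /\ (forall r r', r <= r' -> p r' <= p r)).
  move=> xy; case: mp => mp; [left|right].
    have m r r' : r <= r' -> p r <= p r' by rewrite le_eqVlt => /predU1P[->//|/mp/ltW].
    by split; [exact: m|exact: m].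
  have m r r' : r <= r' -> p r' <= p r by rewrite le_eqVlt => /predU1P[->//|/mp/ltW].
  by split; [exact: m|exact: m].
rewrite /path_lo /path_hi ge_min le_max.
by case: (le _ _ hs) => -[-> m]; rewrite (m _ _ sk) ?orbT.
Qed.

(** All strands of the pictures of the second and third moves are graphs. *)
Definition graph_over F : set (R * R) := [set r | -1 <= r.1 <= 1 /\ r.2 = F r.1].

(** For strands that are graphs in the square and are parametrized monotonically on the
    circle, a replacement amounts to a matching of heights with abscissas. *)
Lemma tangle_replacement_intro n (T T' : 'I_n -> set (R * R)) (F F' p : 'I_n -> R -> R)
    (u v : 'I_n -> R) (D D' : diagram R) (phi : R * R -> R * R) :
  disc_embedding phi ->
  (forall i, T i = graph_over (F i)) -> (forall i, T' i = graph_over (F' i)) ->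
  (forall i, monotone_path (p i)) -> (forall i, u i < v i) ->
  (forall i, `|p i (v i) - p i (u i)| < 1) ->
  (forall i j h k, u i <= h <= v i -> u j <= k <= v j ->
     same_point (p i h) (p j k) -> i = j) ->
  (forall i h, u i <= h <= v i -> exists2 x, -1 <= x <= 1 & D (p i h) = phi (x, F i x)) ->
  (forall i x, -1 <= x <= 1 -> exists2 h, u i <= h <= v i & D (p i h) = phi (x, F i x)) ->
  (forall i h, u i <= h <= v i -> exists2 x, -1 <= x <= 1 & D' (p i h) = phi (x, F' i x)) ->
  (forall i x, -1 <= x <= 1 -> exists2 h, u i <= h <= v i & D' (p i h) = phi (x, F' i x)) ->
  (forall t, (forall i h, u i <= h <= v i -> ~ same_point t (p i h)) ->
     [/\ ~ (phi @` @square R) (D t), D' t = D t & at_crossing D t -> level D' t = level D t]) ->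
  tangle_replacement T T' (fun i => path_lo (p i) (u i) (v i))
    (fun i => path_hi (p i) (u i) (v i)) D D' /\
  forall i t, on_strand (fun i => path_lo (p i) (u i) (v i))
    (fun i => path_hi (p i) (u i) (v i)) i t <->
    exists2 h, u i <= h <= v i & same_point t (p i h).
Proof.
move=> emb TF TF' mp uv short disj D1 D2 D1' D2' out.
have onP i t : on_strand (fun i => path_lo (p i) (u i) (v i))
    (fun i => path_hi (p i) (u i) (v i)) i t <->
    exists2 h, u i <= h <= v i & same_point t (p i h).
  split=> [[m /(path_segment _ (mp i) (ltW (uv i)))[h hI tE]]|[h hI /same_point_sym/same_pointP[m mE]]].
    by exists h => //; apply/same_point_sym/same_pointP; exists m; rewrite -tE.
  by exists m; apply/(path_segment _ (mp i) (ltW (uv i))); exists h.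
split=> //; exists phi; split=> //.
- move=> i; have [_ mo] := mp i; have := short i.
  rewrite /path_lo /path_hi ltr_distl; have := uv i.
  by case: mo => mo /mo H /andP[H1 H2]; [rewrite min_l ?max_r ?ltW//|rewrite min_r ?max_l ?ltW//];
    apply/andP; split=> //; lra.
- move=> i j t /onP[h hI th] /onP[k kI tk].
  by apply: (disj i j h k) => //; exact: same_point_trans (same_point_sym th) tk.
- have img (E : diagram R) (S : 'I_n -> set (R * R)) (G : 'I_n -> R -> R) i :
    S i = graph_over (G i) ->
    (forall h, u i <= h <= v i -> exists2 x, -1 <= x <= 1 & E (p i h) = phi (x, G i x)) ->
    (forall x, -1 <= x <= 1 -> exists2 h, u i <= h <= v i & E (p i h) = phi (x, G i x)) ->
    E @` `[path_lo (p i) (u i) (v i), path_hi (p i) (u i) (v i)] = phi @` S i.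
    move=> -> E1 E2; apply/seteqP; split=> q /=.
      move=> [t]; rewrite in_itv /= => /(path_segment _ (mp i) (ltW (uv i)))[h hI ->] <-.
      by have [x xI ->] := E1 h hI; exists (x, G i x).
    move=> [[x y] [/= xI ->] <-]; have [h hI <-] := E2 x xI.
    exists (p i h) => //; rewrite in_itv /=.
    by apply/(path_segment _ (mp i) (ltW (uv i))); exists h.
  by move=> i; split; [apply: (img D T F)|apply: (img D' T' F')] => //; [exact: D1|exact: D2|exact: D1'|exact: D2'].
- move=> t nt; apply: out => i h hI th; apply: (nt i).
  by apply/onP; exists h.
Qed.

Lemma segmentE (x1 y1 x2 y2 : R) : x1 < x2 -> segment (x1, y1) (x2, y2) =
  [set r | x1 <= r.1 <= x2 /\ r.2 = y1 + (r.1 - x1) * ((y2 - y1) / (x2 - x1))].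
Proof.
move=> x12; have d0 : x2 - x1 != 0 by rewrite gt_eqF// subr_gt0.
apply/seteqP; split=> [r [u /andP[u0 u1] ->] /=|[x y] /= [/andP[xx1 xx2] ->]].
  have : 0 <= u * (x2 - x1) <= x2 - x1.
    apply/andP; split; first by rewrite mulr_ge0// subr_ge0 ltW.
    by rewrite ler_piMl// subr_ge0 ltW.
  move=> /andP[? ?]; split; first by apply/andP; split; lra.
  by field.
exists ((x - x1) / (x2 - x1)) => /=.
  apply/andP; split; first by rewrite divr_ge0 ?subr_ge0// ltW.
  by rewrite ler_pdivrMr ?subr_gt0// mul1r; lra.
by congr pair; field.
Qed.

Lemma segment_end (q r : R * R) : segment q r r.
Proof.
exists 1; first by rewrite lexx ler01.
by case: q r => [? ?] [? ?] /=; congr pair; ring.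
Qed.

Lemma polylineS (q r : R * R) s : s <> [::] -> polyline q (r :: s) = segment q r `|` polyline r s.
Proof. by []. Qed.

Lemma polyline_last (q r : R * R) : polyline q [:: r] = segment q r.
Proof.
by rewrite /=; apply/seteqP; split=> z /=; [case=> // ->; exact: segment_end|left].
Qed.

Let m0 : (-1 : R) < 0. Proof. lra. Qed.

Lemma roof_graph (y z : R) : polyline (-1, y) [:: (0, z); (1, y)] =
  graph_over (fun x => z + (y - z) * `|x|).
Proof.
rewrite polylineS// polyline_last !segmentE//; apply/seteqP; split=> [[x w]|[x w]] /=.
  case=> -[/andP[x1 x2] ->]; (split=> /=; first by apply/andP; split; lra).
    by rewrite ler0_norm//; field.
  by rewrite ger0_norm//; field.
move=> [/= /andP[x1 x2] ->]; have [x0|x0] := leP x 0.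
  by left; rewrite ler0_norm//; split; [apply/andP; split; lra|field].
by right; rewrite gtr0_norm//; split; [apply/andP; split; lra|field].
Qed.

Lemma line_graph (y z : R) : segment (-1, y) (1, z) =
  graph_over (fun x => (y + z) / 2 + (z - y) / 2 * x).
Proof.
rewrite segmentE//; apply/seteqP.
by split=> [[x w]|[x w]] /= [/= xI ->]; split=> //=; field.
Qed.

End Tangles.

(** * The second Reidemeister move in a chart *)

Lemma continuous_pair (R : realType) (T : topologicalType) (a b : T -> R) :
  continuous a -> continuous b -> continuous (fun q => (a q, b q)).
Proof. by move=> ca cb q; exact: (cvg_pair (ca q) (cb q)). Qed.

Section Moves.
Variables (R : realType) (D : diagram R) (K : strand_chart D).
Hypothesis D_smooth : forall t, smooth_at D t.
Variable l : passage.
Implicit Types (s h t u x y : R).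

Local Notation Psi := (chart_map (chart_x K) (chart_y K)).
Local Notation th := (axis K).
Local Notation lb := (lbase K).
Local Notation ls := (lscale K).
Local Notation rb := (rbase K).
Local Notation rs := (rscale K).
Local Notation per := (curve_periodic D).

Definition folded2 := surgery_diagram K D_smooth (admissible_fold2 R) l.
Definition folded3 := surgery_diagram K D_smooth (admissible_fold3 R) l.

Lemma chart_continuous : continuous (fun q : R * R => Psi q.1 q.2).
Proof.
move=> q.
exact: (cvg_pair (@continuous_sep _ _ (chart_x_smooth K) q) (@continuous_sep _ _ (chart_y_smooth K) q)).
Qed.

Lemma chart_disc_embedding (G : R * R -> R * R) : continuous G ->
  (forall q, square q -> chart_domain (G q).1 (G q).2) ->
  (forall q r, square q -> square r -> (G q).1 = (G r).1 -> (G q).2 = (G r).2 -> q = r) ->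
  disc_embedding (fun q => Psi (G q).1 (G q).2).
Proof.
move=> cG domG injG; split.
  apply: continuous_subspaceT => q.
  exact: (continuous_comp (cG q) (@chart_continuous (G q))).
move=> q r sq sr /(chart_inj (domG q sq) (domG r sr))[E1 E2].
exact: injG.
Qed.

Lemma axis_path : monotone_path th.
Proof. by split; [apply: smooth_continuous; exact: axis_smooth|exact: axis_mono]. Qed.

Lemma left_on h : -12 <= h <= 12 -> on_left K (lb + ls * h) h.
Proof. by move=> ?; split=> //; exact: same_point_refl. Qed.

Lemma right_on h : -12 <= h <= 12 -> on_right K (rb + rs * h) h.
Proof. by move=> ?; split=> //; exact: same_point_refl. Qed.

Lemma axis_on s : -2 <= s <= 4 -> on_axis K (th s) s.
Proof. by move=> ?; split=> //; exact: same_point_refl. Qed.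

Lemma short_strand (b e h k : R) : `|e| < 24^-1 -> -12 <= h <= 12 -> -12 <= k <= 12 ->
  `|b + e * k - (b + e * h)| < 1.
Proof.
move=> e1 /andP[? ?] /andP[? ?].
rewrite (_ : _ - _ = e * (k - h)); last by ring.
have kh : `|k - h| <= 24 by rewrite ler_norml; apply/andP; split; lra.
rewrite normrM (le_lt_trans (ler_wpM2l (normr_ge0 e) kh))//; lra.
Qed.

(** The square is turned so that its strands climb, and it is bent at the height 3 of the
    top of the bulge: straight segments of the picture then become the profiles. *)
Definition plane2 (q : R * R) : R * R := (2^-1 + q.2, 3 + 5 * q.1 + 3 * `|q.1|).

Lemma squareP (q : R * R) : square q -> (-1 <= q.1 /\ q.1 <= 1) /\ (-1 <= q.2 /\ q.2 <= 1).
Proof. by case; rewrite !ler_norml => /andP[? ?] /andP[? ?]. Qed.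

Ltac absb x := have [?|?] := leP 0 x; [rewrite ?[`|x|]ger0_norm//|rewrite ?[`|x|]ltr0_norm//].

Lemma plane2_disc : disc_embedding (fun q => Psi (plane2 q).1 (plane2 q).2).
Proof.
apply: chart_disc_embedding.
- rewrite /plane2; apply: (@continuous_pair R (R * R)%type (fun q => 2^-1 + q.2) (fun q => 3 + 5 * q.1 + 3 * `|q.1|)) => q.
    by apply: cvgD; [exact: cvg_cst|exact: cvg_snd].
  apply: cvgD.
    by apply: cvgD; [exact: cvg_cst|apply: cvgM; [exact: cvg_cst|exact: cvg_fst]].
  by apply: cvgM; [exact: cvg_cst|apply: cvg_norm; exact: cvg_fst].
- move=> [x y] /squareP /= [[? ?] [? ?]]; split => /=.
    by apply/andP; split; lra.
  by absb x; apply/andP; split; lra.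
- move=> [x y] [x' y'] _ _ /= E1; have -> : y' = y by lra.
  by absb x; absb x' => E2; congr pair; lra.
Qed.

Definition path2 (i : 'I_2) : R -> R :=
  if i == ord0 then (fun h => lb + ls * h) else (fun h => rb + rs * h).

Let zero12 : -12 <= (0 : R) <= 12. Proof. by apply/andP; split; lra. Qed.

Let widen (a b h : R) : a <= h <= b -> -12 <= a -> b <= 12 -> -12 <= h <= 12.
Proof. by move=> /andP[? ?] ? ?; apply/andP; split; lra. Qed.

Let I2P (P : 'I_2 -> Prop) : P ord0 -> P ord_max -> forall i, P i.
Proof.
move=> P0 P1 [[|[|//]] Hi].
  by rewrite (_ : Ordinal Hi = ord0)//; apply/val_inj.
by rewrite (_ : Ordinal Hi = ord_max)//; apply/val_inj.
Qed.

Let bulge_out h : ~ (1 <= h <= 11) -> bulge h = 0.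
Proof.
by move=> /negP; rewrite negb_and => /orP[]; rewrite -ltNge => ?; case: bulgeP => *; lra.
Qed.

(** The bulge of the left strand and the opposite one of the right strand make a bigon with
    vertices at the heights 2 and 7. *)
Lemma first_move : reidemeister2 D folded2.
Proof.
exists (fun i => path_lo (path2 i) 1 11), (fun i => path_hi (path2 i) 1 11), (other_passage l).
have H12 h : 1 <= h <= 11 -> -12 <= h <= 12 by move=> /widen; apply; lra.
have E0 h : 1 <= h <= 11 -> D (path2 ord0 h) = Psi 0 h.
  by move=> /H12 hI; rewrite /path2 eqxx (on_left_curve per (left_on hI)).
have E1 h : 1 <= h <= 11 -> D (path2 ord_max h) = Psi 1 h.
  by move=> /H12 hI; rewrite /path2 /= (on_right_curve per (right_on hI)).
have E0' h : 1 <= h <= 11 -> folded2 (path2 ord0 h) = Psi (bulge h) h.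
  by move=> /H12 hI; rewrite /path2 eqxx /= (surgery_left _ _ (left_on hI)).
have E1' h : 1 <= h <= 11 -> folded2 (path2 ord_max h) = Psi (1 - bulge h) h.
  by move=> /H12 hI; rewrite /path2 /= (surgery_right _ _ (right_on hI)).
have up x : -1 <= x <= 1 -> exists2 h, 1 <= h <= 11 & h = 3 + 5 * x + 3 * `|x|.
  move=> /andP[? ?]; exists (3 + 5 * x + 3 * `|x|) => //.
  by absb x; apply/andP; split; lra.
have down h : 1 <= h <= 11 -> exists2 x, -1 <= x <= 1 & h = 3 + 5 * x + 3 * `|x|.
  move=> /andP[? ?]; have [h3|h3] := leP h 3.
    exists ((h - 3) / 2); first by apply/andP; split; lra.
    by rewrite ler0_norm; [field|lra].
  exists ((h - 3) / 8); first by apply/andP; split; lra.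
  by rewrite gtr0_norm; [field|lra].
have bulgeE x : -1 <= x <= 1 -> bulge (3 + 5 * x + 3 * `|x|) = 1 - `|x|.
  by move=> /andP[? ?]; absb x; case: bulgeP => *; lra.
pose F (i : 'I_2) x : R := if i == ord0 then (- 2^-1 + - 2^-1) / 2 + (- 2^-1 - - 2^-1) / 2 * x
  else (2^-1 + 2^-1) / 2 + (2^-1 - 2^-1) / 2 * x.
pose F' (i : 'I_2) x : R := if i == ord0 then 2^-1 + (- 2^-1 - 2^-1) * `|x|
  else - 2^-1 + (2^-1 - - 2^-1) * `|x|.
have [] := @tangle_replacement_intro R 2 (@parallel_tangle R) (@bigon_tangle R)
  F F' path2 (fun=> 1) (fun=> 11) D folded2 (fun q => Psi (plane2 q).1 (plane2 q).2).
- exact: plane2_disc.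
- apply: I2P; rewrite /parallel_tangle /F /=; exact: line_graph.
- apply: I2P; rewrite /bigon_tangle /F' /=; exact: roof_graph.
- apply: I2P; rewrite /path2 /=; apply: monotone_path_affine; [exact: lscale_neq0|exact: rscale_neq0].
- by move=> _; lra.
- by apply: I2P; rewrite /path2 /=; apply: short_strand; try (apply/andP; split; lra); [exact: lscale_small|exact: rscale_small].
- move=> i j h k /H12 hI /H12 kI; move: i j; apply: I2P; apply: I2P => //; rewrite /path2 /=.
    by move=> /(left_right hI kI).
  by move=> /same_point_sym/(left_right kI hI).
- apply: I2P => h hI; have [x xI hE] := down h hI; exists x => //; rewrite ?E0 ?E1// hE /F /=.
    by congr Psi; field.
  by congr Psi; field.
- apply: I2P => x xI; have [h hI hE] := up x xI; exists h => //; rewrite ?E0 ?E1// hE /F /=.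
    by congr Psi; field.
  by congr Psi; field.
- apply: I2P => h hI; have [x xI hE] := down h hI; exists x => //; rewrite ?E0' ?E1'// hE /F' /= bulgeE//.
    by congr Psi; field.
  by congr Psi; field.
- apply: I2P => x xI; have [h hI hE] := up x xI; exists h => //; rewrite ?E0' ?E1'// hE /F' /= bulgeE//.
    by congr Psi; field.
  by congr Psi; field.
- move=> t nt.
  have notdisc p k : chart_domain p k -> D t = Psi p k -> (1 <= k <= 11) = false ->
      ~ ((fun q => Psi (plane2 q).1 (plane2 q).2) @` @square R) (D t).
    move=> dom E nk [[x y] sq] /=; rewrite E.
    have /= [[? ?] [? ?]] := squareP sq.
    have xI : -1 <= x <= 1 by apply/andP.
    have [h hI hE] := up x xI.
    rewrite -hE => /chart_inj[].
    + by split; [apply/andP; split => /=; lra|exact: H12].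
    + exact: dom.
    + by move=> _ hk; rewrite -hk hI in nk.
  have dom01 (p k : R) : p = 0 \/ p = 1 -> -12 <= k <= 12 -> chart_domain p k.
    by move=> [->|->] kI; split=> //; apply/andP; split; lra.
  case: (positionP K t) => [h H|h H|s H|H].
  + have nh : (1 <= h <= 11) = false.
      by apply/negP => hI; apply: (nt ord0 h hI); rewrite /path2 eqxx; case: H.
    split.
    * exact: (notdisc 0 h (dom01 0 h (or_introl erefl) (proj1 H)) (on_left_curve per H) nh).
    * by rewrite /= (surgery_left _ _ H) (on_left_curve per H) bulge_out// nh.
    * move=> [t' /= cr]; have [h0|h0] := eqVneq h 0.
        rewrite h0 in H; rewrite /= (surgery_level_left0 _ _ H).
        by case: H => _; rewrite mulr0 addr0 => /level_same ->.
      exfalso; move: cr; rewrite -[X in crossing_pair X](surgery_id K per).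
      have r01 (z : R) : z = 0 \/ z = 1 -> forall h, -12 <= h <= 12 -> -2 <= (cst z h : R) <= 4.
        by move=> [->|->] ? _; apply/andP; split=> /=; lra.
      move=> /(surgery_crossingP K per (r01 1 (or_intror erefl)) (r01 0 (or_introl erefl)))[].
      -- by move=> _ /off_left/(_ H).
      -- by move=> k _ Hk; case: (on_left_right H Hk).
      -- by move=> k _ _ /eqP; rewrite /= oner_eq0.
      -- by move=> _ Hk; exact: on_axis_left Hk H.
      -- by move=> _ /left_heightE; rewrite (left_heightE H) => /eqP; rewrite (negbTE h0).
      -- by move=> _ Hk; exact: on_axis_left Hk H.
      -- by move=> _ Hk; exact: on_left_right H Hk.
  + have nh : (1 <= h <= 11) = false.
      by apply/negP => hI; apply: (nt ord_max h hI); rewrite /path2 /=; case: H.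
    split.
    * exact: (notdisc 1 h (dom01 1 h (or_intror erefl) (proj1 H)) (on_right_curve per H) nh).
    * by rewrite /= (surgery_right _ _ H) (on_right_curve per H) /fold2 bulge_out ?subr0// nh.
    * move=> [t' /= cr]; have [h0|h0] := eqVneq h 0.
        rewrite h0 in H; rewrite /= (surgery_level_right0 _ _ H).
        by case: H => _; rewrite mulr0 addr0 => /level_same ->.
      exfalso; move: cr; rewrite -[X in crossing_pair X](surgery_id K per).
      have r01 (z : R) : z = 0 \/ z = 1 -> forall h, -12 <= h <= 12 -> -2 <= (cst z h : R) <= 4.
        by move=> [->|->] ? _; apply/andP; split=> /=; lra.
      move=> /(surgery_crossingP K per (r01 1 (or_intror erefl)) (r01 0 (or_introl erefl)))[].
      -- by move=> _ /off_right/(_ H).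
      -- by move=> k _ _ /eqP; rewrite /= oner_eq0.
      -- by move=> k _ Hk; case: (on_left_right Hk H).
      -- by move=> _ Hk; exact: on_axis_right Hk H.
      -- by move=> _ Hk; exact: on_left_right Hk H.
      -- by move=> _ Hk; exact: on_axis_right Hk H.
      -- by move=> _ /right_heightE; rewrite (right_heightE H) => /eqP; rewrite (negbTE h0).
  + have DE : D t = Psi s 0 by case: H => _ /(periodic_same per) ->; rewrite chart_axis.
    split.
    * apply: (notdisc s 0) => //; first by split=> //; case: H.
      by rewrite ler10.
    * by rewrite /= (surgery_axis per _ _ H) DE.
    * move=> _; rewrite /= (surgery_level_axis _ _ H).
      case: eqP => // sE; rewrite -(level_axis_right K); apply/level_same/same_point_sym.
      case: H => _; rewrite sE; congr (same_point _ (th _)).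
      by rewrite /fold2; case: bulgeP => *; lra.
  + split.
    * move=> [[x y] sq] /= /esym; apply: (off_chart_neq H).
      have /= [[? ?] [? ?]] := squareP sq.
      have xI : -1 <= x <= 1 by apply/andP.
      have [h hI <-] := up x xI.
      by split; [apply/andP; split => /=; lra|exact: H12].
    * by rewrite /= surgery_off.
    * by move=> _; rewrite /= surgery_level_off.
move=> rep onP; split=> // t /onP[h hI /=].
rewrite /path2 eqxx => th' _; apply: (@surgery_level_left _ _ K _ l t h).
  by split=> //; exact: H12.
by apply/eqP; move/andP: hI => [? ?]; lra.
Qed.

End Moves.

(** * The third Reidemeister move in a chart *)

Section StrandLevels.
Variables (R : realType) (D : diagram R) (K : strand_chart D).
Hypothesis D_smooth : forall t, smooth_at D t.
Variables (f g : R -> R) (zs : seq R) (adm : admissible f g zs) (l : passage).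
Implicit Types (s t h : R).
Local Notation per := (curve_periodic D).
Local Notation D' := (surgery_diagram K D_smooth adm l).

Let dl t h : on_left K t h -> chart_domain (g h) h.
Proof. by case=> h12 _; split=> //; exact: (adm_g_range adm). Qed.

Let dr t h : on_right K t h -> chart_domain (f h) h.
Proof. by case=> h12 _; split=> //; exact: (adm_f_range adm). Qed.

Let da t s : on_axis K t s -> chart_domain s 0.
Proof. by case=> s4 _; split=> //; apply/andP; split; lra. Qed.

Lemma levels_left_right s t h k : on_left K s h -> on_right K t k -> D' s = D' t ->
  level D' s = other_passage l /\ level D' t = l.
Proof.
move=> H H'; rewrite /= (surgery_left _ _ H) (surgery_right _ _ H').
move=> /(chart_inj (dl H) (dr H'))[E1 E2]; subst k.
have h0 : h != 0 by apply: (meet_neq0 adm).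
by rewrite (surgery_level_left _ _ H)// (surgery_level_right _ _ H').
Qed.

Lemma levels_left_axis s t h p : on_left K s h -> on_axis K t p -> D' s = D' t ->
  level D' s = level D (lbase K) /\ level D' t = other_passage (level D (lbase K)).
Proof.
move=> H H'; rewrite /= (surgery_left _ _ H) (surgery_axis per _ _ H').
move=> /(chart_inj (dl H) (da H'))[E1 E2]; subst h p.
rewrite (surgery_level_left0 _ _ H) (surgery_level_axis _ _ H') ifF; last first.
  by apply/negbTE; rewrite eq_sym; apply/eqP; exact: f0_neq_g0 adm.
split=> //; rewrite -level_axis_left; apply: level_same.
by case: H' => _; rewrite (adm_g0_eq0 adm).
Qed.

Lemma levels_right_axis s t h p : on_right K s h -> on_axis K t p -> D' s = D' t ->
  level D' s = level D (rbase K) /\ level D' t = other_passage (level D (rbase K)).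
Proof.
move=> H H'; rewrite /= (surgery_right _ _ H) (surgery_axis per _ _ H').
move=> /(chart_inj (dr H) (da H'))[E1 E2]; subst h p.
by rewrite (surgery_level_right0 _ _ H) (surgery_level_axis _ _ H') eqxx.
Qed.

End StrandLevels.

Section Fan.
Variable R : realType.
Implicit Types (a b x y : R).

(** A piecewise affine embedding of the picture of the third move. In the coordinates
    a = x - y, b = - x - y the two diagonals are the lines a = 0 and b = 0; they are sent to
    the left strand, up to the bulge, and to the axis, and the third strand, on either side
    of their crossing, to the two positions of the right strand. *)
Definition fan_s a b := a + Num.max 0 (Num.min a ((a + b) / 2)).
Definition fan_h a b := 3 * b - Num.max 0 (Num.min a b).

Variant fan_spec a b : R -> R -> Type :=
| FanLeft of a <= 0 : fan_spec a b a (3 * b)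
| FanUp of 0 <= a & a <= b : fan_spec a b (2 * a) (3 * b - a)
| FanRight of 0 <= b & b <= a : fan_spec a b (3 / 2 * a + b / 2) (2 * b)
| FanDown of - a <= b & b <= 0 : fan_spec a b (3 / 2 * a + b / 2) (3 * b)
| FanBelow of 0 <= a & b <= - a : fan_spec a b a (3 * b).

Lemma fanP a b : fan_spec a b (fan_s a b) (fan_h a b).
Proof.
rewrite /fan_s /fan_h; have [a0|a0] := leP a 0.
  have E : Num.min a ((a + b) / 2) <= 0 by rewrite ge_min a0.
  have E' : Num.min a b <= 0 by rewrite ge_min a0.
  by rewrite (max_l E) (max_l E') addr0 subr0; exact: FanLeft.
have [ab|ab] := leP a b.
  rewrite (@min_l _ _ a ((a + b) / 2)); last lra.
  rewrite (max_r (ltW a0)) (_ : a + a = 2 * a); last by ring.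
  by apply: FanUp => //; exact: ltW.
rewrite (@min_r _ _ a ((a + b) / 2)); last lra.
have [b0|b0] := leP 0 b.
  rewrite max_r; last lra.
  rewrite (_ : a + _ = 3 / 2 * a + b / 2); last by field.
  rewrite (_ : 3 * b - b = 2 * b); last by ring.
  by apply: FanRight => //; exact: ltW.
rewrite subr0; have [ab'|ab'] := leP (- a) b.
  rewrite max_r; last lra.
  rewrite (_ : a + _ = 3 / 2 * a + b / 2); last by field.
  by apply: FanDown => //; exact: ltW.
rewrite max_l; last lra.
by rewrite addr0; apply: FanBelow; exact: ltW.
Qed.

Lemma fan_inj a b a' b' : fan_s a b = fan_s a' b' -> fan_h a b = fan_h a' b' ->
  a = a' /\ b = b'.
Proof. by case: (fanP a b); case: (fanP a' b') => *; split; lra. Qed.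

Definition plane3 (q : R * R) : R * R :=
  let h := fan_h (q.1 - q.2) (- q.1 - q.2) in (fan_s (q.1 - q.2) (- q.1 - q.2) + bulge h, h).

Lemma plane3_range x y : -1 <= x -> x <= 1 -> -1 <= y -> y <= 1 ->
  chart_domain (plane3 (x, y)).1 (plane3 (x, y)).2.
Proof.
move=> x1 x2 y1 y2; rewrite /plane3 /=.
have [s1 s2 h1 h2] : [/\ -2 <= fan_s (x - y) (- x - y), fan_s (x - y) (- x - y) <= 3,
    -6 <= fan_h (x - y) (- x - y) & fan_h (x - y) (- x - y) <= 6].
  by case: (fanP (x - y) (- x - y)) => *; split; lra.
by case: bulgeP => *; split; apply/andP; split; lra.
Qed.

Lemma plane3_continuous : continuous plane3.
Proof.
have cM (T : topologicalType) (p q : T -> R) : continuous p -> continuous q ->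
    continuous (fun t => Num.max (p t) (q t)).
  by move=> cp cq t; apply: continuous_max; [exact: cp|exact: cq].
have cm (T : topologicalType) (p q : T -> R) : continuous p -> continuous q ->
    continuous (fun t => Num.min (p t) (q t)).
  by move=> cp cq t; apply: continuous_min; [exact: cp|exact: cq].
have cD (T : topologicalType) (p q : T -> R) : continuous p -> continuous q ->
    continuous (fun t => p t + q t).
  by move=> cp cq t; apply: cvgD; [exact: cp|exact: cq].
have cN (T : topologicalType) (p : T -> R) : continuous p -> continuous (fun t => - p t).
  by move=> cp t; apply: cvgN; exact: cp.
have cZ (T : topologicalType) (k : R) (p : T -> R) : continuous p -> continuous (fun t => k * p t).
  by move=> cp t; apply: cvgM; [exact: cvg_cst|exact: cp].
have cC (T : topologicalType) (k : R) : continuous (fun _ : T => k) by move=> t; exact: cvg_cst.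
have cV (T : topologicalType) (k : R) (p : T -> R) : continuous p -> continuous (fun t => p t / k).
  by move=> cp t; apply: cvgM; [exact: cp|exact: cvg_cst].
have c1 : continuous (fun q : R * R => q.1) by move=> q; exact: cvg_fst.
have c2 : continuous (fun q : R * R => q.2) by move=> q; exact: cvg_snd.
have ca : continuous (fun q : R * R => q.1 - q.2) by apply: (cD) => //; exact: (cN).
have cb : continuous (fun q : R * R => - q.1 - q.2) by apply: (cD); exact: (cN).
have ch : continuous (fun q : R * R => fan_h (q.1 - q.2) (- q.1 - q.2)).
  apply: (cD); first exact: (cZ).
  by apply: (cN); apply: (cM); [exact: (cC)|exact: (cm)].
have cs : continuous (fun q : R * R => fan_s (q.1 - q.2) (- q.1 - q.2)).
  apply: (cD) => //; apply: (cM); first exact: (cC).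
  by apply: (cm) => //; apply: (cV); apply: (cD _ _ _ ca cb).
rewrite /plane3; apply: (@continuous_pair _ _ (fun q => _) (fun q => _)) => //.
apply: (cD) => //; apply: (cM); first exact: (cC).
apply: (cm); first by apply: (cV); apply: (cD) => //; exact: (cC).
apply: (cD); first exact: (cC).
by apply: (cN); apply: (cV); apply: (cD) => //; exact: (cC).
Qed.

End Fan.

Section SecondMove.
Variables (R : realType) (D : diagram R) (K : strand_chart D).
Hypothesis D_smooth : forall t, smooth_at D t.
Implicit Types (s h t u x y : R).

Local Notation Psi := (chart_map (chart_x K) (chart_y K)).
Local Notation th := (axis K).
Local Notation lb := (lbase K).
Local Notation ls := (lscale K).
Local Notation rb := (rbase K).
Local Notation rs := (rscale K).
Local Notation per := (curve_periodic D).
Local Notation l := (level D rb).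
Local Notation D2 := (folded2 K D_smooth l).
Local Notation D3 := (folded3 K D_smooth l).

Definition path3 (i : 'I_3) : R -> R :=
  match val i with
  | 0%N => fun h => lb + ls * h
  | 1%N => th
  | _ => fun h => rb + rs * h
  end.

Definition start3 (i : 'I_3) : R := match val i with 0%N => -6 | 1%N => -2 | _ => -3 end.
Definition stop3 (i : 'I_3) : R := match val i with 0%N => 6 | 1%N => 3 | _ => 3 end.

Definition levels3 (i j : 'I_3) : passage :=
  match val i, val j with
  | 0%N, 1%N => level D lb
  | 1%N, 0%N => other_passage (level D lb)
  | 2%N, _ => l
  | _, _ => other_passage l
  end.

Definition o0 : 'I_3 := ord0.
Definition o1 : 'I_3 := @Ordinal 3 1 isT.
Definition o2 : 'I_3 := ord_max.

Lemma I3P (P : 'I_3 -> Prop) : P o0 -> P o1 -> P o2 -> forall i, P i.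
Proof.
move=> P0 P1 P2 [[|[|[|//]]] Hi].
- by rewrite (_ : Ordinal Hi = o0)//; apply/val_inj.
- by rewrite (_ : Ordinal Hi = o1)//; apply/val_inj.
- by rewrite (_ : Ordinal Hi = o2)//; apply/val_inj.
Qed.

Lemma range3 i h : start3 i <= h <= stop3 i -> -6 <= h <= 6.
Proof.
by move: i; apply: I3P; rewrite /start3 /stop3 /= => /andP[? ?]; apply/andP; split; lra.
Qed.

Lemma on0 h : start3 o0 <= h <= stop3 o0 -> on_left K (path3 o0 h) h.
Proof. by move=> /range3/andP[? ?]; apply: left_on; apply/andP; split; lra. Qed.

Lemma on1 s : start3 o1 <= s <= stop3 o1 -> on_axis K (path3 o1 s) s.
Proof. by rewrite /start3 /stop3 /= => /andP[? ?]; apply: axis_on; apply/andP; split; lra. Qed.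

Lemma on2 h : start3 o2 <= h <= stop3 o2 -> on_right K (path3 o2 h) h.
Proof. by move=> /range3/andP[? ?]; apply: right_on; apply/andP; split; lra. Qed.

Section Folded.
Variables (f : R -> R) (zs : seq R) (adm : admissible f (@bulge R) zs).
Local Notation E := (surgery_diagram K D_smooth adm l).

Lemma folded_left h : start3 o0 <= h <= stop3 o0 -> E (path3 o0 h) = Psi (bulge h) h.
Proof. by move=> /on0 H; rewrite /= (surgery_left _ _ H). Qed.

Lemma folded_axis s : start3 o1 <= s <= stop3 o1 -> E (path3 o1 s) = Psi s 0.
Proof. by move=> /on1 H; rewrite /= (surgery_axis per _ _ H). Qed.

Lemma folded_right h : start3 o2 <= h <= stop3 o2 -> E (path3 o2 h) = Psi (f h) h.
Proof. by move=> /on2 H; rewrite /= (surgery_right _ _ H). Qed.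

Lemma folded_levels (a b : 'I_3 -> R) :
  (forall i t, on_strand a b i t <-> exists2 h, start3 i <= h <= stop3 i & same_point t (path3 i h)) ->
  strand_levels a b levels3 E.
Proof.
move=> onP i j s t ij /onP[h hI sh] /onP[k kI tk] st.
have trl u v p : same_point u v -> on_left K v p -> on_left K u p.
  by move=> uv [pI H]; split=> //; exact: same_point_trans H.
have trr u v p : same_point u v -> on_right K v p -> on_right K u p.
  by move=> uv [pI H]; split=> //; exact: same_point_trans H.
have tra u v p : same_point u v -> on_axis K v p -> on_axis K u p.
  by move=> uv [pI H]; split=> //; exact: same_point_trans H.
move: i j ij hI sh kI tk; apply: I3P; apply: I3P => // _ hI sh kI tk.
- by have [-> _] := levels_left_axis (trl _ _ _ sh (on0 hI)) (tra _ _ _ tk (on1 kI)) st.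
- by have [-> _] := levels_left_right (trl _ _ _ sh (on0 hI)) (trr _ _ _ tk (on2 kI)) st.
- by have [_ ->] := levels_left_axis (trl _ _ _ tk (on0 kI)) (tra _ _ _ sh (on1 hI)) (esym st).
- by have [_ ->] := levels_right_axis (trr _ _ _ tk (on2 kI)) (tra _ _ _ sh (on1 hI)) (esym st).
- by have [_ ->] := levels_left_right (trl _ _ _ tk (on0 kI)) (trr _ _ _ sh (on2 hI)) (esym st).
- by have [-> _] := levels_right_axis (trr _ _ _ sh (on2 hI)) (tra _ _ _ tk (on1 kI)) st.
Qed.

End Folded.

(** The moving strand 2 passes in the same way through both crossings, so it is above both
    others, below both, or virtual. Only in the first two cases must the crossing of the
    others be classical. *)
Lemma levels3_pattern : level D rb = Virtual \/ level D lb <> Virtual ->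
  [\/ classical3 levels3, virtual3 levels3 | mixed3 levels3].
Proof.
move=> lv; case lrE : (level D rb) => //.
- have llv : level D lb <> Virtual by case: lv => //; rewrite lrE.
  apply: Or31; exists (fun i : 'I_3 => match val i, level D lb with
     2%N, _ => 2%N | 0%N, Over => 1%N | 0%N, _ => 0%N | _, Over => 0%N | _, _ => 1%N end).
    by case: (level D lb) llv => // _; apply: I3P; apply: I3P => //=.
  by apply: I3P; apply: I3P => //= _; rewrite /levels3 /= ?lrE; case: (level D lb) llv.
- have llv : level D lb <> Virtual by case: lv => //; rewrite lrE.
  apply: Or31; exists (fun i : 'I_3 => match val i, level D lb with
     2%N, _ => 0%N | 0%N, Over => 2%N | 0%N, _ => 1%N | _, Over => 1%N | _, _ => 2%N end).
    by case: (level D lb) llv => // _; apply: I3P; apply: I3P => //=.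
  by apply: I3P; apply: I3P => //= _; rewrite /levels3 /= ?lrE; case: (level D lb) llv.
- case llE : (level D lb).
  + by apply: Or33; apply: I3P; apply: I3P => //= _; rewrite /levels3 /= ?lrE ?llE /=; (split=> [H|]; [first [by left|by right|by []]|by case=> /(congr1 val)]).
  + by apply: Or33; apply: I3P; apply: I3P => //= _; rewrite /levels3 /= ?lrE ?llE /=; (split=> [H|]; [first [by left|by right|by []]|by case=> /(congr1 val)]).
  + by apply: Or32; apply: I3P; apply: I3P => //= _; rewrite /levels3 /= ?lrE ?llE.
Qed.

Local Notation phi := (fun q => Psi (plane3 q).1 (plane3 q).2).

Lemma plane3_disc : disc_embedding phi.
Proof.
apply: chart_disc_embedding; first exact: plane3_continuous.
  by move=> [x y] /squareP /= [[? ?] [? ?]]; exact: plane3_range.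
move=> [x y] [x' y'] _ _; rewrite /plane3 /= => + E2; rewrite E2 => /addIr E1.
by have [? ?] := fan_inj E1 E2; congr pair; lra.
Qed.

Definition front3 (i : 'I_3) x : R := match val i with
  | 0%N => (- 1 + 1) / 2 + (1 - - 1) / 2 * x
  | 1%N => (1 + - 1) / 2 + (- 1 - 1) / 2 * x
  | _ => - 2^-1 + (0 - - 2^-1) * `|x|
  end.

Definition back3 (i : 'I_3) x : R := match val i with
  | 0%N => (- 1 + 1) / 2 + (1 - - 1) / 2 * x
  | 1%N => (1 + - 1) / 2 + (- 1 - 1) / 2 * x
  | _ => 2^-1 + (0 - 2^-1) * `|x|
  end.

Lemma front3_graph i : triangle_tangle (- 2^-1) i = graph_over (front3 i).
Proof.
move: i; apply: I3P; rewrite /triangle_tangle /front3 /=; [exact: line_graph|exact: line_graph|].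
exact: roof_graph.
Qed.

Lemma back3_graph i : triangle_tangle 2^-1 i = graph_over (back3 i).
Proof.
move: i; apply: I3P; rewrite /triangle_tangle /back3 /=; [exact: line_graph|exact: line_graph|].
exact: roof_graph.
Qed.

Lemma plane3E x y s h : fan_s (x - y) (- x - y) = s -> fan_h (x - y) (- x - y) = h ->
  Psi (plane3 (x, y)).1 (plane3 (x, y)).2 = Psi (s + bulge h) h.
Proof. by rewrite /plane3 /= => -> ->. Qed.

Lemma bulge0 : bulge (0 : R) = 0.
Proof. by case: bulgeP => *; lra. Qed.

Lemma diagonal0 x : -1 <= x <= 1 ->
  phi (x, (- 1 + 1) / 2 + (1 - - 1) / 2 * x) = Psi (bulge (- 6 * x)) (- 6 * x).
Proof.
move=> /andP[? ?]; set y := _ + _.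
have -> : y = x by rewrite /y; field.
rewrite (@plane3E x x 0 (- 6 * x)) ?add0r//.
  by case: (fanP (x - x)) => *; lra.
by case: (fanP (x - x)) => *; lra.
Qed.

Lemma diagonal1 x : -1 <= x <= 1 ->
  phi (x, (1 + - 1) / 2 + (- 1 - 1) / 2 * x) = Psi (if x <= 0 then 2 * x else 3 * x) 0.
Proof.
move=> /andP[? ?]; set y := _ + _.
have -> : y = - x by rewrite /y; field.
rewrite (@plane3E x (- x) (if x <= 0 then 2 * x else 3 * x) 0).
- by rewrite bulge0 addr0.
- by case: leP => ?; case: (fanP (x - - x)) => *; lra.
- by case: (fanP (x - - x)) => *; lra.
Qed.

(** One affine piece of the right strand for each piece of the embedding. *)
Lemma front_strand x h : -1 <= x <= 1 ->
  [\/ x <= - (1 / 3) /\ h = 3 / 2 - 3 / 2 * x, - (1 / 3) <= x <= 1 / 3 /\ h = 1 - 3 * x |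
      1 / 3 <= x /\ h = 3 / 2 - 9 / 2 * x] ->
  phi (x, - 2^-1 + (0 - - 2^-1) * `|x|) = Psi (fold2 h) h.
Proof.
move=> /andP[? ?] hE; set y := _ + _.
have yE : y = - 2^-1 + 2^-1 * `|x| by rewrite /y; field.
rewrite (@plane3E x y (1 - 2 * bulge h) h); first by congr Psi; rewrite /fold2; ring.
  move: hE; have [x0|x0] := leP 0 x.
    rewrite ger0_norm// in yE; move=> [[? ->]|[/andP[? ?] ->]|[? ->]];
      by case: bulgeP => *; case: (fanP (x - y)) => *; lra.
  rewrite ltr0_norm// in yE; move=> [[? ->]|[/andP[? ?] ->]|[? ->]];
    by case: bulgeP => *; case: (fanP (x - y)) => *; lra.
move: hE; have [x0|x0] := leP 0 x.
  rewrite ger0_norm// in yE; move=> [[? ->]|[/andP[? ?] ->]|[? ->]];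
    by case: (fanP (x - y)) => *; lra.
rewrite ltr0_norm// in yE; move=> [[? ->]|[/andP[? ?] ->]|[? ->]];
  by case: (fanP (x - y)) => *; lra.
Qed.

Lemma back_strand x h : -1 <= x <= 1 ->
  (x <= 0 /\ h = - (3 / 2) - 9 / 2 * x) \/ (0 <= x /\ h = - (3 / 2) - 3 / 2 * x) ->
  phi (x, 2^-1 + (0 - 2^-1) * `|x|) = Psi (fold3 h) h.
Proof.
move=> /andP[? ?] hE; set y := _ + _.
have yE : y = 2^-1 - 2^-1 * `|x| by rewrite /y; field.
rewrite (@plane3E x y (detour h) h); first by congr Psi; rewrite /fold3; ring.
  move: hE; move=> [[x0 hE]|[x0 hE]].
    rewrite ler0_norm// in yE; rewrite hE; case: detourP => *; try (exfalso; lra).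
    + by case: (fanP (x - y)) => *; lra.
    + by case: (fanP (x - y)) => *; lra.
    + by case: bulgeP => *; case: (fanP (x - y)) => *; lra.
  rewrite ger0_norm// in yE; rewrite hE; case: detourP => *; try (exfalso; lra).
  + by case: (fanP (x - y)) => *; lra.
  + by case: (fanP (x - y)) => *; lra.
  + by case: (fanP (x - y)) => *; lra.
by move: hE; move=> [[x0 ->]|[x0 ->]]; [rewrite ler0_norm// in yE|rewrite ger0_norm// in yE];
  case: (fanP (x - y)) => *; lra.
Qed.

Lemma strand0 h : start3 o0 <= h <= stop3 o0 -> exists2 x, -1 <= x <= 1 & h = - 6 * x.
Proof.
rewrite /start3 /stop3 /= => /andP[? ?]; exists (- h / 6); last by field.
by apply/andP; split; lra.
Qed.

Lemma strand0' x : -1 <= x <= 1 -> start3 o0 <= - 6 * x <= stop3 o0.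
Proof.
by rewrite /start3 /stop3 /= => /andP[? ?]; apply/andP; split; lra.
Qed.

Lemma strand1 h : start3 o1 <= h <= stop3 o1 ->
    exists2 x, -1 <= x <= 1 & h = if x <= 0 then 2 * x else 3 * x.
Proof.
rewrite /start3 /stop3 /= => /andP[? ?]; have [h0|h0] := leP h 0.
  exists (h / 2); first by apply/andP; split; lra.
  by rewrite ifT; [field|lra].
exists (h / 3); first by apply/andP; split; lra.
by rewrite ifF; [field|apply/negbTE; rewrite -ltNge; lra].
Qed.

Lemma strand1' x : -1 <= x <= 1 -> start3 o1 <= (if x <= 0 then 2 * x else 3 * x) <= stop3 o1.
Proof.
by rewrite /start3 /stop3 /= => /andP[? ?]; case: (leP x 0) => ?; apply/andP; split; lra.
Qed.

Lemma strand2 h : start3 o2 <= h <= stop3 o2 -> exists2 x, -1 <= x <= 1 &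
    [\/ x <= - (1 / 3) /\ h = 3 / 2 - 3 / 2 * x, - (1 / 3) <= x <= 1 / 3 /\ h = 1 - 3 * x |
      1 / 3 <= x /\ h = 3 / 2 - 9 / 2 * x].
Proof.
rewrite /start3 /stop3 /= => /andP[? ?]; have [h2|h2] := leP 2 h.
  exists (1 - 2 / 3 * h); first by apply/andP; split; lra.
  by apply: Or31; split; lra.
have [h0|h0] := leP 0 h.
  exists ((1 - h) / 3); first by apply/andP; split; lra.
  by apply: Or32; split; [apply/andP; split; lra|lra].
exists (1 / 3 - 2 / 9 * h); first by apply/andP; split; lra.
by apply: Or33; split; lra.
Qed.

Lemma strand2' x : -1 <= x <= 1 -> exists2 h, start3 o2 <= h <= stop3 o2 &
    [\/ x <= - (1 / 3) /\ h = 3 / 2 - 3 / 2 * x, - (1 / 3) <= x <= 1 / 3 /\ h = 1 - 3 * x |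
      1 / 3 <= x /\ h = 3 / 2 - 9 / 2 * x].
Proof.
rewrite /start3 /stop3 /= => /andP[? ?]; have [x1|x1] := leP x (- (1 / 3)).
  exists (3 / 2 - 3 / 2 * x); first by apply/andP; split; lra.
  exact: Or31.
have [x2|x2] := leP x (1 / 3).
  exists (1 - 3 * x); first by apply/andP; split; lra.
  by apply: Or32; split=> //; rewrite andbT ltW.
exists (3 / 2 - 9 / 2 * x); first by apply/andP; split; lra.
by apply: Or33; split=> //; exact: ltW.
Qed.

Lemma strand3 h : start3 o2 <= h <= stop3 o2 -> exists2 x, -1 <= x <= 1 &
    (x <= 0 /\ h = - (3 / 2) - 9 / 2 * x) \/ (0 <= x /\ h = - (3 / 2) - 3 / 2 * x).
Proof.
rewrite /start3 /stop3 /= => /andP[? ?]; have [h2|h2] := leP (- (3 / 2)) h.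
  exists (- (1 / 3) - 2 / 9 * h); first by apply/andP; split; lra.
  by left; split; lra.
exists (- 1 - 2 / 3 * h); first by apply/andP; split; lra.
by right; split; lra.
Qed.

Lemma strand3' x : -1 <= x <= 1 -> exists2 h, start3 o2 <= h <= stop3 o2 &
    (x <= 0 /\ h = - (3 / 2) - 9 / 2 * x) \/ (0 <= x /\ h = - (3 / 2) - 3 / 2 * x).
Proof.
rewrite /start3 /stop3 /= => /andP[? ?]; have [x1|x1] := leP x 0.
  exists (- (3 / 2) - 9 / 2 * x); first by apply/andP; split; lra.
  by left.
exists (- (3 / 2) - 3 / 2 * x); first by apply/andP; split; lra.
by right; split=> //; exact: ltW.
Qed.

End SecondMove.

Section SecondMove.
Variables (R : realType) (D : diagram R) (K : strand_chart D).
Hypothesis D_smooth : forall t, smooth_at D t.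
Implicit Types (s h t u x y : R).

Local Notation Psi := (chart_map (chart_x K) (chart_y K)).
Local Notation th := (axis K).
Local Notation lb := (lbase K).
Local Notation ls := (lscale K).
Local Notation rb := (rbase K).
Local Notation rs := (rscale K).
Local Notation per := (curve_periodic D).
Local Notation l := (level D rb).
Local Notation D2 := (folded2 K D_smooth l).
Local Notation path3 := (path3 K).
Local Notation phi := (fun q => Psi (plane3 q).1 (plane3 q).2).
Local Notation D3 := (folded3 K D_smooth l).

(** Strand 0 is the left strand, strand 1 the axis and strand 2, the moving one, the right
    strand; between the heights -3 and 3 it passes across the crossing of the other two. *)
Lemma second_move : level D rb = Virtual \/ level D lb <> Virtual -> reidemeister3 D2 D3.
Proof.
move=> lv.
have gt2 := admissible_fold2 R; have gt3 := admissible_fold3 R.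
have [] := @tangle_replacement_intro R 3 (triangle_tangle (- 2^-1)) (triangle_tangle 2^-1)
  (@front3 R) (@back3 R) path3 (@start3 R) (@stop3 R) D2 D3 phi.
- exact: plane3_disc.
- exact: front3_graph.
- exact: back3_graph.
- apply: I3P; rewrite /path3 /=; [apply: monotone_path_affine; exact: lscale_neq0|exact: axis_path|].
  by apply: monotone_path_affine; exact: rscale_neq0.
- by apply: I3P; rewrite /start3 /stop3 /=; lra.
- apply: I3P; rewrite /path3 /start3 /stop3 /=.
  + by apply: short_strand; try (apply/andP; split; lra); exact: lscale_small.
  + apply: le_lt_trans (axis_short K).
    have [m|m] := axis_mono K.
      have /ltW ? := m 3 4 ltac:(lra); have /ltW ? := m (-2) 3 ltac:(lra).
      by rewrite !ger0_norm; lra.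
    have /ltW ? := m 3 4 ltac:(lra); have /ltW ? := m (-2) 3 ltac:(lra).
    by rewrite !ler0_norm; lra.
  + by apply: short_strand; try (apply/andP; split; lra); exact: rscale_small.
- move=> i j h k hI kI; move: i j hI kI; apply: I3P; apply: I3P => // hI kI E; exfalso.
  + by apply: (on_axis_left (on1 K kI)); split; [case: (on0 K hI)|exact: same_point_sym E].
  + by apply: (on_left_right (on0 K hI)); split; [case: (on2 K kI)|exact: E].
  + by apply: (on_axis_left (on1 K hI)); split; [case: (on0 K kI)|exact: E].
  + by apply: (on_axis_right (on1 K hI)); split; [case: (on2 K kI)|exact: E].
  + by apply: (on_left_right (on0 K kI)); split; [case: (on2 K hI)|exact: same_point_sym E].
  + by apply: (on_axis_right (on1 K kI)); split; [case: (on2 K hI)|exact: same_point_sym E].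
- apply: I3P => h hI.
  + by have [x xI hE] := strand0 hI; exists x; rewrite // (folded_left K D_smooth gt2)// hE (diagonal0 K).
  + by have [x xI hE] := strand1 hI; exists x; rewrite // (folded_axis K D_smooth gt2)// hE (diagonal1 K).
  + by have [x xI hE] := strand2 hI; exists x; rewrite // (folded_right K D_smooth gt2)// (front_strand K xI hE).
- apply: I3P => x xI.
  + by exists (- 6 * x); [exact: strand0'|rewrite (folded_left K D_smooth gt2) ?strand0'// (diagonal0 K)].
  + by eexists; [exact: strand1' xI|rewrite (folded_axis K D_smooth gt2) ?strand1'// (diagonal1 K)].
  + by have [h hI hE] := strand2' xI; exists h; rewrite // (folded_right K D_smooth gt2)// (front_strand K xI hE).
- apply: I3P => h hI.
  + by have [x xI hE] := strand0 hI; exists x; rewrite // (folded_left K D_smooth gt3)// hE (diagonal0 K).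
  + by have [x xI hE] := strand1 hI; exists x; rewrite // (folded_axis K D_smooth gt3)// hE (diagonal1 K).
  + by have [x xI hE] := strand3 hI; exists x; rewrite // (folded_right K D_smooth gt3)// (back_strand K xI hE).
- apply: I3P => x xI.
  + by exists (- 6 * x); [exact: strand0'|rewrite (folded_left K D_smooth gt3) ?strand0'// (diagonal0 K)].
  + by eexists; [exact: strand1' xI|rewrite (folded_axis K D_smooth gt3) ?strand1'// (diagonal1 K)].
  + by have [h hI hE] := strand3' xI; exists h; rewrite // (folded_right K D_smooth gt3)// (back_strand K xI hE).
- move=> t nt.
  have notdisc p k : chart_domain p k -> D2 t = Psi p k ->
     (forall x y, -1 <= x -> x <= 1 -> -1 <= y -> y <= 1 -> fan_h (x - y) (- x - y) = k ->
       fan_s (x - y) (- x - y) + bulge k = p -> False) -> ~ (phi @` @square R) (D2 t).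
    move=> dom E no [[x y] sq]; rewrite E.
    have /= [[? ?] [? ?]] := squareP sq.
    move=> /(chart_inj (plane3_range _ _ _ _) dom)[]// E1 E2.
    by apply: (no x y) => //; rewrite -E1 -E2.
  case: (positionP K t) => [h H|h H|s H|H].
  + have nh : ~ (-6 <= h <= 6) by move=> hI; apply: (nt o0 h hI); rewrite /path3 /=; case: H.
    split.
    * apply: (notdisc (bulge h) h).
      -- by split; [exact: (adm_g_range gt2 (proj1 H))|exact: (proj1 H)].
      -- by rewrite /= (surgery_left _ _ H).
      -- move=> x y ? ? ? ? E1 E2; apply: nh; rewrite -E1.
         have : fan_s (x - y) (- x - y) = 0 by lra.
         by case: (fanP (x - y)) => *; apply/andP; split; lra.
    * by rewrite /= !(surgery_left _ _ H).
    * move=> _ /=; have [h0|h0] := eqVneq h 0.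
        by rewrite h0 in H; rewrite !(surgery_level_left0 _ _ H).
      by rewrite !(surgery_level_left _ _ H).
  + have nh : ~ (-3 <= h <= 3) by move=> hI; apply: (nt o2 h hI); rewrite /path3 /=; case: H.
    have h3 : 3 <= `|h|.
      rewrite ler_normr; apply/orP; have [?|?] := leP 3 h; first by left.
      by right; rewrite lerNr; case: (leP h (- 3)) => // ?; case: nh; apply/andP; split; lra.
    split.
    * apply: (notdisc (fold2 h) h).
      -- by split; [exact: (adm_f_range gt2 (proj1 H))|exact: (proj1 H)].
      -- by rewrite /= (surgery_right _ _ H).
      -- move=> x y ? ? ? ? E1 E2; apply: nh.
         have : fan_s (x - y) (- x - y) = 1 - 2 * bulge h by move: E2; rewrite /fold2 => ?; lra.
         move: E1; case: (bulgeP h); case: (fanP (x - y)) => *; apply/andP; split; lra.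
    * by rewrite /= !(surgery_right _ _ H) fold3_eq.
    * move=> _ /=; have [h0|h0] := eqVneq h 0.
        by rewrite h0 in H; rewrite !(surgery_level_right0 _ _ H).
      by rewrite !(surgery_level_right _ _ H).
  + have ns : ~ (-2 <= s <= 3) by move=> sI; apply: (nt o1 s sI); rewrite /path3 /=; case: H.
    split.
    * apply: (notdisc s 0).
      -- by split; [exact: (proj1 H)|apply/andP; split; lra].
      -- by rewrite /= (surgery_axis per _ _ H).
      -- move=> x y ? ? ? ? E1 E2; apply: ns; rewrite -E2.
         rewrite bulge0 addr0.
         by case: (fanP (x - y)) => *; apply/andP; split; lra.
    * by rewrite /= !(surgery_axis per _ _ H).
    * move=> _ /=; rewrite !(surgery_level_axis _ _ H).
      have f2 : fold2 (0 : R) = 1 by rewrite /fold2 bulge0 subr0.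
      have f3 : fold3 (0 : R) = - (2 / 3).
        by rewrite /fold3 bulge0 add0r; case: detourP => *; lra.
      rewrite f2 f3 !ifF//; apply/eqP => sE; apply: ns; rewrite sE; apply/andP; split; lra.
  + split.
    * move=> [[x y] sq]; rewrite /= (surgery_off _ _ H) => /esym; apply: (off_chart_neq H).
      by have /= [[? ?] [? ?]] := squareP sq; exact: plane3_range.
    * by rewrite /= !surgery_off.
    * by move=> _; rewrite /= !surgery_level_off.
move=> rep onP.
exists (fun i => path_lo (path3 i) (start3 R i) (stop3 R i)),
  (fun i => path_hi (path3 i) (start3 R i) (stop3 R i)), (levels3 K); split=> //.
- exact: (folded_levels onP).
- exact: (folded_levels onP).
- exact: levels3_pattern.
Qed.

End SecondMove.

(** * Local injectivity and uniformity on compact sets *)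

Section LocalInjectivity.
Variable R : realType.
Implicit Types (s y t r : R).

Lemma mean_value (f df : R -> R) : (forall x : R, is_derive x 1 f (df x)) ->
  forall a b, exists2 x, Num.min a b <= x <= Num.max a b & f b - f a = df x * (b - a).
Proof.
move=> fdf.
have key a b : a <= b -> exists2 x, a <= x <= b & f b - f a = df x * (b - a).
  move=> ab; have [|x xI E] := @MVT_segment _ f df a b ab (fun x _ => fdf x).
    apply: continuous_subspaceT => x.
    by apply/differentiable_continuous/derivable1_diffP; have [] := fdf x.
  by exists x => //; move: xI; rewrite in_itv.
move=> a b; have [ab|ba] := leP a b; first exact: key.
have [x xI E] := key b a (ltW ba); exists x => //.
by rewrite -[LHS]opprB E; ring.
Qed.

Lemma box_near (P : R * R -> Prop) s0 y0 : (\forall q \near (s0, y0), P q) ->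
  exists2 r, 0 < r & forall s y, `|s - s0| < r -> `|y - y0| < r -> P (s, y).
Proof.
move=> /nbhs_ballP[r /= r0 rP]; exists r => // s y ss yy.
by apply: rP; split; rewrite /ball/= distrC.
Qed.

Lemma near_box (P : R * R -> Prop) s0 y0 r : 0 < r ->
  (forall s y, `|s - s0| < r -> `|y - y0| < r -> P (s, y)) -> \forall q \near (s0, y0), P q.
Proof.
move=> r0 rP; apply/nbhs_ballP; exists r => //= -[s y] [/= ss yy].
by apply: rP; rewrite distrC.
Qed.

Lemma min_max_close a b s0 r x : `|a - s0| < r -> `|b - s0| < r ->
  Num.min a b <= x <= Num.max a b -> `|x - s0| < r.
Proof.
rewrite !ltr_norml => /andP[a1 a2] /andP[b1 b2].
by case: (leP a b) => ab /andP[x1 x2]; apply/andP; split; lra.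
Qed.

Lemma det_near (a b c d : R * R -> R) (p : R * R) :
  {for p, continuous a} -> {for p, continuous b} -> {for p, continuous c} ->
  {for p, continuous d} -> a p * d p - b p * c p != 0 ->
  exists2 r, 0 < r & forall q1 q2 q3 q4, ball p r q1 -> ball p r q2 -> ball p r q3 ->
    ball p r q4 -> a q1 * d q4 - b q2 * c q3 != 0.
Proof.
move=> ca cb cc cd det0.
pose G (z : ((R * R) * (R * R)) * ((R * R) * (R * R))) :=
  a z.1.1 * d z.2.2 - b z.1.2 * c z.2.1.
pose P := ((p, p), (p, p)).
have cG : {for P, continuous G}.
  have c11 : z.1.1 @[z --> P] --> p.
    exact: (@cvg_comp _ _ _ fst fst _ _ _ (@cvg_fst _ _ _ _ _) (@cvg_fst _ _ _ _ _)).
  have c12 : z.1.2 @[z --> P] --> p.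
    exact: (@cvg_comp _ _ _ fst snd _ _ _ (@cvg_fst _ _ _ _ _) (@cvg_snd _ _ _ _ _)).
  have c21 : z.2.1 @[z --> P] --> p.
    exact: (@cvg_comp _ _ _ snd fst _ _ _ (@cvg_snd _ _ _ _ _) (@cvg_fst _ _ _ _ _)).
  have c22 : z.2.2 @[z --> P] --> p.
    exact: (@cvg_comp _ _ _ snd snd _ _ _ (@cvg_snd _ _ _ _ _) (@cvg_snd _ _ _ _ _)).
  apply: cvgB; apply: cvgM.
  - exact: (cvg_comp _ _ c11 ca).
  - exact: (cvg_comp _ _ c22 cd).
  - exact: (cvg_comp _ _ c12 cb).
  - exact: (cvg_comp _ _ c21 cc).
have /nbhs_ballP[r /= r0 rP] : \forall z \near P, G z != 0 by exact: (cvgr_neq0 _ cG det0).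
exists r => // q1 q2 q3 q4 b1 b2 b3 b4.
apply: (rP ((q1, q2), (q3, q4))).
by split=> /=; [exact: (conj b1 b2)|exact: (conj b3 b4)].
Qed.

Lemma cramer (a b c d u v : R) : a * u + c * v = 0 -> b * u + d * v = 0 ->
  a * d - b * c != 0 -> u = 0 /\ v = 0.
Proof.
move=> E1 E2 det0; split; apply/eqP.
  have : (a * d - b * c) * u = 0.
    by transitivity (d * (a * u + c * v) - c * (b * u + d * v)); [ring|rewrite E1 E2; ring].
  by move/eqP; rewrite mulf_eq0 (negbTE det0).
have : (a * d - b * c) * v = 0.
  by transitivity (a * (b * u + d * v) - b * (a * u + c * v)); [ring|rewrite E1 E2; ring].
by move/eqP; rewrite mulf_eq0 (negbTE det0).
Qed.

Variables lx ly : seq ((R -> R) * (R -> R)).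
Hypotheses (slx : smooth_sep lx) (sly : smooth_sep ly).

Lemma sep_increment l : smooth_sep l -> forall s y s' y', exists x z,
  [/\ Num.min s' s <= x <= Num.max s' s, Num.min y' y <= z <= Num.max y' y &
    sep l s y - sep l s' y' =
      sep (sep_ds l) x y * (s - s') + sep (sep_dh l) s' z * (y - y')].
Proof.
move=> sl s y s' y'.
have d1 (x : R) : is_derive x 1 (fun u => sep l u y) (sep (sep_ds l) x y).
  have := is_derive_sep_curve sl (is_derive_id x 1) (is_derive_cst y x 1).
  by congr is_derive; rewrite mulr1 mulr0 addr0.
have d2 (z : R) : is_derive z 1 (fun u => sep l s' u) (sep (sep_dh l) s' z).
  have := is_derive_sep_curve sl (is_derive_cst s' z 1) (is_derive_id z 1).
  by congr is_derive; rewrite mulr1 mulr0 add0r.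
have [x xI Ex] := mean_value d1 s' s; have [z zI Ez] := mean_value d2 y' y.
by exists x, z; split=> //; rewrite -Ex -Ez; ring.
Qed.

(** By the mean value theorem in each variable, the difference of two points with the same
    image solves a linear system whose determinant is close to the Jacobian at the centre. *)
Lemma chart_locally_injective s0 y0 : chart_jacobian lx ly s0 y0 != 0 ->
  exists2 r, 0 < r & forall s y s' y', `|s - s0| < r -> `|y - y0| < r ->
    `|s' - s0| < r -> `|y' - y0| < r ->
    chart_map lx ly s y = chart_map lx ly s' y' -> s = s' /\ y = y'.
Proof.
move=> jac0.
have [||||r r0 rP] := @det_near (fun q => sep (sep_ds lx) q.1 q.2) (fun q => sep (sep_ds ly) q.1 q.2)
  (fun q => sep (sep_dh lx) q.1 q.2) (fun q => sep (sep_dh ly) q.1 q.2) (s0, y0) _ _ _ _ jac0.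
- exact/continuous_sep/smooth_sep_ds.
- exact/continuous_sep/smooth_sep_ds.
- exact/continuous_sep/smooth_sep_dh.
- exact/continuous_sep/smooth_sep_dh.
exists r => // s y s' y' hs hy hs' hy' [E1 E2].
have [x1 [z1 [x1I z1I I1]]] := sep_increment slx s y s' y'.
have [x2 [z2 [x2I z2I I2]]] := sep_increment sly s y s' y'.
have bl x z : `|x - s0| < r -> `|z - y0| < r -> ball (s0, y0) r (x, z).
  by move=> *; split; rewrite /ball/= distrC.
have := rP (x1, y) (x2, y) (s', z1) (s', z2) _ _ _ _.
move=> /(_ (bl _ _ (min_max_close hs' hs x1I) hy) (bl _ _ (min_max_close hs' hs x2I) hy)
  (bl _ _ hs' (min_max_close hy' hy z1I)) (bl _ _ hs' (min_max_close hy' hy z2I))) /= det0.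
rewrite E1 subrr in I1; rewrite E2 subrr in I2.
have [u0 v0] := cramer (esym I1) (esym I2) det0.
by split; apply/eqP; rewrite -subr_eq0; apply/eqP.
Qed.

End LocalInjectivity.

Section ThinCover.
Variable R : realType.
Implicit Types (s y t r : R).

(** The form of compactness needed for a chart: the width [e] of a strip around its axis
    is chosen locally at first. *)
Lemma thin_cover (T : topologicalType) (A : set T) (P : R -> T -> Prop) : compact A ->
  (forall x, A x -> exists2 r, 0 < r & \forall x' \near x, forall e, 0 < e < r -> P e x') ->
  exists2 e, 0 < e & forall e' x, 0 < e' <= e -> A x -> P e' x.
Proof.
move=> /compact_near_coveringP cA loc.
have : \forall e \near 0^'+, A `<=` (fun x => forall e', 0 < e' <= e -> P e' x).
  apply: (cA R (0^'+) (fun e x => forall e', 0 < e' <= e -> P e' x)) => x Ax.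
  have [r r0 rP] := loc x Ax.
  exists ([set x' : T | forall e : R, 0 < e < r -> P e x'], [set e : R | 0 < e < r]).
    split=> //=; near=> e; apply/andP; split; near: e; [exact: nbhs_right_gt|exact: nbhs_right_lt].
  move=> [x' e] /= [Px' /andP[e0 er]] e' /andP[e'0 e'e]; apply: Px'.
  by rewrite e'0 (le_lt_trans e'e).
move=> cov.
have [e [e0 eP]] : exists e : R, 0 < e /\ A `<=` (fun x => forall e', 0 < e' <= e -> P e' x).
  near (0 : R)^'+ => e; exists e; split; last by near: e.
  by near: e; exact: nbhs_right_gt.
by exists e => // e' x e'I Ax; exact: eP.
Unshelve. all: by end_near. Qed.

End ThinCover.

(** * Isolated crossings *)

Section Isolation.
Variable R : realType.
Implicit Types (s t : R) (D : diagram R).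

Lemma finite_isolated (A : set R) : finite_set A ->
  forall t0, exists2 d, 0 < d & forall t, A t -> `|t - t0| < d -> t = t0.
Proof.
move=> /finite_seqP[s ->] t0; elim: s => [|x s [d d0 dP]]; first by exists 1.
have [->|xt] := eqVneq x t0.
  by exists d => // t /=; rewrite inE => /orP[/eqP//|]; exact: dP.
have x0 : 0 < `|x - t0| by rewrite normr_gt0 subr_eq0.
exists (Num.min d `|x - t0|); first by rewrite lt_min d0 x0.
move=> t /=; rewrite inE lt_min => /orP[/eqP ->|ts] /andP[h1 h2]; last exact: dP.
by rewrite ltxx in h2.
Qed.

Lemma at_crossing_same D t t' : same_point t t' -> at_crossing D t -> at_crossing D t'.
Proof.
move=> tt [s [ns E]]; exists s; split.
  by move=> H; apply: ns; exact: same_point_trans H (same_point_sym tt).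
by rewrite E; apply: periodic_same tt; exact: curve_periodic.
Qed.

Lemma crossing_isolated D t0 :
  exists2 d, 0 < d & forall t, `|t - t0| < d -> at_crossing D t -> t = t0.
Proof.
have [_ fin _] := curve_generic D.
have [d d0 dP] := finite_isolated (finite_image (fun x => t0 + centered (x - t0)) fin) t0.
exists (Num.min d 2^-1); first by rewrite lt_min d0 /= invr_gt0.
move=> t; rewrite lt_min => /andP[td t2] cr; apply: dP => //.
have tf : same_point t (fracpart t).
  by apply/same_pointP; exists (Num.floor t); rewrite /fracpart subrK.
exists (fracpart t).
  split; last exact: at_crossing_same tf cr.
  have /andP[] := floor_itv t; rewrite intrD /fracpart => *.
  by apply/andP; split; lra.
rewrite (@centeredE _ _ (t - t0))//; first by rewrite addrC subrK.
exact: same_pointD (same_point_sym tf).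
Qed.

Lemma increasing_of_derive (f : R -> R) : smooth f -> (forall s, 0 < derive1 f s) ->
  forall s s', s < s' -> f s < f s'.
Proof.
move=> sf f0 s s' ss; have [x _ E] := mean_value (smooth_is_derive sf) s s'.
by rewrite -subr_gt0 E mulr_gt0// subr_gt0.
Qed.

(** A logistic function: the unit interval is prolonged beyond both ends without leaving a
    given neighbourhood of it. *)
Lemma squeezed_line (k : R) : 0 < k -> exists S : R -> R,
  [/\ smooth S, S 0 = 0, S 1 = 1, forall s, 0 < derive1 S s & forall s, - k < S s < 1 + k].
Proof.
move=> k0; pose a := ln ((1 + k) / k).
have k1 : 1 < (1 + k) / k by rewrite ltr_pdivlMr// mul1r; lra.
have a0 : 0 < a by rewrite ln_gt0.
have eaE : expR a = (1 + k) / k by rewrite lnK// posrE; lra.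
pose E s := expR (a + (- (2 * a)) * s).
have sE : smooth E by apply: (@smooth_comp _ (@expR R)); [exact: smooth_expR|exact: smooth_affine].
have E0 s : 0 < E s by exact: expR_gt0.
have D0 s : 0 < 1 + E s by rewrite ltr_pwDl// ltW.
have dE s : is_derive s 1 E (E s * - (2 * a)).
  apply: is_derive1_comp; have := smooth_is_derive (@smooth_affine R a (- (2 * a))) s.
  congr is_derive; rewrite derive1E; apply: derive_val.
  have := is_deriveD (is_derive_cst a s 1) (is_deriveM (is_derive_cst (- (2 * a)) s 1) (is_derive_id s 1)).
  by congr is_derive; rewrite /GRing.scale /=; ring.
pose S s := (1 + 2 * k) * (1 + E s)^-1 + - k.
have sS : smooth S.
  apply: smoothD; last exact: smooth_cst.
  apply: smoothM; first exact: smooth_cst.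
  apply: smoothV; last by move=> s; rewrite gt_eqF.
  by apply: smoothD; [exact: smooth_cst|exact: sE].
exists S; split=> //.
- rewrite /S /E mulr0 addr0 eaE; have : 1 + (1 + k) / k != 0 by rewrite gt_eqF// ltr_pwDl// ltW; lra.
  have kn : k != 0 by rewrite gt_eqF.
  have : 1 + 2 * k != 0 by rewrite gt_eqF//; lra.
  move=> ? ?; field; rewrite kn /= (_ : k + (1 + k) = 1 + 2 * k)//; ring.
- rewrite /S /E mulr1 (_ : a + - (2 * a) = - a); last by ring.
  rewrite expRN eaE.
  have kn : k != 0 by rewrite gt_eqF.
  have k1n : 1 + k != 0 by rewrite gt_eqF//; lra.
  have k2n : 1 + 2 * k != 0 by rewrite gt_eqF//; lra.
  field; rewrite kn k1n /= (_ : 1 + k + k = 1 + 2 * k)//; ring.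
- move=> s.
  have dS : is_derive s 1 S ((1 + 2 * k) * (- (1 + E s) ^- 2 * (E s * - (2 * a)))).
    have d1 := is_deriveD (is_derive_cst (1 : R) s 1) (dE s).
    have n0 : (cst 1 + E) s != 0 by rewrite /= gt_eqF// D0.
    have := is_deriveD (is_deriveM (is_derive_cst (1 + 2 * k) s 1) (is_deriveV n0 d1)) (is_derive_cst (- k) s 1).
    by congr is_derive; rewrite /GRing.scale /= !fctE; ring.
  rewrite derive1E (@derive_val _ _ _ _ _ _ _ dS).
  rewrite (_ : _ * _ = (1 + 2 * k) * (2 * a) * E s * (1 + E s) ^- 2); last by ring.
  rewrite mulr_gt0 ?invr_gt0 ?exprn_gt0// !mulr_gt0//; lra.
- move=> s; rewrite /S; apply/andP; split.
    by rewrite ltrDr mulr_gt0 ?invr_gt0//; lra.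
  rewrite ltrBlDr (_ : 1 + k + k = 1 + 2 * k); last by ring.
  rewrite -[ltRHS]mulr1 ltr_pM2l; last lra.
  by rewrite invf_lt1// ltrDl.
Qed.

End Isolation.

(** * Existence of strand charts *)

Lemma continuous_apart (R : realType) (T T' : pseudoMetricType R) (f : T -> R) (g : T' -> R) p p' :
  {for p, continuous f} -> {for p', continuous g} -> f p - g p' != 0 ->
  exists2 r, 0 < r & forall q q', ball p r q -> ball p' r q' -> f q <> g q'.
Proof.
move=> cf cg n0.
have cG : {for (p, p'), continuous (fun z : T * T' => f z.1 - g z.2)}.
  apply: cvgB.
    exact: (@cvg_comp _ _ _ fst f _ _ _ (@cvg_fst _ _ _ _ _) cf).
  exact: (@cvg_comp _ _ _ snd g _ _ _ (@cvg_snd _ _ _ _ _) cg).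
have nG : \forall z \near (p, p'), f z.1 - g z.2 != 0 by exact: (cvgr_neq0 _ cG n0).
have [[A B] /= [nA nB] AB] := nG.
have [r1 /= r10 rA] := (@nbhs_ballP R T p A).1 nA.
have [r2 /= r20 rB] := (@nbhs_ballP R T' p' B).1 nB.
have m1 : Num.min r1 r2 <= r1 by rewrite ge_min lexx.
have m2 : Num.min r1 r2 <= r2 by rewrite ge_min lexx orbT.
exists (Num.min r1 r2); first by rewrite lt_min r10 r20.
move=> q q' b b' E; have := AB (q, q') (conj (rA _ (le_ball m1 b)) (rB _ (le_ball m2 b'))).
by rewrite /= E subrr eqxx.
Qed.

(** Shrinking the second coordinate turns a thin strip into the box of a chart. *)
Section Rescale.
Variables (R : realType) (e : R).
Implicit Types l : seq ((R -> R) * (R -> R)).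

Definition rescale l := [seq (uv.1, fun h => uv.2 (e * h)) | uv : (R -> R) * (R -> R) <- l].

Lemma sep_rescale l s h : sep (rescale l) s h = sep l s (e * h).
Proof. by elim: l => //= uv l ->. Qed.

Lemma smooth_sep_rescale l : smooth_sep l -> smooth_sep (rescale l).
Proof.
elim: l => [//|uv l IH /= [su sv sl]]; split; [exact: su| |exact: IH].
apply: (@smooth_comp _ uv.2); first exact: sv.
by rewrite (_ : *%R e = fun h => 0 + e * h); [exact: smooth_affine|apply/funext => h; rewrite add0r].
Qed.

Lemma sep_ds_rescale l s h : sep (sep_ds (rescale l)) s h = sep (sep_ds l) s (e * h).
Proof. by elim: l => //= uv l ->. Qed.

Lemma sep_dh_rescale l s h : smooth_sep l ->
  sep (sep_dh (rescale l)) s h = e * sep (sep_dh l) s (e * h).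
Proof.
elim: l => [|uv l IH] /=; first by rewrite mulr0.
move=> [su sv sl]; rewrite IH// mulrDr; congr (_ + _).
have de : is_derive h 1 (fun x => e * x) e.
  have := is_deriveM (is_derive_cst e h 1) (is_derive_id h 1).
  by congr is_derive; rewrite /GRing.scale /=; ring.
have H := @is_derive1_comp _ uv.2 _ h _ _ (smooth_is_derive sv _) de.
by rewrite derive1E (@derive_val _ _ _ _ _ _ _ H); ring.
Qed.

End Rescale.

(** The segment from [c] to [m] and the strands through [c'] and [m'], with a margin [d]
    in which there are no other crossings. *)
Section ChartExists.
Variables (R : realType) (D : diagram R).
Hypothesis D_smooth : forall t, smooth_at D t.
Variables (c m c' m' d : R).
Implicit Types (s y t u : R).

Hypotheses (cc' : crossing_pair D c c') (mm' : crossing_pair D m m').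
Hypothesis Dcm : D c <> D m.
Hypothesis d_gt0 : 0 < d.
Variables lo hi : R.
Hypotheses (loE : lo = Num.min c m) (hiE : hi = Num.max c m).
Hypothesis d_short : hi - lo + 4 * d < 1.
Hypothesis d_axis : forall t, lo - 2 * d < t < hi + 2 * d -> at_crossing D t -> t = c \/ t = m.
Hypothesis d_left : forall t, `|t - c'| < 2 * d -> at_crossing D t -> t = c'.

Local Notation per := (curve_periodic D).

Let sizes : hi - lo + 4 * d < 1 /\ 0 < d. Proof. by []. Qed.

Ltac slra := have [? ?] := sizes; lra.

Let gx t := (D t).1.
Let gy t := (D t).2.

Let sgx : smooth gx. Proof. by have [H _ _] := smooth_coordinates D_smooth; exact: H. Qed.
Let sgy : smooth gy. Proof. by have [_ H _] := smooth_coordinates D_smooth; exact: H. Qed.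
Let vel0 t : velocity gx gy t <> (0, 0). Proof. by have [_ _] := smooth_coordinates D_smooth. Qed.

Let cm : c != m. Proof. by apply/eqP => E; apply: Dcm; rewrite E. Qed.

Let crossing_sym t t' : crossing_pair D t t' -> crossing_pair D t' t.
Proof. by case=> n E; split=> // /same_point_sym. Qed.

Let cr_c' : at_crossing D c'. Proof. by exists c. Qed.
Let cr_m' : at_crossing D m'. Proof. by exists m. Qed.

Lemma same_curve t t' : same_point t t' -> D t = D t'.
Proof. exact/periodic_same/per. Qed.

Let on_A t := lo - d < t < hi + d.

Lemma axis_injective t t' : on_A t -> on_A t' -> D t = D t' -> t = t'.
Proof.
move=> /andP[t1 t2] /andP[t1' t2'] E; have [H|H] := pselect (same_point t t').
  apply: same_point_lt1 H _; rewrite ltr_norml; apply/andP; split; slra.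
have wide u : lo - d < u -> u < hi + d -> lo - 2 * d < u < hi + 2 * d.
  by move=> *; apply/andP; split; slra.
have crt : at_crossing D t by exists t'; split=> // /same_point_sym.
have crt' : at_crossing D t' by exists t; split.
have [tE|tE] := d_axis (wide _ t1 t2) crt; have [tE'|tE'] := d_axis (wide _ t1' t2') crt';
  rewrite ?tE ?tE' // in E *; by case: Dcm.
Qed.

Lemma axis_strand b t u : (b = c' \/ b = m') -> on_A t -> `|u - b| < d -> ~ same_point t u.
Proof.
move=> bE /andP[t1 t2] ub tu.
have crb : at_crossing D b by case: bE => ->.
have sb : same_point (t - (u - b)) b.
  by have := same_pointD (b - u) tu; rewrite [u + _]addrC subrK opprB.
have := at_crossing_same (same_point_sym sb) crb.
move: ub; rewrite ltr_norml => /andP[? ?].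
have wide : lo - 2 * d < t - (u - b) < hi + 2 * d by apply/andP; split; slra.
have /same_point_sym cb := sb.
move=> /(d_axis wide)[E|E]; rewrite E in cb; case: bE => bE; rewrite bE in cb.
- by case: cc' => n _; apply: n; exact: same_point_sym.
- by apply: Dcm; rewrite -(same_curve cb); have [_ ->] := mm'.
- by apply: Dcm; have [_ ->] := cc'; exact: same_curve.
- by case: mm' => n _; apply: n; exact: same_point_sym.
Qed.

Lemma strand_strand t u : `|t - c'| < d -> `|u - m'| < d -> ~ same_point t u.
Proof.
move=> tc um tu.
have sb : same_point (t - (u - m')) m'.
  by have := same_pointD (m' - u) tu; rewrite [u + _]addrC subrK opprB.
have := at_crossing_same (same_point_sym sb) cr_m'.
move=> /d_left E; have {}E : t - (u - m') = c'.
  apply: E; move: tc um; rewrite !ltr_norml => /andP[? ?] /andP[? ?].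
  by apply/andP; split; slra.
rewrite E in sb; apply: Dcm.
by have [_ ->] := cc'; have [_ ->] := mm'; exact: same_curve.
Qed.

(** The axis is run through by a smooth path whose end parts are squeezed into
    the small gaps before and after the two crossings. *)

Variable S : R -> R.
Hypotheses (sS : smooth S) (S0 : S 0 = 0) (S1 : S 1 = 1) (dS : forall s, 0 < derive1 S s)
  (S_range : forall s, - (d / `|m - c|) < S s < 1 + d / `|m - c|).

Let th s := c + (m - c) * S s.

Let sth : smooth th.
Proof.
apply: smoothD; first exact: smooth_cst.
by apply: smoothM; [exact: smooth_cst|exact: sS].
Qed.

Lemma th_range s : on_A (th s).
Proof.
have /andP[s1 s2] := S_range s.
have mc : 0 < `|m - c| by rewrite normr_gt0 subr_eq0 eq_sym.
have E1 : - d < `|m - c| * S s.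
  by rewrite -ltr_pdivrMl// mulrN mulrC.
have E2 : `|m - c| * S s < `|m - c| + d.
  rewrite -[X in X + d]mulr1 -ltrBlDl -mulrBr -ltr_pdivlMl// mulrC; slra.
rewrite /on_A loE hiE /th; have [h|h] := leP c m.
  by rewrite ger0_norm ?subr_ge0// in E1 E2; apply/andP; split; slra.
by rewrite ltr0_norm ?subr_lt0// in E1 E2; apply/andP; split; slra.
Qed.

Let dth s : derive1 th s = (m - c) * derive1 S s.
Proof.
have H := is_deriveD (is_derive_cst c s 1) (is_deriveM (is_derive_cst (m - c) s 1) (smooth_is_derive sS s)).
rewrite derive1E (_ : th = cst c + cst (m - c) * S)// (@derive_val _ _ _ _ _ _ _ H).
by rewrite /GRing.scale /=; ring.
Qed.

Let S_incr := increasing_of_derive sS dS.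

Lemma th_mono : (forall s s', s < s' -> th s < th s') \/ (forall s s', s < s' -> th s' < th s).
Proof.
have [h|h|E] := ltgtP c m; last by move: cm; rewrite E eqxx.
  by left=> s s' /S_incr H; rewrite /th ltrD2l ltr_pM2l// subr_gt0.
by right=> s s' /S_incr H; rewrite /th ltrD2l ltr_nM2l// subr_lt0.
Qed.

Lemma th_inj s s' : th s = th s' -> s = s'.
Proof.
move=> E; have [h|h|//] := ltgtP s s'.
  by case: th_mono => /(_ _ _ h); rewrite E ltxx.
by case: th_mono => /(_ _ _ h); rewrite E ltxx.
Qed.

Lemma th_near s0 : \forall t \near th s0, exists2 s, `|s - s0| <= 1 & t = th s.
Proof.
have cth : {within `[s0 - 1, s0 + 1], continuous th}.
  by apply: continuous_subspaceT; exact: smooth_continuous.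
have le1 : s0 - 1 <= s0 + 1 by lra.
have iv t : Num.min (th (s0 - 1)) (th (s0 + 1)) <= t <= Num.max (th (s0 - 1)) (th (s0 + 1)) ->
    exists2 s, `|s - s0| <= 1 & t = th s.
  move=> /(IVT le1 cth)[s]; rewrite in_itv /= => /andP[? ?] <-.
  by exists s => //; rewrite ler_norml; apply/andP; split; lra.
have h1 : s0 - 1 < s0 by lra.
have h2 : s0 < s0 + 1 by lra.
have lh : Num.min (th (s0 - 1)) (th (s0 + 1)) < th s0 < Num.max (th (s0 - 1)) (th (s0 + 1)).
  by rewrite gt_min lt_max; case: th_mono => mo; rewrite (mo _ _ h1) (mo _ _ h2) ?orbT.
case/andP: lh => l1 l2.
near=> t; apply: iv; apply/andP; split; apply/ltW; near: t; [exact: lt_nbhsr|exact: lt_nbhsl].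
Unshelve. all: by end_near. Qed.

(** The directions of the strands, oriented so that both climb on the same side of the axis. *)
Let cross t t' := derive1 gx t * derive1 gy t' - derive1 gy t * derive1 gx t'.

Let cross_c : cross c c' != 0.
Proof. by have [_ _ tr] := curve_generic D; have [_ _ /eqP] := tr _ _ cc'. Qed.
Let cross_m : cross m m' != 0.
Proof. by have [_ _ tr] := curve_generic D; have [_ _ /eqP] := tr _ _ mm'. Qed.

Let ec := Num.sg (cross c c').
Let em := Num.sg (cross m m').

Variable r : R.
Hypotheses (r_gt0 : 0 < r) (r_half : r <= 2^-1).
Hypothesis r_left : forall s, `|s| < r -> 0 < Num.sg (cross c c') * cross (th s) c'.
Hypothesis r_right : forall s, `|1 - s| < r -> 0 < Num.sg (cross m m') * cross (th s) m'.

Let b s := step (1 - (s / r) ^+ 2).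

Let sb : smooth b.
Proof.
apply: (@smooth_comp _ (@step R)); first exact: smooth_step.
apply: smoothB; first exact: smooth_cst.
rewrite (_ : (fun x => _) = (fun x => (0 + r^-1 * x) * (0 + r^-1 * x))).
  by apply: smoothM; exact: smooth_affine.
by apply/funext => x; rewrite expr2 !add0r [r^-1 * x]mulrC.
Qed.

Let b0 : b 0 = 1.
Proof. by rewrite /b mul0r expr0n subr0 step_ge1. Qed.

Let b_far s : r <= `|s| -> b s = 0.
Proof.
move=> rs; have h : 1 <= `|s / r|.
  by rewrite normrM normfV (gtr0_norm r_gt0) ler_pdivlMr// mul1r.
by rewrite /b step_le0// subr_le0 -real_normK ?num_real// exprn_ege1.
Qed.

Let b1 : b 1 = 0.
Proof. by apply: b_far; rewrite normr1; have := r_half; lra. Qed.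

Let b_bound s : 0 <= b s <= 1. Proof. exact: step_bound. Qed.

Let b1s s := b (1 - s).

Let sb1 : smooth b1s.
Proof.
apply: (@smooth_comp _ b); first exact: sb.
by apply: smoothB; [exact: smooth_cst|exact: smooth_id].
Qed.

Let b_sum s : b s = 0 \/ b1s s = 0.
Proof.
have [h|h] := leP r `|s|; first by left; exact: b_far.
right; apply: b_far; have := r_half; have : 1 - s <= `|1 - s| by exact: ler_norm.
have : s <= `|s| by exact: ler_norm.
by move: h => *; lra.
Qed.

Let strand (g : R -> R) (p e : R) y := g (p + e * y) + - g p.

Let s_strand g p e : smooth g -> smooth (strand g p e).
Proof.
move=> sg; apply: smoothD; last exact: smooth_cst.
by apply: (@smooth_comp _ g); [exact: sg|exact: smooth_affine].
Qed.

(** On the axis the sum is the curve itself. Near s = 0 and s = 1 the translates of the two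
    strands are added, which makes them vertical lines; in between a normal direction [n]
    takes over, so that the map is a local diffeomorphism along the whole axis. *)
Let layers (g n : R -> R) : seq ((R -> R) * (R -> R)) :=
  [:: (fun s => g (th s), fun=> 1); (b, strand g c' ec); (b1s, strand g m' em);
      (fun s => (1 + - (b s + b1s s)) * n (th s), fun y => y)].

Let lx := layers gx (fun t => - derive1 gy t).
Let ly := layers gy (derive1 gx).

Let s_layers g n : smooth g -> smooth n -> smooth_sep (layers g n).
Proof.
move=> sg sn /=; split; [exact: smooth_comp|exact: smooth_cst|].
split; [exact: sb|exact: s_strand|].
split; [exact: sb1|exact: s_strand|].
split; [|exact: smooth_id|by []].
apply: smoothM; last exact: smooth_comp.
apply: smoothD; first exact: smooth_cst.
by apply: smoothN; exact: smoothD.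
Qed.

Let slx : smooth_sep lx.
Proof. by apply: s_layers; [exact: sgx|apply/smoothN/smooth_derive1; exact: sgy]. Qed.
Let sly : smooth_sep ly.
Proof. by apply: s_layers; [exact: sgy|apply: smooth_derive1; exact: sgx]. Qed.

Let layers_axis g n s : sep (layers g n) s 0 = g (th s).
Proof. by rewrite /= /strand !mulr0 !addr0 !subrr !mulr0 !addr0 mulr1. Qed.

Let layers_left g n y : g c = g c' -> sep (layers g n) 0 y = g (c' + ec * y).
Proof.
move=> E; rewrite /= /b1s b0 subr0 b1 /strand /th S0 mulr0 !addr0 subrr !mul0r E; ring.
Qed.

Let layers_right g n y : g m = g m' -> sep (layers g n) 1 y = g (m' + em * y).
Proof.
move=> E; have thm : th 1 = m by rewrite /th S1 mulr1 addrC subrK.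
by rewrite /= /b1s b1 subrr b0 /strand thm E; ring.
Qed.

Let F := chart_map lx ly.

Let F_axis s : F s 0 = D (th s).
Proof. by rewrite /F /chart_map !layers_axis /gx /gy; case: (D _). Qed.

Let F_left y : F 0 y = D (c' + ec * y).
Proof.
have [_ E] := cc'; rewrite /F /chart_map !layers_left /gx /gy ?E//; by case: (D _).
Qed.

Let F_right y : F 1 y = D (m' + em * y).
Proof.
have [_ E] := mm'; rewrite /F /chart_map !layers_right /gx /gy ?E//; by case: (D _).
Qed.

(** On the axis the Jacobian is the derivative of [th] times a convex combination of two
    positive numbers: the determinant of the directions of the curve and of a strand, and
    the squared length of the velocity. *)
Let F_jac s : chart_jacobian lx ly s 0 != 0.
Proof.
have d_strand g p e y : smooth g -> derive1 (strand g p e) y = e * derive1 g (p + e * y).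
  move=> sg.
  have da : is_derive y 1 (fun y => p + e * y) e.
    have := is_deriveD (is_derive_cst p y 1) (is_deriveM (is_derive_cst e y 1) (is_derive_id y 1)).
    by congr is_derive; rewrite /GRing.scale /=; ring.
  have H := is_deriveD (@is_derive1_comp _ g _ y _ _ (smooth_is_derive sg _) da) (is_derive_cst (- g p) y 1).
  by rewrite derive1E (@derive_val _ _ _ _ _ _ _ H) addr0 mulrC.
have d_th g : smooth g -> derive1 (fun s => g (th s)) s = derive1 g (th s) * derive1 th s.
  move=> sg; have H := @is_derive1_comp _ g th s _ _ (smooth_is_derive sg _) (smooth_is_derive sth s).
  by rewrite derive1E (@derive_val _ _ _ _ _ _ _ H).
have d_cst : derive1 (fun=> 1 : R) (0 : R) = 0 by rewrite derive1E derive_cst.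
have d_id : derive1 (fun y => y : R) (0 : R) = 1 by rewrite derive1E derive_id.
have Ds g n : smooth g -> sep (sep_ds (layers g n)) s 0 = derive1 g (th s) * derive1 th s.
  by move=> sg; rewrite /= d_th// /strand !mulr0 !addr0 !subrr !mulr0 !addr0 mulr1.
have Dh g n : smooth g -> sep (sep_dh (layers g n)) s 0 =
    b s * (ec * derive1 g c') + b1s s * (em * derive1 g m') + (1 + - (b s + b1s s)) * n (th s).
  by move=> sg; rewrite /= !d_strand// d_cst d_id !mulr0 !addr0; ring.
rewrite /chart_jacobian /lx /ly !Ds// !Dh//.
pose w := derive1 gx (th s) ^+ 2 + derive1 gy (th s) ^+ 2.
have w0 : 0 < w.
  rewrite lt_neqAle addr_ge0 ?sqr_ge0// andbT; apply/eqP => /esym/eqP.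
  rewrite paddr_eq0 ?sqr_ge0// !sqrf_eq0 => /andP[/eqP E1 /eqP E2].
  by apply: (@vel0 (th s)); rewrite /velocity E1 E2.
rewrite (_ : _ - _ = derive1 th s * (b s * (ec * cross (th s) c') +
  b1s s * (em * cross (th s) m') + (1 + - (b s + b1s s)) * w)); last first.
  by rewrite /cross /w; ring.
rewrite mulf_neq0//.
  rewrite dth mulf_neq0//; first by rewrite subr_eq0 eq_sym.
  by rewrite gt_eqF// dS.
rewrite gt_eqF//.
have /andP[bs0 bs1] := b_bound s; have /andP[bs0' bs1'] := b_bound (1 - s).
have [h|h] := b_sum s; rewrite h mul0r ?add0r ?addr0.
  have [E|E] := eqVneq (b1s s) 0; first by rewrite E mul0r add0r oppr0 addr0 mul1r.
  apply: ltr_pwDl; last by rewrite mulr_ge0 ?(ltW w0)// subr_ge0.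
  rewrite mulr_gt0//; first by rewrite lt_neqAle eq_sym E.
  by apply: r_right; rewrite ltNge; apply: contra E => /b_far/eqP.
have [E|E] := eqVneq (b s) 0; first by rewrite E mul0r add0r oppr0 addr0 mul1r.
apply: ltr_pwDl; last by rewrite mulr_ge0 ?(ltW w0)// subr_ge0.
rewrite mulr_gt0//; first by rewrite lt_neqAle eq_sym E.
by apply: r_left; rewrite ltNge; apply: contra E => /b_far/eqP.
Qed.

(** Two distinct points of the axis have distinct images, by the absence of crossings
    between them, and near a single point local injectivity applies. *)
Lemma strip_injective : exists2 e, 0 < e & forall s y s' y', -3 <= s <= 5 -> -3 <= s' <= 5 ->
  `|y| <= e -> `|y'| <= e -> F s y = F s' y' -> s = s' /\ y = y'.
Proof.
pose I := `[(-3 : R), 5]%classic.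
have cI : compact (I `*` I) by apply: compact_setX; exact: segment_compact.
have [|e e0 eP] := @thin_cover R _ _ (fun e (q : R * R) => forall y y', `|y| <= e -> `|y'| <= e ->
    F q.1 y = F q.2 y' -> q.1 = q.2 /\ y = y') cI; last first.
  exists e => // s y s' y' sI s'I; apply: (eP e (s, s')); first by rewrite e0 lexx.
  by split; rewrite /I /= in_itv.
move=> [s0 s0'] _; have [<-|ss] := eqVneq s0 s0'.
  have [r0 r00 rP] := chart_locally_injective slx sly (F_jac s0).
  exists r0 => //; apply: (@near_box _ _ _ _ r0) => // s s' hs hs' e /andP[_ er] y y' ye ye'.
  by apply: rP => //; rewrite subr0; apply: le_lt_trans er.
have FF : F s0 0 <> F s0' 0.
  rewrite !F_axis => /axis_injective E; move: ss; rewrite (th_inj (E _ _)) ?eqxx//; exact: th_range.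
have key l : smooth_sep l -> sep l s0 0 != sep l s0' 0 -> exists2 r, 0 < r &
    forall s s' y y', `|s - s0| < r -> `|s' - s0'| < r -> `|y| < r -> `|y'| < r -> sep l s y <> sep l s' y'.
  move=> sl; rewrite -subr_eq0 => ne.
  have [r0 r00 rP] := continuous_apart (@continuous_sep R l sl (s0, 0)) (@continuous_sep R l sl (s0', 0)) ne.
  exists r0 => // s s' y y' hs hs' hy hy'.
  by apply: (rP (s, y) (s', y')); split; rewrite /ball/= distrC ?subr0.
have [r0 r00 rP] : exists2 r, 0 < r & forall s s' y y', `|s - s0| < r -> `|s' - s0'| < r ->
    `|y| < r -> `|y'| < r -> F s y <> F s' y'.
  have [E|ne] := eqVneq (sep lx s0 0) (sep lx s0' 0).
    have [E'|ne] := eqVneq (sep ly s0 0) (sep ly s0' 0).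
      by case: FF; rewrite /F /chart_map E E'.
    have [r0 r00 rP] := key _ sly ne; exists r0 => // s s' y y' h1 h2 h3 h4 [_].
    exact: rP.
  have [r0 r00 rP] := key _ slx ne; exists r0 => // s s' y y' h1 h2 h3 h4 [+ _].
  exact: rP.
exists r0 => //; apply: (@near_box _ _ _ _ r0) => // s s' hs hs' e /andP[_ er] y y' ye ye' E.
by case: (rP s s' y y') => //; exact: le_lt_trans er.
Qed.

Lemma strip_jacobian : exists2 e, 0 < e & forall s y, -3 <= s <= 5 -> `|y| <= e ->
  chart_jacobian lx ly s y != 0.
Proof.
have [|e e0 eP] := @thin_cover R _ _ (fun e s => forall y, `|y| <= e -> chart_jacobian lx ly s y != 0)
    (@segment_compact R (-3) 5); last first.
  exists e => // s y sI; apply: (eP e s); first by rewrite e0 lexx.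
  by rewrite /= in_itv.
move=> s0 _.
have cj : {for (s0, 0), continuous (fun q : R * R => chart_jacobian lx ly q.1 q.2)}.
  have cs l (sl : smooth_sep l) := @continuous_sep R l sl (s0, 0).
  apply: cvgB; apply: cvgM; apply: cs; first [exact: smooth_sep_ds|exact: smooth_sep_dh].
have [r0 r00 rP] := box_near (cvgr_neq0 _ cj (F_jac s0)).
exists r0 => //; apply/nbhs_ballP; exists r0 => //= s sr e /andP[_ er] y ye.
apply: (rP s y); first by rewrite distrC.
by rewrite subr0; exact: le_lt_trans er.
Qed.

(** A parameter whose image lies on the axis is on the axis itself or, by the absence of
    triple points, on one of the two strands; the others stay away by continuity. *)
Lemma strip_only eta : 0 < eta -> exists2 e, 0 < e & forall t s y, -2 <= s <= 4 -> `|y| <= e ->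
  D t = F s y ->
  [\/ exists2 s', -3 <= s' <= 5 & same_point t (th s'),
      exists2 y', `|y'| <= eta & same_point t (c' + ec * y') |
      exists2 y', `|y'| <= eta & same_point t (m' + em * y')].
Proof.
move=> eta0.
pose Q t := [\/ exists2 s', -3 <= s' <= 5 & same_point t (th s'),
      exists2 y', `|y'| <= eta & same_point t (c' + ec * y') |
      exists2 y', `|y'| <= eta & same_point t (m' + em * y')].
have cI : compact (`[(0 : R), 1]%classic `*` `[(-2 : R), 4]%classic).
  by apply: compact_setX; exact: segment_compact.
have [|e e0 eP] := @thin_cover R _ _ (fun e (q : R * R) => forall y, `|y| <= e ->
    D q.1 = F q.2 y -> Q q.1) cI; last first.
  exists e => // t s y sI ye E.
  have tf : same_point t (fracpart t).
    by apply/same_pointP; exists (Num.floor t); rewrite /fracpart subrK.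
  have QE : Q (fracpart t) -> Q t.
    by case=> -[z ? ?]; [apply: Or31|apply: Or32|apply: Or33]; exists z => //; exact: same_point_trans tf _.
  apply: QE; apply: (eP e (fracpart t, s) _ _ y) => //=; first by rewrite e0 lexx.
    split; rewrite /= in_itv//= /fracpart.
    by have /andP[] := floor_itv t; rewrite intrD => *; apply/andP; split; lra.
  by rewrite -(same_curve tf).
move=> [t0 s0] [_ /=]; rewrite in_itv /= => s0I.
have [E|ne] := pselect (D t0 = D (th s0)); last first.
  have cx : {for t0, continuous gx} by apply: smooth_continuous; exact: sgx.
  have cy : {for t0, continuous gy} by apply: smooth_continuous; exact: sgy.
  have key g l : {for t0, continuous g} -> smooth_sep l -> g t0 != sep l s0 0 -> exists2 r, 0 < r &
      forall t s y, `|t - t0| < r -> `|s - s0| < r -> `|y| < r -> g t <> sep l s y.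
    move=> cg sl; rewrite -subr_eq0 => n0.
    have [r0 r00 rP] := @continuous_apart _ _ _ _ _ t0 (s0, 0) cg (@continuous_sep R l sl (s0, 0)) n0.
    exists r0 => // t s y ht hs hy; apply: (rP t (s, y)); first by rewrite /ball/= distrC.
    by split; rewrite /ball/= distrC ?subr0.
  have [r0 r00 rP] : exists2 r, 0 < r & forall t s y, `|t - t0| < r -> `|s - s0| < r -> `|y| < r -> D t <> F s y.
    have [E|n0] := eqVneq (gx t0) (sep lx s0 0).
      have [E'|n0] := eqVneq (gy t0) (sep ly s0 0).
        case: ne; have := F_axis s0; rewrite /F /chart_map -E -E' /gx /gy => <-.
        by case: (D t0).
      have [r0 r00 rP] := key _ _ cy sly n0; exists r0 => // t s y h1 h2 h3 E'.
      by apply: (rP t s y h1 h2 h3); rewrite /gy E'.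
    have [r0 r00 rP] := key _ _ cx slx n0; exists r0 => // t s y h1 h2 h3 E'.
    by apply: (rP t s y h1 h2 h3); rewrite /gx E'.
  exists r0 => //; apply: (@near_box _ _ _ _ r0) => // t s ht hs e /andP[_ er] y ye /= E.
  by case: (rP t s y ht hs (le_lt_trans ye er)).
suff [r0 r00 rP] : exists2 r, 0 < r & forall t, `|t - t0| < r -> Q t.
  by exists r0 => //; apply: (@near_box _ _ _ _ r0) => // t s ht hs e _ y _ /= _; exact: rP.
have near_strand p e : e * e = 1 -> same_point t0 p -> exists2 r, 0 < r & forall t, `|t - t0| < r ->
    exists2 y', `|y'| <= eta & same_point t (p + e * y').
  move=> ee tb; exists eta => // t tt; exists (e * (t - t0)).
    have e1 : `|e| = 1.
      apply/eqP; rewrite -(@eqrXn2 _ 2)// expr1n real_normK ?num_real//; exact/eqP.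
    by rewrite normrM e1 mul1r ltW.
  rewrite mulrA ee mul1r; have := same_pointD (t - t0) tb.
  by rewrite [t0 + _]addrC subrK.
have sgsq (x : R) : x != 0 -> Num.sg x * Num.sg x = 1 by move=> x0; rewrite -expr2 sqr_sg x0.
have [tt|nt] := pselect (same_point t0 (th s0)).
  have /nbhs_ballP[r0 /= r00 rP] := th_near s0; exists r0 => // t tr; apply: Or31.
  have [|s' s's E'] := rP (t - t0 + th s0).
    by rewrite /ball/= opprD addrCA subrr addr0 normrN.
  exists s'; first by move: s's; rewrite ler_norml => /andP[? ?]; apply/andP; split; lra.
  rewrite -E'; have := same_pointD (t - t0) tt.
  by rewrite [t0 + _]addrC subrK [th s0 + _]addrC.
have cr : at_crossing D (th s0) by exists t0.
have thin : lo - 2 * d < th s0 < hi + 2 * d.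
  by have /andP[? ?] := th_range s0; apply/andP; split; slra.
have [triple _ _] := curve_generic D.
have [cE|mE] := d_axis thin cr.
  rewrite cE in E nt; have [nc Ec] := cc'.
  have [H|H|H] := triple _ _ _ E Ec; [by []|by []|].
  have [r0 r00 rP] := near_strand c' ec (sgsq _ cross_c) H.
  by exists r0 => // t /rP; apply: Or32.
rewrite mE in E nt; have [nm Em] := mm'.
have [H|H|H] := triple _ _ _ E Em; [by []|by []|].
have [r0 r00 rP] := near_strand m' em (sgsq _ cross_m) H.
by exists r0 => // t /rP; apply: Or33.
Qed.

Let sq_ec : ec * ec = 1. Proof. by rewrite -expr2 sqr_sg cross_c. Qed.
Let sq_em : em * em = 1. Proof. by rewrite -expr2 sqr_sg cross_m. Qed.

Let unit_norm (e : R) : e * e = 1 -> `|e| = 1.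
Proof.
move=> ee; apply/eqP; rewrite -(@eqrXn2 _ 2)// expr1n real_normK ?num_real//; exact/eqP.
Qed.

(** A strip on which all three uniform statements hold, rescaled to the box. *)
Lemma chart_exists_at : exists K : strand_chart D,
  [/\ axis K 0 = c, axis K 1 = m, lbase K = c' & rbase K = m'] /\
  [/\ forall s, lo - d < axis K s < hi + d, 12 * `|lscale K| < d & 12 * `|rscale K| < d].
Proof.
have [e1 e10 injP] := strip_injective; have [e2 e20 jacP] := strip_jacobian.
have [e3 e30 onlyP] := strip_only e10.
(* Heights up to 12 have to fit in the strip and [12 * e] in [d]; scales are below 1/24. *)
pose e := Num.min (Num.min e1 e2) (Num.min e3 (Num.min d 1)) / 25.
have m0 : 0 < Num.min (Num.min e1 e2) (Num.min e3 (Num.min d 1)).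
  by rewrite !lt_min e10 e20 e30 d_gt0 ltr01.
have e0 : 0 < e by rewrite divr_gt0.
have [le1 le2 le3 led le4] : [/\ 25 * e <= e1, 25 * e <= e2, 25 * e <= e3, 25 * e <= d & 25 * e <= 1].
  rewrite /e mulrCA divff ?mulr1//.
  by split; rewrite !ge_min lexx ?orbT.
have eh h : -12 <= h <= 12 -> `|e * h| <= 12 * e.
  by move=> hI; rewrite normrM gtr0_norm// mulrC ler_pM2r// ler_norml.
have s3 s : -2 <= s <= 4 -> -3 <= s <= 5 by move=> /andP[? ?]; apply/andP; split; lra.
have i0 : -3 <= (0 : R) <= 5 by apply/andP; split; lra.
have i1 : -3 <= (1 : R) <= 5 by apply/andP; split; lra.
have h1 h : -12 <= h <= 12 -> `|e * h| <= e1 by move=> /eh; lra.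
have n0 : `|(0 : R)| <= e1 by rewrite normr0 ltW.
have FE s h : chart_map (rescale e lx) (rescale e ly) s h = F s (e * h).
  by rewrite /F /chart_map !sep_rescale.
have small x : `|x| = 1 -> `|x * e| < 24^-1 by move=> x1; rewrite normrM x1 mul1r gtr0_norm//; lra.
have nz x : `|x| = 1 -> x * e != 0.
  by move=> x1; apply: mulf_neq0; rewrite ?(gt_eqF e0)// -normr_gt0 x1.
have e_c := unit_norm sq_ec; have e_m := unit_norm sq_em.
have near_base p x h : `|x| = 1 -> -12 <= h <= 12 -> `|p + x * e * h - p| < d.
  move=> x1 hI; apply: (@le_lt_trans _ _ (12 * e)); last by slra.
  by rewrite addrAC subrr add0r -mulrA normrM x1 mul1r; exact: eh.
have unscale x y : e1 >= `|y| -> `|y| <= 12 * e -> exists2 h, -12 <= h <= 12 & x * y = x * e * h.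
  move=> _ ye; exists (y / e); last by field; rewrite gt_eqF.
  by rewrite -ler_norml normrM normfV (gtr0_norm e0) ler_pdivrMr.
have only t s h : chart_domain s h -> D t = chart_map (rescale e lx) (rescale e ly) s h ->
    [\/ exists2 s', -2 <= s' <= 4 & same_point t (th s'),
        exists2 h', -12 <= h' <= 12 & same_point t (c' + ec * e * h') |
        exists2 h', -12 <= h' <= 12 & same_point t (m' + em * e * h')].
  move=> [sI hI]; rewrite FE => E.
  have [|[s' s'I H]|[y yI H]|[y yI H]] := onlyP t s (e * h) sI _ E.
  - by have := eh _ hI; lra.
  - apply: Or31; exists s' => //; move: E; rewrite (same_curve H) -F_axis.
    by move=> /(injP _ _ _ _ s'I (s3 _ sI) n0 (h1 _ hI))[-> _].
  - apply: Or32; move: E; rewrite (same_curve H) -F_left.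
    move=> /(injP _ _ _ _ i0 (s3 _ sI) yI (h1 _ hI))[_ yE].
    have [|h' h'I E] := unscale ec y yI; first by rewrite yE; exact: eh.
    by exists h' => //; rewrite -E.
  - apply: Or33; move: E; rewrite (same_curve H) -F_right.
    move=> /(injP _ _ _ _ i1 (s3 _ sI) yI (h1 _ hI))[_ yE].
    have [|h' h'I E] := unscale em y yI; first by rewrite yE; exact: eh.
    by exists h' => //; rewrite -E.
have short : `|th 4 - th (-2)| < 1.
  have /andP[? ?] := th_range 4; have /andP[? ?] := th_range (-2).
  by rewrite ltr_norml; apply/andP; split; slra.
have ax s : chart_map (rescale e lx) (rescale e ly) s 0 = D (th s) by rewrite FE mulr0 F_axis.
have lf h : chart_map (rescale e lx) (rescale e ly) 0 h = D (c' + ec * e * h).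
  by rewrite FE F_left mulrA.
have rg h : chart_map (rescale e lx) (rescale e ly) 1 h = D (m' + em * e * h).
  by rewrite FE F_right mulrA.
have inj s h s' h' : chart_domain s h -> chart_domain s' h' ->
    chart_map (rescale e lx) (rescale e ly) s h = chart_map (rescale e lx) (rescale e ly) s' h' ->
    s = s' /\ h = h'.
  move=> [sI hI] [s'I h'I]; rewrite !FE => /(injP _ _ _ _ (s3 _ sI) (s3 _ s'I) (h1 _ hI) (h1 _ h'I))[-> E].
  by split=> //; apply: (mulfI _ E); rewrite gt_eqF.
have jac s h : chart_domain s h -> chart_jacobian (rescale e lx) (rescale e ly) s h != 0.
  move=> [sI hI]; have h2 : `|e * h| <= e2 by have := eh _ hI; lra.
  have := jacP _ _ (s3 _ sI) h2; apply: contra => /eqP.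
  rewrite /chart_jacobian !sep_ds_rescale !sep_dh_rescale//.
  rewrite mulrCA [X in _ - X]mulrCA -mulrBr => /eqP; rewrite mulf_eq0 => /orP[/eqP E|//].
  by rewrite E ltxx in e0.
have al s h : chart_domain s h -> ~ same_point (th s) (c' + ec * e * h).
  by move=> [_ hI]; apply: (@axis_strand c'); [left|exact: th_range|exact: near_base].
have ar s h : chart_domain s h -> ~ same_point (th s) (m' + em * e * h).
  by move=> [_ hI]; apply: (@axis_strand m'); [right|exact: th_range|exact: near_base].
have lr h h' : -12 <= h <= 12 -> -12 <= h' <= 12 -> ~ same_point (c' + ec * e * h) (m' + em * e * h').
  by move=> hI h'I; apply: strand_strand; exact: near_base.
exists (StrandChart (smooth_sep_rescale e slx) (smooth_sep_rescale e sly) sth th_mono short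
  (nz _ e_c) (small _ e_c) (nz _ e_m) (small _ e_m) ax lf rg inj jac only al ar lr); split; split=> //=.
- by rewrite /th S0 mulr0 addr0.
- by rewrite /th S1 mulr1 addrC subrK.
- exact: th_range.
- by rewrite normrM e_c mul1r gtr0_norm//; lra.
- by rewrite normrM e_m mul1r gtr0_norm//; lra.
Qed.

End ChartExists.

Section ChartExistence.
Variables (R : realType) (D : diagram R).
Hypothesis D_smooth : forall t, smooth_at D t.
Implicit Types (s t c m eps : R).

Lemma curve_generic_ne c m c' : D c <> D m -> crossing_pair D c c' -> ~ same_point c' m.
Proof. by move=> cm [_ E] /(periodic_same (curve_periodic D)) Em; apply: cm; rewrite E. Qed.

Lemma near_ends (a b e t : R) : Num.min a b - e < t < Num.max a b + e ->
  [\/ `|t - a| < e, `|t - b| < e | Num.min a b < t < Num.max a b].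
Proof.
move=> /andP[t1 t2]; case: (leP a b) t1 t2 => ab t1 t2.
  have [h|h] := leP t a; first by apply: Or31; rewrite ltr_norml; apply/andP; split; lra.
  have [h'|h'] := leP b t; first by apply: Or32; rewrite ltr_norml; apply/andP; split; lra.
  by apply: Or33.
have [h|h] := leP t b; first by apply: Or32; rewrite ltr_norml; apply/andP; split; lra.
have [h'|h'] := leP a t; first by apply: Or31; rewrite ltr_norml; apply/andP; split; lra.
by apply: Or33.
Qed.

(** The constants of the construction: the isolation of the four crossing parameters
    bounds the size of the chart, and transversality at the two crossings persists on
    small intervals of the axis. *)
Lemma chart_exists c m c' m' eps : crossing_pair D c c' -> crossing_pair D m m' ->
  D c <> D m -> `|m - c| < 1 ->
  (forall t, Num.min c m < t < Num.max c m -> ~ at_crossing D t) -> 0 < eps ->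
  exists K : strand_chart D,
    [/\ axis K 0 = c, axis K 1 = m, lbase K = c' & rbase K = m'] /\
    [/\ forall s, Num.min c m - eps < axis K s < Num.max c m + eps,
        12 * `|lscale K| < eps & 12 * `|rscale K| < eps].
Proof.
move=> cc mm Dcm mc empty eps0.
have cm : m - c != 0 by rewrite subr_eq0; apply/eqP => E; apply: Dcm; rewrite E.
have mc0 : 0 < `|m - c| by rewrite normr_gt0.
have gap : Num.max c m - Num.min c m = `|m - c|.
  by have [h|h] := leP c m; [rewrite ger0_norm ?subr_ge0|rewrite ltr0_norm ?subr_lt0// opprB].
have [d1 d10 P1] := crossing_isolated D c; have [d2 d20 P2] := crossing_isolated D m.
have [d3 d30 P3] := crossing_isolated D c'; have [d4 d40 P4] := crossing_isolated D m'.
(* No further crossings at distance 2 d, and room for 4 d in addition to the segment. *)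
pose d := Num.min (Num.min (Num.min d1 d2) (Num.min d3 d4)) (Num.min (1 - `|m - c|) eps) / 5.
have mn : 0 < Num.min (Num.min (Num.min d1 d2) (Num.min d3 d4)) (Num.min (1 - `|m - c|) eps).
  by rewrite !lt_min d10 d20 d30 d40 eps0 subr_gt0 mc.
have d0 : 0 < d by rewrite divr_gt0.
have [[le1 le2 le3] [le4 le5 le6]] : [/\ 5 * d <= d1, 5 * d <= d2 & 5 * d <= d3] /\
    [/\ 5 * d <= d4, 5 * d <= 1 - `|m - c| & 5 * d <= eps].
  by rewrite /d mulrCA divff ?mulr1//; split; split; rewrite !ge_min lexx ?orbT.
have d_axis t : Num.min c m - 2 * d < t < Num.max c m + 2 * d -> at_crossing D t -> t = c \/ t = m.
  move=> /near_ends[tc|tm|/empty//] cr.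
    by left; apply: P1 cr; apply: lt_le_trans tc _; lra.
  by right; apply: P2 cr; apply: lt_le_trans tm _; lra.
have short : Num.max c m - Num.min c m + 4 * d < 1 by rewrite gap; lra.
have iso p q t : (forall t, `|t - p| < q -> at_crossing D t -> t = p) -> 5 * d <= q ->
    `|t - p| < 2 * d -> at_crossing D t -> t = p.
  by move=> H dq tp; apply: H; lra.
have [gx_s gy_s _] := smooth_coordinates D_smooth.
have [S [sS S0 S1 dS S_range]] := @squeezed_line R (d / `|m - c|) (divr_gt0 d0 mc0).
pose cross t t' := derive1 (fun t => (D t).1) t * derive1 (fun t => (D t).2) t' -
  derive1 (fun t => (D t).2) t * derive1 (fun t => (D t).1) t'.
have [_ _ tr] := curve_generic D.
have transverse_along t t' s0 : crossing_pair D t t' -> c + (m - c) * S s0 = t ->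
    exists2 r, 0 < r & forall s, `|s0 - s| < r -> 0 < Num.sg (cross t t') * cross (c + (m - c) * S s) t'.
  move=> tt E; pose f s := Num.sg (cross t t') * cross (c + (m - c) * S s) t'.
  have sf : smooth f.
    have sth : smooth (fun s => c + (m - c) * S s).
      by apply: smoothD; [exact: smooth_cst|apply: smoothM; [exact: smooth_cst|]].
    apply: smoothM; first exact: smooth_cst.
    have along g : smooth g -> smooth (fun s => derive1 g (c + (m - c) * S s)).
      by move=> sg; apply: (@smooth_comp _ (derive1 g)); [exact: smooth_derive1|exact: sth].
    apply: smoothB; apply: smoothM; [exact: (along _ gx_s)|exact: smooth_cst|exact: (along _ gy_s)|exact: smooth_cst].
  have f0 : 0 < f s0.
    have [_ _ /eqP n0] := tr _ _ tt.
    by rewrite /f E -normrEsg normr_gt0.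
  have near0 : \forall s \near s0, 0 < f s by exact: (cvgr_gt _ (@smooth_continuous _ _ sf s0) _ f0).
  have /nbhs_ballP[r /= r0 rP] := near0.
  by exists r => // s /rP.
have th0 : c + (m - c) * S 0 = c by rewrite S0 mulr0 addr0.
have th1 : c + (m - c) * S 1 = m by rewrite S1 mulr1 addrC subrK.
have [r1 r10 r1P] := transverse_along _ _ _ cc th0.
have [r2 r20 r2P] := transverse_along _ _ _ mm th1.
have r0 : 0 < Num.min (Num.min r1 r2) 2^-1 by rewrite !lt_min r10 r20 invr_gt0 ltr0n.
have [m1 m2 m3] : [/\ Num.min (Num.min r1 r2) 2^-1 <= r1, Num.min (Num.min r1 r2) 2^-1 <= r2 &
    Num.min (Num.min r1 r2) (2^-1 : R) <= 2^-1].
  by split; rewrite !ge_min lexx ?orbT.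
have [K [KE [ax ls rs]]] := @chart_exists_at R D D_smooth c m c' m' d cc mm Dcm d0 _ _ (erefl _) (erefl _)
  short d_axis (fun t => iso _ _ t P3 le3) S sS S0 S1 dS S_range _ r0 m3
  (fun s sr => r1P s (lt_le_trans (eq_ind_r (fun x => x < _) sr (etrans (distrC 0 s) (congr1 Num.norm (subr0 s)))) m1))
  (fun s sr => r2P s (lt_le_trans sr m2)).
have de : d <= eps by clear -le6 d0; lra.
exists K; split; first exact: KE.
split; [|exact: lt_le_trans ls de|exact: lt_le_trans rs de].
move=> s; have /andP[h1 h2] := ax s; clear -h1 h2 de; apply/andP; split; lra.
Qed.

End ChartExistence.

(** * Sliding a strand past a crossing *)

Section Slide.
Variables (R : realType) (D : diagram R).
Hypothesis D_smooth : forall t, smooth_at D t.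
Implicit Types (s t c m eps : R).

(** The strand through [m] is pushed over the crossing of the axis with the strand through
    [c]: afterwards it crosses the axis at [ts], on the other side of [c]. The two further
    crossings are between the two strands. *)
Lemma slide c m c' m' eps : crossing_pair D c c' -> crossing_pair D m m' ->
  D c <> D m -> `|m - c| < 1 ->
  (forall t, Num.min c m < t < Num.max c m -> ~ at_crossing D t) -> 0 < eps ->
  level D m' = Virtual \/ level D c' <> Virtual ->
  exists D' : diagram R, exists ts : R,
    [/\ equivalent D D', c < m /\ c - eps < ts < c \/ m < c /\ c < ts < c + eps,
        crossing_pair D' c c', crossing_pair D' ts m' &
        forall s t, crossing_pair D' s t ->
          [\/ [/\ crossing_pair D s t, ~ same_point s m & ~ same_point t m],
              same_point s ts /\ same_point t m', same_point s m' /\ same_point t ts |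
              exists u v, [/\ `|u - c'| < eps, `|v - m'| < eps &
                same_point s u /\ same_point t v \/ same_point s v /\ same_point t u]]].
Proof.
move=> cc mm Dcm mc empty eps0 lv.
have [K [[K0 K1 Kl Kr] [ax ls rs]]] := chart_exists D_smooth cc mm Dcm mc empty eps0.
have lv' : level D (rbase K) = Virtual \/ level D (lbase K) <> Virtual by rewrite Kl Kr.
set D' := folded3 K D_smooth (level D (rbase K)).
have adm := admissible_fold3 R.
have crP s t : crossing_pair D' s t <-> surgery_crossing K (@fold3 R) (@bulge R) s t.
  exact: (surgery_crossingP K (curve_periodic D) (adm_f_range adm) (adm_g_range adm)).
(* Abscissas at which the redrawn strands meet the axis. *)
have f0 : @fold3 R 0 = - (2 / 3).
  by rewrite /fold3; case: (bulgeP 0) => *; case: (detourP 0) => *; lra.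
have g0 : @bulge R 0 = 0 by case: (bulgeP 0) => *; lra.
have i0 : -12 <= (0 : R) <= 12 by apply/andP; split; lra.
have axis_on s : -2 <= s <= 4 -> on_axis K (axis K s) s by split=> //; exact: same_point_refl.
have left0 : on_left K c' 0 by split=> //; rewrite mulr0 addr0 Kl; exact: same_point_refl.
have right0 : on_right K m' 0 by split=> //; rewrite mulr0 addr0 Kr; exact: same_point_refl.
have at_c : on_axis K c 0 by rewrite -{1}K0; apply: axis_on; apply/andP; split; lra.
have at_m : on_axis K m 1 by rewrite -{1}K1; apply: axis_on; apply/andP; split; lra.
have at_ts : on_axis K (axis K (- (2 / 3))) (- (2 / 3)) by apply: axis_on; apply/andP; split; lra.
have on_axis_same t t' s : same_point t t' -> on_axis K t s -> on_axis K t' s.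
  by move=> tt [sI H]; split=> //; exact: same_point_trans (same_point_sym tt) H.
have left_pt t : on_left K t 0 -> same_point t c' by case=> _; rewrite mulr0 addr0 Kl.
have right_pt t : on_right K t 0 -> same_point t m' by case=> _; rewrite mulr0 addr0 Kr.
have not_m t s : on_axis K t s -> s != 1 -> ~ same_point t m.
  by move=> H s1 E; have := on_axis_inj (on_axis_same _ _ _ E H) at_m; apply/eqP.
have close e h : 12 * `|e| < eps -> -12 <= h <= 12 -> `|e * h| < eps.
  by move=> ee; rewrite -ler_norml normrM => hh; apply: le_lt_trans ee; rewrite mulrC ler_wpM2r.
have strands s t h : on_left K s h -> on_right K t h -> exists u v,
    [/\ `|u - c'| < eps, `|v - m'| < eps & same_point s u /\ same_point t v].
  move=> [hI E] [_ E']; exists (lbase K + lscale K * h), (rbase K + rscale K * h); split=> //.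
    by rewrite Kl addrAC subrr add0r; exact: close.
  by rewrite Kr addrAC subrr add0r; exact: close.
exists D', (axis K (- (2 / 3))); split.
- apply: (@rst_trans _ _ _ (folded2 K D_smooth (level D (rbase K)))); apply: rst_step.
    by apply: Or43; exact: first_move.
  by apply: Or44; exact: second_move.
- have /andP[h1 h2] := ax (- (2 / 3)).
  have n1 : - (2 / 3) < (0 : R) by lra.
  case: (axis_mono K) => mo; have e0 := mo _ _ n1; have e1 := mo _ _ (@ltr01 R); rewrite K0 in e0 e1; rewrite K1 in e1.
    by left; rewrite e0 andbT; split=> //; move: h1; rewrite min_l// ltW.
  by right; rewrite e0 /=; split=> //; move: h2; rewrite max_l// ltW.
- by apply/crP; apply: CrossAL => //; rewrite g0.
- by apply/crP; apply: CrossAR => //; rewrite f0.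
- move=> s t /crP[H H' E|h H H' E|h H H' E|H H'|H H'|H H'|H H'].
  + apply: Or41; split=> //.
      by move=> /same_point_sym/on_axis_same/(_ at_m); exact: (off_axis H).
    by move=> /same_point_sym/on_axis_same/(_ at_m); exact: (off_axis H').
  + by apply: Or44; have [u [v [? ? ?]]] := strands _ _ _ H H'; exists u, v; split=> //; left.
  + by apply: Or44; have [u [v [? ? []]]] := strands _ _ _ H' H; exists u, v; split=> //; right.
  + rewrite g0 in H'; have sc := left_pt _ H; have tc : same_point t c by apply: on_axis_uniq H' at_c.
    apply: Or41; split.
    * split.
        move=> st; have [n _] := cc; apply: n.
        exact: same_point_trans (same_point_sym tc) (same_point_trans (same_point_sym st) sc).
      by rewrite (periodic_same (curve_periodic D) sc) (periodic_same (curve_periodic D) tc); case: cc.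
    * by move=> E; apply: (curve_generic_ne Dcm cc); apply: same_point_trans (same_point_sym sc) E.
    * by apply: not_m H' _; rewrite eq_sym oner_eq0.
  + rewrite g0 in H; have tc := left_pt _ H'; have sc : same_point s c by apply: on_axis_uniq H at_c.
    apply: Or41; split.
    * split.
        move=> st; have [n _] := cc; apply: n.
        exact: same_point_trans (same_point_sym sc) (same_point_trans st tc).
      by rewrite (periodic_same (curve_periodic D) sc) (periodic_same (curve_periodic D) tc); case: cc.
    * by apply: not_m H _; rewrite eq_sym oner_eq0.
    * by move=> E; apply: (curve_generic_ne Dcm cc); apply: same_point_trans (same_point_sym tc) E.
  + by rewrite f0 in H'; apply: Or43; split; [exact: right_pt|exact: on_axis_uniq H' at_ts].
  + by rewrite f0 in H; apply: Or42; split; [exact: on_axis_uniq H at_ts|exact: right_pt].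
Qed.

End Slide.

(** * Shearing isotopies *)

Section Shear.
Variables (R : realType) (a b : R).
Local Notation plane := (R * R)%type.
Local Notation N := (a ^+ 2 + b ^+ 2).
Hypothesis N_gt0 : 0 < N.

Definition along (p : plane) := a * p.1 + b * p.2.
Definition across (p : plane) := (a * p.2 - b * p.1) / N.
Definition push (p : plane) (x : R) : plane := (p.1 - x * b, p.2 + x * a).

Lemma along_push p x : along (push p x) = along p.
Proof. by rewrite /along /=; ring. Qed.

Lemma across_push p x : across (push p x) = across p + x.
Proof. by rewrite /across /=; field; rewrite gt_eqF. Qed.

Lemma coordinates_inj p q : along p = along q -> across p = across q -> p = q.
Proof.
case: p q => [p1 p2] [q1 q2]; rewrite /along /across /= => E1.
move/(divIf (negbT (gt_eqF N_gt0))) => E2.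
have n0 : N != 0 by rewrite gt_eqF.
congr pair; apply: (mulfI n0).
  by transitivity (a * (a * p1 + b * p2) - b * (a * p2 - b * p1)); [ring|rewrite E1 E2; ring].
by transitivity (b * (a * p1 + b * p2) + a * (a * p2 - b * p1)); [ring|rewrite E1 E2; ring].
Qed.

Lemma continuous_along : continuous along.
Proof. by move=> p; apply: cvgD; apply: cvgMl_tmp; [exact: cvg_fst|exact: cvg_snd]. Qed.

Lemma continuous_across : continuous across.
Proof.
move=> p; apply: cvgMr_tmp.
by apply: cvgB; apply: cvgMl_tmp; [exact: cvg_snd|exact: cvg_fst].
Qed.

Variables (h w : R -> R) (W : R).
Hypotheses (ch : continuous h) (cw : continuous w) (W_gt0 : 0 < W).
Hypothesis w_small : forall s, `|w s| <= W / 2.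

Definition tent (z : R) : R := Num.max 0 (1 - `|z| / W).

Lemma tent0 : tent 0 = 1.
Proof. by rewrite /tent normr0 mul0r subr0 max_r. Qed.

Lemma tent_far z : W <= `|z| -> tent z = 0.
Proof. by move=> Wz; rewrite /tent max_l// subr_le0 ler_pdivlMr// mul1r. Qed.

Lemma tent_bound z : 0 <= tent z <= 1.
Proof.
rewrite /tent le_max lexx /= ge_max ler01 /= gerDl oppr_le0.
by rewrite divr_ge0// ltW.
Qed.

Lemma tent_lipschitz z z' : `|tent z - tent z'| <= `|z - z'| / W.
Proof.
have key (x y : R) : `|Num.max 0 x - Num.max 0 y| <= `|x - y|.
  have l1 := ler_norm (x - y); have l2 := ler_norm (- (x - y)); rewrite normrN in l2.
  by rewrite ler_norml; case: (leP 0 x) => ?; case: (leP 0 y) => ?; apply/andP; split; lra.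
apply: le_trans (key _ _) _.
rewrite opprD addrACA subrr add0r opprK addrC -mulrBl normrM normfV (gtr0_norm W_gt0).
rewrite ler_pM2r ?invr_gt0// [`|z - _|]distrC; exact: ler_dist_dist.
Qed.

Lemma continuous_tent : continuous tent.
Proof.
move=> z; apply: (@continuous_max _ _ (fun=> 0) (fun z => 1 - `|z| / W)); first exact: cvg_cst.
apply: cvgB; first exact: cvg_cst.
by apply: cvgMr_tmp; exact: norm_continuous.
Qed.

(** Points are pushed along the lines where [along] is constant, by [w] on the graph of [h]
    and less and less away from it. As the slope of [tent] is at most 1 / W and [w] at most
    W / 2, the order on each line is preserved. *)
Definition displacement u p : R := u * w (along p) * tent (across p - h (along p)).
Definition shear u p : plane := push p (displacement u p).

Lemma continuous_displacement (T : topologicalType) (f : T -> R) (g : T -> plane) :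
  continuous f -> continuous g -> continuous (fun q => displacement (f q) (g q)).
Proof.
move=> cf cg q.
have cs : along (g x) @[x --> q] --> along (g q) by exact: (@cvg_comp _ _ _ g along _ _ _ (cg q) (@continuous_along _)).
have cy : across (g x) @[x --> q] --> across (g q) by exact: (@cvg_comp _ _ _ g across _ _ _ (cg q) (@continuous_across _)).
apply: cvgM.
  by apply: cvgM; [exact: cf|exact: (@cvg_comp _ _ _ (fun x => along (g x)) w _ _ _ cs (@cw _))].
apply: (@cvg_comp _ _ _ (fun x => across (g x) - h (along (g x))) tent); last exact: continuous_tent.
by apply: cvgB; [exact: cy|exact: (@cvg_comp _ _ _ (fun x => along (g x)) h _ _ _ cs (@ch _))].
Qed.

Lemma continuous_push (T : topologicalType) (f : T -> R) (g : T -> plane) :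
  continuous f -> continuous g -> continuous (fun q => push (g q) (f q)).
Proof.
move=> cf cg q.
have c1 : (g x).1 @[x --> q] --> (g q).1 by exact: (@cvg_comp _ _ _ g fst _ _ _ (cg q) (@cvg_fst _ _ _ _ _)).
have c2 : (g x).2 @[x --> q] --> (g q).2 by exact: (@cvg_comp _ _ _ g snd _ _ _ (cg q) (@cvg_snd _ _ _ _ _)).
have p1 : {for q, continuous (fun x => (g x).1 - f x * b)}.
  by apply: cvgB => //; apply: cvgMr_tmp; exact: cf.
have p2 : {for q, continuous (fun x => (g x).2 + f x * a)}.
  by apply: cvgD => //; apply: cvgMr_tmp; exact: cf.
exact: (cvg_pair p1 p2).
Qed.

(** The map [shear u] on the line through [p], in terms of [across]. *)
Let rise u (p : plane) y := y + u * w (along p) * tent (y - h (along p)).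

Let rise_mono u p y y' : 0 <= u <= 1 -> y < y' -> rise u p y < rise u p y'.
Proof.
move=> /andP[u0 u1] yy; have lip := tent_lipschitz (y' - h (along p)) (y - h (along p)).
rewrite opprB addrA subrK in lip; rewrite (gtr0_norm (_ : 0 < y' - y)) ?subr_gt0// in lip.
have wb := w_small (along p).
have : `|u * w (along p) * (tent (y' - h (along p)) - tent (y - h (along p)))| <= (y' - y) / 2.
  rewrite normrM (_ : (y' - y) / 2 = (W / 2) * ((y' - y) / W)); last by field; rewrite gt_eqF.
  apply: ler_pM => //; rewrite normrM (ger0_norm u0); apply: le_trans wb.
  by rewrite -[leRHS]mul1r ler_wpM2r.
rewrite ler_norml => /andP[lb _]; rewrite /rise -subr_gt0.
rewrite (_ : _ - _ = (y' - y) + u * w (along p) * (tent (y' - h (along p)) - tent (y - h (along p)))); last by ring.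
lra.
Qed.

Let rise_bound u p y : 0 <= u <= 1 -> `|rise u p y - y| <= W.
Proof.
move=> /andP[u0 u1]; rewrite /rise addrAC subrr add0r !normrM.
have /andP[t0 t1] := tent_bound (y - h (along p)).
rewrite (ger0_norm u0) (ger0_norm t0) -[leRHS]mulr1; apply: ler_pM => //.
  by rewrite mulr_ge0.
apply: le_trans (_ : 1 * `|w (along p)| <= _); first by rewrite ler_wpM2r.
by rewrite mul1r; apply: le_trans (w_small _) _; move: W_gt0 => ?; lra.
Qed.

Let continuous_rise u p : continuous (rise u p).
Proof.
move=> y; apply: cvgD; first exact: cvg_id.
apply: cvgMl_tmp; apply: (@cvg_comp _ _ _ (fun y => y - h (along p)) tent); last exact: continuous_tent.
by apply: cvgB; [exact: cvg_id|exact: cvg_cst].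
Qed.

Let rise_onto u p Y : 0 <= u <= 1 -> exists y, rise u p y = Y.
Proof.
move=> uI; have lh : Y - W <= Y + W by move: W_gt0 => ?; lra.
have := @IVT R (rise u p) (Y - W) (Y + W) Y lh (continuous_subspaceT (@continuous_rise u p)).
case.
  have := rise_bound p (Y - W) uI; have := rise_bound p (Y + W) uI.
  rewrite !ler_norml => /andP[? ?] /andP[? ?].
  by rewrite ge_min le_max; apply/andP; split; apply/orP; [left|right]; lra.
by move=> y _ E; exists y.
Qed.

(** The inverse exists on each line by the intermediate value theorem; it is continuous in
    all variables because of monotonicity along the lines. *)
Let shear_homeomorphism u : 0 <= u <= 1 -> homeomorphism (shear u).
Proof.
move=> uI.
have mono p y y' : y < y' -> rise u p y < rise u p y' by exact: rise_mono.
have inj p : injective (rise u p).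
  by move=> y y' E; have [/(mono p)|/(mono p)|//] := ltgtP y y'; rewrite E ltxx.
have /choice[G GE] : forall q : plane, exists y, rise u q y = across q by move=> q; exact: rise_onto.
have cG : continuous G.
  move=> q0; apply/cvgrPdist_lt => e e0.
  have cr y0 : {for q0, continuous (fun q => across q - rise u q y0)}.
    apply: cvgB; first exact: continuous_across.
    apply: cvgD; first exact: cvg_cst.
    apply: cvgM.
      by apply: cvgMl_tmp; exact: (@cvg_comp _ _ _ along w _ _ _ (@continuous_along q0) (@cw _)).
    apply: (@cvg_comp _ _ _ (fun q => y0 - h (along q)) tent); last exact: continuous_tent.
    apply: cvgB; first exact: cvg_cst.
    by exact: (@cvg_comp _ _ _ along h _ _ _ (@continuous_along q0) (@ch _)).
  have n1 : \forall q \near q0, 0 < across q - rise u q (G q0 - e).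
    by apply: (cvgr_gt _ (cr _)); rewrite -GE subr_gt0 mono// ltrBlDr ltrDl.
  have n2 : \forall q \near q0, across q - rise u q (G q0 + e) < 0.
    by apply: (cvgr_lt _ (cr _)); rewrite -GE subr_lt0 mono// ltrDl.
  near=> q.
  have h1 : 0 < across q - rise u q (G q0 - e) by near: q.
  have h2 : across q - rise u q (G q0 + e) < 0 by near: q.
  rewrite -GE in h1 h2; rewrite subr_gt0 in h1; rewrite subr_lt0 in h2.
  have k1 : G q0 - e < G q.
    by rewrite ltNge; apply/negP; rewrite le_eqVlt => /predU1P[E|/(mono q) E]; move: h1; rewrite ?E ?ltxx// ltNge (ltW E).
  have k2 : G q < G q0 + e.
    by rewrite ltNge; apply/negP; rewrite le_eqVlt => /predU1P[E|/(mono q) E]; move: h2; rewrite ?E ?ltxx// ltNge (ltW E).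
  by rewrite ltr_norml; apply/andP; split; lra.
split; first by apply: continuous_push; [apply: continuous_displacement; [move=> ?; exact: cvg_cst|move=> ?; exact: cvg_id]|move=> ?; exact: cvg_id].
exists (fun q => push q (G q - across q)); split.
- apply: continuous_push; last by move=> ?; exact: cvg_id.
  by move=> q; apply: cvgB; [exact: cG|exact: continuous_across].
- move=> p; apply: coordinates_inj; first by rewrite along_push /shear along_push.
  rewrite across_push addrC subrK; apply: (inj p).
  rewrite (_ : rise u p (G _) = rise u (shear u p) (G (shear u p))); last by rewrite /rise /shear along_push.
  by rewrite GE /shear across_push.
- move=> q; apply: coordinates_inj; first by rewrite /shear !along_push.
  rewrite /shear /displacement !across_push along_push.
  by rewrite [across q + _]addrC subrK; exact: GE.
Unshelve. all: by end_near. Qed.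

Lemma shear_isotopy : ambient_isotopy shear.
Proof.
split; last by move=> p; rewrite /shear /displacement !mul0r /push !mul0r subr0 addr0; case: p.
- apply: continuous_subspaceT; apply: continuous_push; last by move=> q; exact: cvg_snd.
  by apply: continuous_displacement; move=> q; [exact: cvg_fst|exact: cvg_snd].
- exact: shear_homeomorphism.
Qed.

End Shear.

(** * Inverse functions and the rounding profile *)

Section Inverse.
Variable R : realType.
Implicit Types (x y s d : R).

Lemma increasing_inverse (f : R -> R) : continuous f -> (forall x y, x < y -> f x < f y) ->
  (forall s, exists x, f x = s) -> exists g, [/\ continuous g, cancel f g & cancel g f].
Proof.
move=> cf inc onto; have [g fg] := choice onto.
have le_inc x y : x <= y -> f x <= f y by rewrite le_eqVlt => /predU1P[->//|/inc/ltW].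
have lt_back s y : s < f y -> g s < y.
  by move=> sy; rewrite ltNge; apply/negP => /le_inc; rewrite fg leNgt sy.
have gt_back s y : f y < s -> y < g s.
  by move=> sy; rewrite ltNge; apply/negP => /le_inc; rewrite fg leNgt sy.
exists g; split=> //; last first.
  by move=> x; have [/inc|/inc|//] := ltgtP (g (f x)) x; rewrite fg ltxx.
move=> s0; apply/cvgrPdist_lt => e e0; near=> s.
have h1 : g s0 - e < g s.
  apply: gt_back; near: s; apply: lt_nbhsr.
  by rewrite -[X in _ < X]fg inc// ltrBlDr ltrDl.
have h2 : g s < g s0 + e.
  apply: lt_back; near: s; apply: lt_nbhsl.
  by rewrite -[X in X < _]fg inc// ltrDl.
by rewrite ltr_norml; apply/andP; split; lra.
Unshelve. all: by end_near. Qed.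

Definition clamp d x := Num.max (- d) (Num.min d x).

Variant clamp_spec d x : R -> Type :=
| ClampLow of x <= - d : clamp_spec d x (- d)
| ClampMid of - d <= x & x <= d : clamp_spec d x x
| ClampHigh of d <= x : clamp_spec d x d.

Lemma clampP d x : 0 < d -> clamp_spec d x (clamp d x).
Proof.
move=> d0; rewrite /clamp; case: (leP d x) => [dx|xd].
  by rewrite max_r; [exact: ClampHigh|lra].
by case: (leP (- d) x) => dx; [apply: ClampMid|apply: ClampLow] => //; exact: ltW.
Qed.

Lemma clamp_id d x : - d <= x <= d -> clamp d x = x.
Proof. by move=> /andP[? ?]; rewrite /clamp min_r// max_r. Qed.

Lemma clamp_range d x : 0 < d -> - d <= clamp d x <= d.
Proof. by move=> d0; case: clampP => // *; apply/andP; split; lra. Qed.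

Lemma clamp_high d x : 0 < d -> d <= x -> clamp d x = d.
Proof. by move=> d0 dx; case: clampP => // *; lra. Qed.

Lemma clamp_low d x : 0 < d -> x <= - d -> clamp d x = - d.
Proof. by move=> d0 dx; case: clampP => // *; lra. Qed.

Lemma continuous_clamp d : continuous (clamp d).
Proof.
move=> x; apply: (@continuous_max _ _ (fun=> - d) (fun x => Num.min d x)); first exact: cvg_cst.
by apply: (@continuous_min _ _ (fun=> d) (fun x => x)); [exact: cvg_cst|exact: cvg_id].
Qed.

Lemma extended_increasing (f : R -> R) d : 0 < d ->
  (forall x y, - d <= x -> x < y -> y <= d -> f x < f y) ->
  forall x y, x < y -> f (clamp d x) + (x - clamp d x) < f (clamp d y) + (y - clamp d y).
Proof.
move=> d0 inc x y xy.
case: (clampP x d0) => [xd|dx xd|dx]; case: (clampP y d0) => [yd|dy yd|dy]; try lra.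
- by move: dy; rewrite le_eqVlt => /predU1P[E|dy]; [rewrite -E; lra|have := inc _ _ (lexx (- d)) dy yd; lra].
- by have h : - d < d; [lra|have := inc _ _ (lexx (- d)) h (lexx d); lra].
- by have := inc _ _ dx xy yd; lra.
- by move: xd; rewrite le_eqVlt => /predU1P[E|xd]; [rewrite E; lra|have := inc _ _ dx xd (lexx d); lra].
Qed.

(** The function is continued with slope 1 outside of [-d, d] and inverted on the line. *)
Lemma clamped_inverse (f : R -> R) d : 0 < d -> continuous f ->
  (forall x y, - d <= x -> x < y -> y <= d -> f x < f y) ->
  exists g : R -> R, [/\ continuous g, forall s, - d <= g s <= d,
    forall x, - d <= x <= d -> g (f x) = x,
    forall s, f (- d) <= s <= f d -> f (g s) = s &
    (forall s, s <= f (- d) -> g s = - d) /\ (forall s, f d <= s -> g s = d)].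
Proof.
move=> d0 cf inc; have finc := extended_increasing d0 inc.
pose F x := f (clamp d x) + (x - clamp d x).
have cF : continuous F.
  move=> x; have cc := @continuous_clamp d x.
  apply: cvgD; first exact: (@cvg_comp _ _ _ (clamp d) f _ _ _ cc (@cf _)).
  by apply: cvgB; [exact: cvg_id|exact: cc].
have FE x : - d <= x <= d -> F x = f x by move=> xd; rewrite /F clamp_id// subrr addr0.
have dd : - d <= d <= d by apply/andP; split; lra.
have dd' : - d <= - d <= d by apply/andP; split; lra.
have [//|s|g [cg Fg gF]] := increasing_inverse cF.
  pose l := - d - `|s - f (- d)|; pose h := d + `|s - f d|.
  have n1 := normr_ge0 (s - f (- d)); have n2 := normr_ge0 (s - f d).
  have lE : F l = f (- d) - `|s - f (- d)|.
    by rewrite /F clamp_low// /l; [lra|lra].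
  have hE : F h = f d + `|s - f d|.
    by rewrite /F clamp_high// /h; [lra|lra].
  have lh : l <= h by rewrite /l /h; lra.
  have [|x _ E] := IVT (v := s) lh (continuous_subspaceT cF); last by exists x.
  have b1 : F l <= s by rewrite lE; have := ler_norm (- (s - f (- d))); rewrite normrN; lra.
  have b2 : s <= F h by rewrite hE; have := ler_norm (s - f d); lra.
  by rewrite ge_min le_max b1 b2 orbT.
have le_back s x : s <= F x -> g s <= x.
  by move=> sx; rewrite leNgt; apply/negP => /finc; rewrite -/(F _) -/(F (g s)) gF ltNge sx.
have ge_back s x : F x <= s -> x <= g s.
  by move=> sx; rewrite leNgt; apply/negP => /finc; rewrite -/(F _) -/(F (g s)) gF ltNge sx.
exists (clamp d \o g); split.
- by move=> s; apply: continuous_comp; [exact: cg|exact: continuous_clamp].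
- by move=> s; exact: clamp_range.
- by move=> x xd; rewrite /= -FE// Fg clamp_id.
- move=> s /andP[s1 s2]; rewrite -FE in s1; last exact: dd'.
  rewrite -FE in s2; last exact: dd.
  have gd : - d <= g s <= d by rewrite ge_back// le_back.
  by rewrite /= clamp_id// -FE// gF.
- split=> s; rewrite -FE// => sd /=.
    by rewrite clamp_low// le_back.
  by rewrite clamp_high// ge_back.
Qed.

End Inverse.

Section Bend.
Variable R : realType.
Implicit Types (x y d : R).

Lemma derive1_step_le0 x : x <= 0 -> derive1 (@step R) x = 0.
Proof. by move=> x0; rewrite derive1_step /flat_poly ltNge x0 /= !mul0r addr0 mul0r. Qed.

Let slope_step (a b x : R) : is_derive x 1 (fun x => step (a + b * x)) (derive1 (@step R) (a + b * x) * b).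
Proof.
apply: is_derive1_comp; first exact: (smooth_is_derive (@smooth_step R)).
have := is_deriveD (is_derive_cst a x 1) (is_deriveM (is_derive_cst b x 1) (is_derive_id x 1)).
by congr is_derive; rewrite /GRing.scale /=; ring.
Qed.

(** A smooth function that agrees with [Num.max 0] outside of [-1, 1] and increases from -1
    on; the first summand gives it a positive slope before the second one starts. *)
Definition bend x : R := (1 - step (-1 + 2 * x)) * (2^-1 * step (2^-1 + 2^-1 * x)) + step (-1 + 2 * x) * x.

Lemma smooth_bend : smooth bend.
Proof.
have ss a b : smooth (fun x : R => step (a + b * x)).
  by apply: (@smooth_comp _ (@step R)); [exact: smooth_step|exact: smooth_affine].
apply: smoothD; apply: smoothM; [|apply: smoothM|exact: ss|exact: smooth_id].
- by apply: smoothB; [exact: smooth_cst|exact: ss].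
- exact: smooth_cst.
- exact: ss.
Qed.

Lemma bend_low x : x <= -1 -> bend x = 0.
Proof. by move=> x1; rewrite /bend !step_le0; [ring|lra|lra]. Qed.

Lemma bend_high x : 1 <= x -> bend x = x.
Proof. by move=> x1; rewrite /bend [step (-1 + _)]step_ge1; [ring|lra]. Qed.

Lemma derive1_bend x : derive1 bend x =
  2 * derive1 (@step R) (-1 + 2 * x) * (x - 2^-1 * step (2^-1 + 2^-1 * x)) +
  4^-1 * (1 - step (-1 + 2 * x)) * derive1 (@step R) (2^-1 + 2^-1 * x) + step (-1 + 2 * x).
Proof.
have s1 := slope_step (-1) 2 x; have s2 := slope_step 2^-1 2^-1 x.
have H := is_deriveD (is_deriveM (is_deriveB (is_derive_cst (1 : R) x 1) s1)
  (is_deriveM (is_derive_cst (2^-1 : R) x 1) s2)) (is_deriveM s1 (is_derive_id x 1)).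
rewrite derive1E (_ : bend = (cst 1 - (fun x => step (-1 + 2 * x))) *
  (cst 2^-1 * (fun x => step (2^-1 + 2^-1 * x))) + (fun x => step (-1 + 2 * x)) * id)//.
by rewrite (@derive_val _ _ _ _ _ _ _ H) /GRing.scale /= !fctE; field.
Qed.

Let term1 x : 0 <= 2 * derive1 (@step R) (-1 + 2 * x) * (x - 2^-1 * step (2^-1 + 2^-1 * x)).
Proof.
have [h|h] := leP x 2^-1; first by rewrite derive1_step_le0 ?mulr0 ?mul0r//; lra.
have /andP[b0 b1] := @step_bound R (2^-1 + 2^-1 * x).
by rewrite mulr_ge0 ?mulr_ge0 ?derive1_step_ge0//; lra.
Qed.

Lemma derive1_bend_ge0 x : 0 <= derive1 bend x.
Proof.
have /andP[b0 b1] := @step_bound R (-1 + 2 * x).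
rewrite derive1_bend !addr_ge0// ?term1//.
by rewrite mulr_ge0 ?derive1_step_ge0// mulr_ge0//; lra.
Qed.

Lemma derive1_bend_gt0 x : -1 < x -> 0 < derive1 bend x.
Proof.
move=> x1; have /andP[b0 b1] := @step_bound R (-1 + 2 * x); rewrite derive1_bend.
have [h|h] := leP 1 x.
  have s1 : step (-1 + 2 * x) = (1 : R) by apply: step_ge1; lra.
  by rewrite s1 subrr mulr0 mul0r addr0 ltr_wpDl// ?term1.
have l1 : step (-1 + 2 * x) < (1 : R) by apply: step_lt1; lra.
rewrite ltr_pwDl// ltr_wpDl ?term1// mulr_gt0// ?derive1_step_gt0//; [lra|].
by apply/andP; split; lra.
Qed.

Lemma bend_increasing x y : -1 <= x -> x < y -> bend x < bend y.
Proof.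
move=> x1 xy; pose z := (x + y) / 2.
have [u /andP[u1 u2] E] := mean_value (smooth_is_derive smooth_bend) x z.
have [v /andP[v1 v2] E'] := mean_value (smooth_is_derive smooth_bend) z y.
have xz : x < z by rewrite /z; lra.
have zy : z < y by rewrite /z; lra.
rewrite min_l ?(ltW zy)// in v1.
have d1 : 0 <= derive1 bend u * (z - x) by rewrite mulr_ge0 ?derive1_bend_ge0//; lra.
have d2 : 0 < derive1 bend v * (y - z) by rewrite mulr_gt0 ?derive1_bend_gt0//; lra.
lra.
Qed.

Lemma bend_range x : x <= 1 -> 0 <= bend x <= 1.
Proof.
move=> x1; have [h|h] := leP x (-1); first by rewrite bend_low// lexx ler01.
have p := bend_increasing (lexx (-1)) h; rewrite bend_low// in p; rewrite (ltW p) /=.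
have E := bend_high (lexx 1); rewrite -[leRHS]E.
by move: x1; rewrite le_eqVlt => /predU1P[->//|xl]; apply/ltW/bend_increasing => //; exact: ltW.
Qed.

End Bend.

(** * Reparametrizing the circle and splicing curves *)

Lemma continuous_near (R : realType) (T : topologicalType) (f g : R -> T) t :
  (\forall t' \near t, f t' = g t') -> {for t, continuous g} -> {for t, continuous f}.
Proof.
move=> fg cg; have E : f t = g t := nbhs_singleton fg.
change (f @ t --> f t); rewrite E; apply: (cvg_trans _ cg).
by apply: near_eq_cvg; near=> t'; apply/esym; near: t'.
Unshelve. all: by end_near. Qed.

Section Twist.
Variable R : realType.
Implicit Types (s t u z d : R).

Lemma centered_shift z x : `|centered z + x| < 2^-1 -> centered (z + x) = centered z + x.
Proof. by move=> h; apply: centeredE h; exact/same_pointD/same_point_sym/centered_same. Qed.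

Lemma centered_half z : `|centered z| <= 2^-1.
Proof. by have /andP[? ?] := centered_bound z; rewrite ler_norml; apply/andP; split; lra. Qed.

Lemma centered_far_near d z : d < `|centered z| -> \forall z' \near z, d < `|centered z'|.
Proof.
move=> dz; apply/nbhs_ballP; exists (`|centered z| - d) => /=; first by rewrite subr_gt0.
move=> z' zz'; rewrite /ball /= in zz'.
rewrite ltNge; apply/negP => z'd.
have lt : `|centered z' + (z - z')| < `|centered z|.
  by apply: le_lt_trans (ler_normD _ _) _; lra.
have := centered_shift (lt_le_trans lt (centered_half z)).
by rewrite addrC subrK => E; rewrite -E ltxx in lt.
Qed.

Lemma centered_near z : `|centered z| < 2^-1 -> \forall z' \near z, centered z' = centered z + (z' - z).
Proof.
move=> h; apply/nbhs_ballP; exists (2^-1 - `|centered z|) => /=; first by rewrite subr_gt0.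
move=> z' zz'; rewrite /ball /= distrC in zz'.
have lt : `|centered z + (z' - z)| < 2^-1.
  by apply: le_lt_trans (ler_normD _ _) _; lra.
by rewrite -(centered_shift lt) addrC subrK.
Qed.

Variables (t0 d : R).
Hypotheses (d_gt0 : 0 < d) (d_half : d < 2^-1).

(** The reparametrization [phi] of a neighbourhood of [t0], continued by the identity. *)
Definition twist (phi : R -> R) t := t + (phi (centered (t - t0)) - centered (t - t0)).

Definition local_shift (phi : R -> R) :=
  [/\ continuous phi, forall u, d <= `|u| -> phi u = u & forall u, `|u| <= d -> `|phi u| <= d].

Lemma continuous_shift_near t : {for t, continuous (fun t => t - t0)}.
Proof. by apply: cvgB; [exact: cvg_id|exact: cvg_cst]. Qed.

Lemma continuous_twist phi : local_shift phi -> continuous (twist phi).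
Proof.
move=> [cphi far _] t; have [h|h] := ltP d `|centered (t - t0)|.
  have n : \forall t' \near t, twist phi t' = t'.
    have nf : \forall t' \near t, d < `|centered (t' - t0)|.
      exact: (@continuous_shift_near t _ (centered_far_near h)).
    near=> t'; rewrite /twist far ?subrr ?addr0//; apply: ltW; near: t'; exact: nf.
  by apply: continuous_near n _; exact: cvg_id.
have h2 : `|centered (t - t0)| < 2^-1 by exact: le_lt_trans d_half.
have n : \forall t' \near t, twist phi t' =
    t' + (phi (centered (t - t0) + (t' - t)) - (centered (t - t0) + (t' - t))).
  have nf : \forall t' \near t, centered (t' - t0) = centered (t - t0) + (t' - t0 - (t - t0)).
    exact: (@continuous_shift_near t _ (centered_near h2)).
  near=> t'; have E : centered (t' - t0) = centered (t - t0) + (t' - t).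
    rewrite (_ : t' - t = t' - t0 - (t - t0)); last by ring.
    by near: t'.
  by rewrite /twist E.
have c1 : {for t, continuous (fun t' => centered (t - t0) + (t' - t))}.
  by apply: cvgD; [exact: cvg_cst|apply: cvgB; [exact: cvg_id|exact: cvg_cst]].
have c2 : {for t, continuous (fun t' => t' + (phi (centered (t - t0) + (t' - t)) - (centered (t - t0) + (t' - t))))}.
  apply: cvgD; first exact: cvg_id.
  apply: cvgB; last exact: c1.
  exact: (@cvg_comp _ _ _ (fun t' => centered (t - t0) + (t' - t)) phi _ _ _ c1 (@cphi _)).
exact: continuous_near n c2.
Unshelve. all: by end_near. Qed.

Lemma twist_periodic phi t : twist phi (t + 1) = twist phi t + 1.
Proof. by rewrite /twist (_ : t + 1 - t0 = t - t0 + 1) ?centered_periodic; ring. Qed.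

Lemma twist_same phi t t' : same_point t t' -> same_point (twist phi t) (twist phi t').
Proof.
move=> tt; have E : centered (t - t0) = centered (t' - t0) by exact/centered_eq/same_pointD.
by rewrite /twist E; exact: same_pointD.
Qed.

Lemma twist_far phi t : local_shift phi -> d <= `|centered (t - t0)| -> twist phi t = t.
Proof. by move=> [_ far _] h; rewrite /twist far// subrr addr0. Qed.

Lemma centered_twist phi t : local_shift phi ->
  centered (twist phi t - t0) = phi (centered (t - t0)).
Proof.
move=> ls; have [h|h] := leP d `|centered (t - t0)|.
  by rewrite twist_far//; case: ls => _ -> .
have [_ _ near] := ls.
rewrite /twist (_ : _ - t0 = t - t0 + (phi (centered (t - t0)) - centered (t - t0))); last by ring.
have E : centered (t - t0) + (phi (centered (t - t0)) - centered (t - t0)) = phi (centered (t - t0)).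
  by ring.
by rewrite centered_shift E// (le_lt_trans (near _ (ltW h))).
Qed.

Lemma twistK phi psi : local_shift phi -> local_shift psi ->
  (forall u, `|u| <= d -> psi (phi u) = u) -> cancel (twist phi) (twist psi).
Proof.
move=> lphi lpsi inv t; rewrite {1}/twist centered_twist//.
have E : psi (phi (centered (t - t0))) = centered (t - t0).
  have [h|h] := leP `|centered (t - t0)| d; first exact: inv.
  have [_ f1 _] := lphi; have [_ f2 _] := lpsi.
  by rewrite f1 ?f2// ltW.
by rewrite E /twist; ring.
Qed.

Lemma twist_homeo phi psi : local_shift phi -> local_shift psi ->
  (forall u, `|u| <= d -> psi (phi u) = u) -> (forall u, `|u| <= d -> phi (psi u) = u) ->
  circle_homeo (twist phi).
Proof.
move=> lphi lpsi i1 i2; split; first exact: continuous_twist.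
  by exists (twist psi); exact: twistK.
by left=> t; exact: twist_periodic.
Qed.

End Twist.

Section Splice.
Variable R : realType.
Implicit Types (p q v : R -> R) (d u : R).

(** With [v = Num.max 0] the curve [p] is followed up to [t0] and [q] afterwards; a smooth
    [v] superposes the two movements near [t0] and rounds the corner. *)
Definition splice p q (t0 : R) v u : R := p (t0 - v (- u)) + q (t0 + v u) - p t0.

Lemma splice_before p q t0 v u : p t0 = q t0 -> v u = 0 -> v (- u) = - u ->
  splice p q t0 v u = p (t0 + u).
Proof. by move=> E v0 v1; rewrite /splice v0 v1 opprK addr0 -E addrK. Qed.

Lemma splice_after p q t0 v u : v u = u -> v (- u) = 0 -> splice p q t0 v u = q (t0 + u).
Proof. by move=> v0 v1; rewrite /splice v0 v1 subr0 [p t0 + _]addrC addrK. Qed.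

Record cornering d v : Prop := Cornering {
  cornering_continuous : continuous v ;
  cornering_low : forall u, u <= - d -> v u = 0 ;
  cornering_high : forall u, d <= u -> v u = u ;
  cornering_range : forall u, u <= d -> 0 <= v u <= d ;
  cornering_le : forall u u', u <= u' -> v u <= v u' ;
  cornering_lt : forall u u', - d <= u -> u < u' -> u' <= d -> v u < v u' \/ v (- u') < v (- u)
}.

Lemma corner_cornering d : 0 < d -> cornering d (Num.max 0).
Proof.
move=> d0; split.
- move=> u; apply: (@continuous_max _ _ (fun=> 0) (fun u => u)); [exact: cvg_cst|exact: cvg_id].
- by move=> u ud; rewrite max_l//; lra.
- by move=> u ud; rewrite max_r//; lra.
- by move=> u ud; rewrite le_max lexx /= ge_max ud ltW.
- by move=> u u' uu; rewrite ge_max !le_max lexx uu orbT.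
- move=> u u' _ uu _; case: (leP 0 u') => h; case: (leP 0 u) => h'; case: (leP 0 (- u')) => ?;
    case: (leP 0 (- u)) => ?; by [left; lra|right; lra].
Qed.

Lemma bend_cornering d : 0 < d -> cornering d (fun u => d * bend (d^-1 * u)).
Proof.
move=> d0; have dn : d != 0 by rewrite gt_eqF.
have sc u u' : (d^-1 * u <= d^-1 * u') = (u <= u') by rewrite ler_pM2l ?invr_gt0.
have sc' u u' : (d^-1 * u < d^-1 * u') = (u < u') by rewrite ltr_pM2l ?invr_gt0.
have d1 : d^-1 * d = 1 by rewrite mulVf.
have d2 : d^-1 * - d = -1 by rewrite mulrN d1.
have inc u u' : - d <= u -> u < u' -> bend (d^-1 * u) < bend (d^-1 * u').
  by move=> du uu; apply: bend_increasing; rewrite ?sc'// -d2 sc.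
split.
- have sb : smooth (fun u => d * bend (d^-1 * u)).
    apply: smoothM; first exact: smooth_cst.
    apply: (@smooth_comp _ (@bend R)); first exact: smooth_bend.
    by apply: smoothM; [exact: smooth_cst|exact: smooth_id].
  exact: smooth_continuous sb.
- by move=> u ud; rewrite bend_low ?mulr0// -d2 sc.
- by move=> u ud; rewrite bend_high -?d1 ?sc// mulrA mulfV// mul1r.
- move=> u ud; have /andP[b0 b1] : 0 <= bend (d^-1 * u) <= 1 by apply: bend_range; rewrite -d1 sc.
  by rewrite mulr_ge0 ?(ltW d0)//= -[leRHS]mulr1 ler_pM2l.
- move=> u u' uu; rewrite ler_pM2l//; have [h|h] := leP u (- d).
    rewrite bend_low; last by rewrite -d2 sc.
    have [h'|h'] := leP (d^-1 * u') 1; first by have /andP[] := bend_range h'.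
    by rewrite bend_high ltW// (lt_trans ltr01).
  by move: uu; rewrite le_eqVlt => /predU1P[->//|uu]; apply/ltW/inc => //; exact: ltW.
- by move=> u u' du uu _; left; rewrite ltr_pM2l// inc.
Qed.

Lemma continuous_splice p q t0 v : continuous p -> continuous q -> continuous v ->
  continuous (splice p q t0 v).
Proof.
move=> cp cq cv u.
have cN : {for u, continuous (fun u => v (- u))}.
  by apply: (@cvg_comp _ _ _ (fun u => - u) v); [apply: cvgN; exact: cvg_id|exact: cv].
apply: cvgB; last exact: cvg_cst.
apply: cvgD.
  apply: (@cvg_comp _ _ _ (fun u => t0 - v (- u)) p); last exact: cp.
  by apply: cvgB; [exact: cvg_cst|exact: cN].
apply: (@cvg_comp _ _ _ (fun u => t0 + v u) q); last exact: cq.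
by apply: cvgD; [exact: cvg_cst|exact: cv].
Qed.

Lemma splice_increasing p q t0 d v : cornering d v ->
  (forall r r', t0 - d <= r -> r < r' -> r' <= t0 + d -> p r < p r') ->
  (forall r r', t0 - d <= r -> r < r' -> r' <= t0 + d -> q r < q r') ->
  forall u u', - d <= u -> u < u' -> u' <= d -> splice p q t0 v u < splice p q t0 v u'.
Proof.
move=> cv pi qi u u' du uu ud.
have le p' : (forall r r', t0 - d <= r -> r < r' -> r' <= t0 + d -> p' r < p' r') ->
    forall r r', t0 - d <= r -> r <= r' -> r' <= t0 + d -> p' r <= p' r'.
  by move=> inc r r' tr; rewrite le_eqVlt => /predU1P[->//|rr] rt; apply/ltW/inc.
have rg x : - d <= x -> x <= d -> [/\ 0 <= v x, v x <= d, 0 <= v (- x) & v (- x) <= d].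
  move=> x1 x2; have /andP[? ?] := cornering_range cv x2.
  have /andP[? ?] : 0 <= v (- x) <= d by apply: (cornering_range cv); lra.
  by split.
have [a1 a2 a3 a4] := rg u du (ltW (lt_le_trans uu ud)).
have [b1 b2 b3 b4] := rg u' (ltW (le_lt_trans du uu)) ud.
have l1 := cornering_le cv (ltW uu).
have l2 : v (- u') <= v (- u) by apply: (cornering_le cv); rewrite lerN2 ltW.
rewrite /splice ltrD2r; have [h|h] := cornering_lt cv du uu ud.
  by apply: ler_ltD; [apply: (le p pi); lra|apply: qi; lra].
by apply: ltr_leD; [apply: pi; lra|apply: (le q qi); lra].
Qed.

Lemma smooth_splice p q t0 v : smooth p -> smooth q -> smooth v -> smooth (splice p q t0 v).
Proof.
move=> sp sq sv; apply: smoothB; last exact: smooth_cst.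
apply: smoothD.
  apply: (@smooth_comp _ p); first exact: sp.
  apply: smoothB; first exact: smooth_cst.
  by apply: (@smooth_comp _ v); [exact: sv|apply: smoothN; exact: smooth_id].
by apply: (@smooth_comp _ q); [exact: sq|apply: smoothD; [exact: smooth_cst|exact: sv]].
Qed.

Lemma is_derive_splice p q t0 v u : smooth p -> smooth q -> smooth v -> is_derive u 1 (splice p q t0 v)
  (derive1 p (t0 - v (- u)) * derive1 v (- u) + derive1 q (t0 + v u) * derive1 v u).
Proof.
move=> sp sq sv.
have dN := @is_derive1_comp _ v (fun u => - u) u _ _ (smooth_is_derive sv _) (is_deriveN (is_derive_id u 1)).
have d1 := @is_derive1_comp _ p _ u _ _ (smooth_is_derive sp _) (is_deriveB (is_derive_cst t0 u 1) dN).
have d2 := @is_derive1_comp _ q _ u _ _ (smooth_is_derive sq _)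
  (is_deriveD (is_derive_cst t0 u 1) (smooth_is_derive sv u)).
have := is_deriveB (is_deriveD d1 d2) (is_derive_cst (p t0) u 1).
by congr is_derive; rewrite /= ?fctE /=; ring.
Qed.

End Splice.

(** * Rounding a corner *)

Section Rounding.
Variables (R : realType) (D : diagram R).
Local Notation plane := (R * R)%type.
Implicit Types (s t u r : R) (v : R -> R).

Variables (x1 y1 x2 y2 : R -> R) (t0 a b d d1 rho : R).
Hypotheses (sx1 : smooth x1) (sy1 : smooth y1) (sx2 : smooth x2) (sy2 : smooth y2).
Hypothesis N_gt0 : 0 < a ^+ 2 + b ^+ 2.
Hypotheses (d_gt0 : 0 < d) (d_lt : d < d1) (d1_small : d1 < 4^-1) (rho_gt0 : 0 < rho).
Hypothesis before : forall r, t0 - d1 <= r <= t0 -> D r = (x1 r, y1 r).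
Hypothesis after : forall r, t0 <= r <= t0 + d1 -> D r = (x2 r, y2 r).
Hypothesis forward1 : forall r, t0 - d1 <= r <= t0 + d1 -> 0 < a * derive1 x1 r + b * derive1 y1 r.
Hypothesis forward2 : forall r, t0 - d1 <= r <= t0 + d1 -> 0 < a * derive1 x2 r + b * derive1 y2 r.
Hypothesis quiet : forall t, `|t - t0| <= d1 -> ~ at_crossing D t.

Local Notation al := (along a b).
Local Notation ac := (across a b).

Let p1 r := al (x1 r, y1 r).
Let p2 r := al (x2 r, y2 r).
Let q1 r := ac (x1 r, y1 r).
Let q2 r := ac (x2 r, y2 r).

Hypothesis far : forall t, d1 <= `|centered (t - t0)| ->
  rho <= `|al (D t) - al (D t0)| + `|ac (D t) - ac (D t0)|.
Hypothesis near : forall r, t0 - d <= r <= t0 + d ->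
  [/\ `|al (x1 r, y1 r) - al (D t0)| < rho / 4, `|al (x2 r, y2 r) - al (D t0)| < rho / 4,
      `|ac (x1 r, y1 r) - ac (D t0)| < rho / 32 & `|ac (x2 r, y2 r) - ac (D t0)| < rho / 32].

Let corner1 : D t0 = (x1 t0, y1 t0).
Proof. by apply: before; move: d_gt0 d_lt => *; apply/andP; split; lra. Qed.
Let corner2 : D t0 = (x2 t0, y2 t0).
Proof. by apply: after; move: d_gt0 d_lt => *; apply/andP; split; lra. Qed.
Let cornerx : x1 t0 = x2 t0. Proof. by have := corner1; rewrite corner2 => -[]. Qed.
Let cornery : y1 t0 = y2 t0. Proof. by have := corner1; rewrite corner2 => -[]. Qed.
Let cornerp : p1 t0 = p2 t0. Proof. by rewrite /p1 /p2 cornerx cornery. Qed.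
Let cornerq : q1 t0 = q2 t0. Proof. by rewrite /q1 /q2 cornerx cornery. Qed.

Let slope (x y : R -> R) r : smooth x -> smooth y ->
  is_derive r 1 (fun r => al (x r, y r)) (a * derive1 x r + b * derive1 y r).
Proof.
move=> sx sy.
have := is_deriveD (is_deriveM (is_derive_cst a r 1) (smooth_is_derive sx r))
  (is_deriveM (is_derive_cst b r 1) (smooth_is_derive sy r)).
by congr is_derive; rewrite /GRing.scale /=; ring.
Qed.

Let increasing (x y : R -> R) : smooth x -> smooth y ->
  (forall r, t0 - d1 <= r <= t0 + d1 -> 0 < a * derive1 x r + b * derive1 y r) ->
  forall r r', t0 - d1 <= r -> r < r' -> r' <= t0 + d1 -> al (x r, y r) < al (x r', y r').
Proof.
move=> sx sy fw r r' tr rr rt.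
have [z] := mean_value (fun r => slope r sx sy) r r'.
rewrite min_l ?(ltW rr)// max_r ?(ltW rr)// => /andP[z1 z2] E.
rewrite -subr_gt0 E mulr_gt0 ?subr_gt0// fw//.
by rewrite (le_trans tr z1) (le_trans z2 rt).
Qed.

Let p1_inc := increasing sx1 sy1 forward1.
Let p2_inc := increasing sx2 sy2 forward2.

Let pt v u : plane := (splice x1 x2 t0 v u, splice y1 y2 t0 v u).
Let S v u := splice p1 p2 t0 v u.
Let Y v u := splice q1 q2 t0 v u.

Let along_pt v u : al (pt v u) = S v u.
Proof. by rewrite /S /pt /splice /p1 /p2 /along /=; ring. Qed.

Let across_pt v u : ac (pt v u) = Y v u.
Proof. by rewrite /Y /pt /splice /q1 /q2 /across /=; field; rewrite gt_eqF. Qed.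

Let sharp : R -> R := Num.max 0.
Let blunt u := d * bend (d^-1 * u).
Let csharp : cornering d sharp := corner_cornering d_gt0.
Let cblunt : cornering d blunt := bend_cornering d_gt0.

Let pt_sharp u : `|u| <= d1 -> D (t0 + u) = pt sharp u.
Proof.
rewrite ler_norml => /andP[u1 u2]; rewrite /pt /sharp; have [h|h] := leP u 0.
  rewrite before; last by apply/andP; split; lra.
  have e1 : Num.max 0 u = 0 by rewrite max_l.
  have e2 : Num.max 0 (- u) = - u by rewrite max_r// oppr_ge0.
  by rewrite !splice_before.
have e1 : Num.max 0 u = u by rewrite max_r// ltW.
have e2 : Num.max 0 (- u) = 0 by rewrite max_l// oppr_le0 ltW.
rewrite after; last by apply/andP; split; lra.
by rewrite !splice_after.
Qed.

Let at_end (T : Type) (F : R -> R -> T) u : d <= `|u| -> F (sharp (- u)) (sharp u) = F (blunt (- u)) (blunt u).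
Proof.
rewrite ler_normr => /orP[h|h].
  have h' : - u <= - d by rewrite lerN2.
  by rewrite !(cornering_high csharp h) !(cornering_high cblunt h) !(cornering_low csharp h') !(cornering_low cblunt h').
have h' : u <= - d by rewrite lerNr.
by rewrite !(cornering_high csharp h) !(cornering_high cblunt h) !(cornering_low csharp h') !(cornering_low cblunt h').
Qed.

Let pt_far u : d <= `|u| -> pt sharp u = pt blunt u.
Proof. exact: (@at_end _ (fun m n => (x1 (t0 - m) + x2 (t0 + n) - x1 t0, y1 (t0 - m) + y2 (t0 + n) - y1 t0))). Qed.

Let S_far u : d <= `|u| -> S sharp u = S blunt u.
Proof. exact: (@at_end _ (fun m n => p1 (t0 - m) + p2 (t0 + n) - p1 t0)). Qed.

Let Y_far u : d <= `|u| -> Y sharp u = Y blunt u.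
Proof. exact: (@at_end _ (fun m n => q1 (t0 - m) + q2 (t0 + n) - q1 t0)). Qed.

Let S_inc v : cornering d v -> forall u u', - d <= u -> u < u' -> u' <= d -> S v u < S v u'.
Proof.
move=> cv; apply: (splice_increasing cv) => r r' h1 h2 h3; [apply: p1_inc|apply: p2_inc] => //;
  move: d_lt => ?; lra.
Qed.

Let close v u : cornering d v -> `|u| <= d ->
  `|S v u - al (D t0)| < rho / 2 /\ `|Y v u - ac (D t0)| < rho / 16.
Proof.
move=> cv; rewrite ler_norml => /andP[u1 u2].
have /andP[a0 a1] := cornering_range cv u2.
have /andP[b0 b1'] : 0 <= v (- u) <= d by apply: (cornering_range cv); lra.
have [|e1 _ e3 _] := near (r := t0 - v (- u)); first by apply/andP; split; lra.
have [|_ e2 _ e4] := near (r := t0 + v u); first by apply/andP; split; lra.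
rewrite /S /Y /splice /p1 /p2 /q1 /q2 -corner1; move: e1 e2 e3 e4; rewrite !ltr_norml.
by move=> /andP[? ?] /andP[? ?] /andP[? ?] /andP[? ?]; split; apply/andP; split; lra.
Qed.

Let continuous_along_curve x y : smooth x -> smooth y -> continuous (fun r => al (x r, y r)).
Proof.
move=> sx sy r.
by apply: cvgD; (apply: cvgM; first exact: cvg_cst); [exact: smooth_continuous sx _|exact: smooth_continuous sy _].
Qed.

Let continuous_across_curve x y : smooth x -> smooth y -> continuous (fun r => ac (x r, y r)).
Proof.
move=> sx sy r; apply: cvgM; last exact: cvg_cst.
by apply: cvgB; (apply: cvgM; first exact: cvg_cst); [exact: smooth_continuous sy _|exact: smooth_continuous sx _].
Qed.

Let cS v : cornering d v -> continuous (S v).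
Proof.
by move=> cv; apply: continuous_splice; [exact: continuous_along_curve|exact: continuous_along_curve|exact: (cornering_continuous cv)].
Qed.

Let cY v : cornering d v -> continuous (Y v).
Proof.
by move=> cv; apply: continuous_splice; [exact: continuous_across_curve|exact: continuous_across_curve|exact: (cornering_continuous cv)].
Qed.

Let norm_d : `|d| = d. Proof. by rewrite gtr0_norm. Qed.
Let norm_Nd : `|- d| = d. Proof. by rewrite normrN gtr0_norm. Qed.

(** The linear function [along] increases on the corner and on its rounding, so that both
    are graphs over it. A shear takes one graph to the other, and points with the same
    value of [along] correspond to each other. The rest of the curve is too far from the
    corner, or over other values of [along], to be moved. *)
Lemma corner_isotopy : exists (H : R -> plane -> plane) (phi psi : R -> R),
  [/\ ambient_isotopy H, local_shift d phi, local_shift d psi,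
      (forall u, `|u| <= d -> psi (phi u) = u) /\ (forall u, `|u| <= d -> phi (psi u) = u) &
      forall t, H 1 (D t) =
        if `|centered (t - t0)| <= d then pt blunt (phi (centered (t - t0))) else D t].
Proof.
have [g1 [cg1 r1 gS1 Sg1 [lo1 hi1]]] := clamped_inverse d_gt0 (cS csharp) (S_inc csharp).
have [g2 [cg2 r2 gS2 Sg2 [lo2 hi2]]] := clamped_inverse d_gt0 (cS cblunt) (S_inc cblunt).
have Ed : S sharp d = S blunt d by apply: S_far; rewrite norm_d.
have ENd : S sharp (- d) = S blunt (- d) by apply: S_far; rewrite norm_Nd.
have gd (g : R -> R) s : (forall s, - d <= g s <= d) -> `|g s| <= d by move=> rg; rewrite ler_norml.
pose h s := Y sharp (g1 s); pose w s := Y blunt (g2 s) - Y sharp (g1 s).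
have ch : continuous h.
  by move=> s; apply: (@cvg_comp _ _ _ g1 (Y sharp)); [exact: cg1|exact: (cY csharp)].
have cw : continuous w.
  move=> s; apply: cvgB; last exact: ch.
  by apply: (@cvg_comp _ _ _ g2 (Y blunt)); [exact: cg2|exact: (cY cblunt)].
have W0 : 0 < rho / 4 by rewrite divr_gt0.
have w_small s : `|w s| <= rho / 4 / 2.
  have [_] := close csharp (gd g1 s r1); have [_] := close cblunt (gd g2 s r2).
  rewrite !ltr_norml ler_norml /w => /andP[? ?] /andP[? ?]; apply/andP; split; lra.
have h_close s : `|h s - ac (D t0)| < rho / 16 by have [_] := close csharp (gd g1 s r1).
have w_out s : s <= S sharp (- d) \/ S sharp d <= s -> w s = 0.
  move=> [hs|hs]; rewrite /w.
    by rewrite lo1// lo2 -?ENd// Y_far ?subrr ?norm_Nd.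
  by rewrite hi1// hi2 -?Ed// Y_far ?subrr ?norm_d.
pose phi u := g2 (S sharp (clamp d u)) + (u - clamp d u).
pose psi u := g1 (S blunt (clamp d u)) + (u - clamp d u).
have clampd u : `|u| <= d -> clamp d u = u by rewrite ler_norml => /clamp_id.
have le_S v u : cornering d v -> `|u| <= d -> S v (- d) <= S v u <= S v d.
  move=> cv; rewrite ler_norml => /andP[u1 u2]; apply/andP; split.
    by move: u1; rewrite le_eqVlt => /predU1P[->//|u1]; apply/ltW/S_inc.
  by move: u2; rewrite le_eqVlt => /predU1P[->//|u2]; apply/ltW/S_inc.
have shift_of (v : R -> R) (g : R -> R) : cornering d v -> continuous g -> (forall s, - d <= g s <= d) ->
    g (S v d) = d -> g (S v (- d)) = - d -> local_shift d (fun u => g (S v (clamp d u)) + (u - clamp d u)).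
  move=> cv cg rg ed end_; split.
  - move=> u; have cc := @continuous_clamp R d u.
    apply: cvgD; last by apply: cvgB; [exact: cvg_id|exact: cc].
    apply: (@cvg_comp _ _ _ (fun u => S v (clamp d u)) g); last exact: cg.
    by apply: (@cvg_comp _ _ _ (clamp d) (S v)); [exact: cc|exact: cS].
  - move=> u; rewrite ler_normr => /orP[hu|hu].
      by rewrite (clamp_high d_gt0 hu) ed addrC subrK.
    have hu' : u <= - d by rewrite lerNr.
    by rewrite (clamp_low d_gt0 hu') end_ addrC subrK.
  - by move=> u ud; rewrite clampd// subrr addr0; exact: gd.
have lphi : local_shift d phi.
  by apply: shift_of => //; rewrite ?Ed ?ENd ?gS2//; apply/andP; move: d_gt0 => *; split; lra.
have lpsi : local_shift d psi.
  by apply: shift_of => //; rewrite -?Ed -?ENd ?gS1//; apply/andP; move: d_gt0 => *; split; lra.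
have phiE u : `|u| <= d -> phi u = g2 (S sharp u) by move=> ud; rewrite /phi clampd// subrr addr0.
have psiE u : `|u| <= d -> psi u = g1 (S blunt u) by move=> ud; rewrite /psi clampd// subrr addr0.
exists (shear a b h w (rho / 4)), phi, psi; split=> //.
- exact: shear_isotopy.
- split=> u ud.
    rewrite phiE// psiE ?gd// Sg2 ?gS1//; first by rewrite -ler_norml.
    by rewrite -Ed -ENd; exact: le_S.
  rewrite psiE// phiE ?gd// Sg1 ?gS2//; first by rewrite -ler_norml.
  by rewrite Ed ENd; exact: le_S.
move=> t; set u := centered (t - t0).
have Dt : D t = D (t0 + u).
  apply: periodic_same; first exact: curve_periodic.
  have := same_pointD t0 (same_point_sym (centered_same (t - t0))).
  by rewrite subrK addrC.
have still : w (al (D t)) * tent (rho / 4) (ac (D t) - h (al (D t))) = 0 ->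
    shear a b h w (rho / 4) 1 (D t) = D t.
  by rewrite /shear /displacement mul1r => ->; rewrite /push !mul0r subr0 addr0; case: (D t).
have [ud|ud] := leP `|u| d.
  have E : D t = pt sharp u by rewrite Dt pt_sharp// (le_trans ud)// ltW.
  apply: (coordinates_inj N_gt0).
    rewrite /shear along_push E !along_pt phiE// Sg2//.
    by rewrite -Ed -ENd; exact: le_S.
  rewrite /shear across_push// E !across_pt /displacement along_pt across_pt.
  have hE : h (S sharp u) = Y sharp u by rewrite /h gS1// -ler_norml.
  rewrite hE subrr tent0 mul1r mulr1 /w gS1; last by rewrite -ler_norml.
  by rewrite phiE// addrC subrK.
apply: still; have [ud1|ud1] := leP `|u| d1.
  rewrite w_out ?mul0r//; rewrite Dt.
  move: ud ud1; rewrite ltr_normr ler_norml => /orP[hu|hu] /andP[u1 u2].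
    right; rewrite after; last by apply/andP; move: d_gt0 => *; split; lra.
    rewrite /S splice_after; [|exact: (cornering_high csharp)|by apply: (cornering_low csharp)].
    by apply/ltW/p2_inc; move: d_gt0 d_lt => *; lra.
  left; rewrite before; last by apply/andP; move: d_gt0 => *; split; lra.
  rewrite /S splice_before//; [|exact: (cornering_low csharp)|by rewrite opprK; exact: (cornering_high csharp)].
  by apply/ltW/p1_inc; move: d_gt0 d_lt => *; lra.
have := far (ltW ud1); have [hs|hs] := leP (rho / 2) `|al (D t) - al (D t0)|.
  move=> _; rewrite w_out ?mul0r//.
  have nd : `|d| <= d by rewrite norm_d.
  have nNd : `|- d| <= d by rewrite norm_Nd.
  have [+ _] := close csharp nd; have [+ _] := close csharp nNd.
  rewrite !ltr_norml => /andP[? ?] /andP[? ?].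
  by move: hs; rewrite ler_normr => /orP[hs|hs]; [right|left]; lra.
move=> hr; rewrite tent_far ?mulr0//.
have := h_close (al (D t)); rewrite ltr_norml => /andP[c1 c2].
have {}hr : rho / 2 <= `|ac (D t) - ac (D t0)| by lra.
by move: hr; rewrite !ler_normr => /orP[hr|hr]; apply/orP; [left|right]; lra.
Qed.

Let cv t : plane :=
  if `|centered (t - t0)| <= d then pt blunt (centered (t - t0)) else D t.

Let per := curve_periodic D.

Let D_centered t : D t = D (t0 + centered (t - t0)).
Proof.
apply: periodic_same per _.
have := same_pointD t0 (same_point_sym (centered_same (t - t0))).
by rewrite subrK addrC.
Qed.

Let cv_periodic t : cv (t + 1) = cv t.
Proof. by rewrite /cv (_ : t + 1 - t0 = t - t0 + 1) ?centered_periodic ?per//; ring. Qed.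

Let cv_inside t : `|centered (t - t0)| <= d1 -> cv t = pt blunt (centered (t - t0)).
Proof.
move=> ud; rewrite /cv; case: leP => // h.
by rewrite D_centered pt_sharp// pt_far// ltW.
Qed.

Let cv_outside t : d < `|centered (t - t0)| -> \forall t' \near t, D t' = cv t'.
Proof.
move=> h; have n : \forall t' \near t, d < `|centered (t' - t0)|.
  exact: (@continuous_shift_near _ t0 t _ (centered_far_near h)).
near=> t'; rewrite /cv leNgt ifN// negbK; near: t'; exact: n.
Unshelve. all: by end_near. Qed.

Let smooth_blunt : smooth blunt.
Proof.
apply: smoothM; first exact: smooth_cst.
apply: (@smooth_comp _ (@bend R)); first exact: smooth_bend.
by apply: smoothM; [exact: smooth_cst|exact: smooth_id].
Qed.

Let derive1_blunt u : derive1 blunt u = derive1 (@bend R) (d^-1 * u).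
Proof.
have dl : is_derive u 1 (fun u => d^-1 * u) d^-1.
  have := is_deriveM (is_derive_cst d^-1 u 1) (is_derive_id u 1).
  by congr is_derive; rewrite /GRing.scale /=; ring.
have H := is_deriveM (is_derive_cst d u 1)
  (@is_derive1_comp _ (@bend R) _ u _ _ (smooth_is_derive (@smooth_bend R) _) dl).
rewrite derive1E (_ : blunt = cst d * (fun u => bend (d^-1 * u)))// (@derive_val _ _ _ _ _ _ _ H).
by rewrite /GRing.scale /=; field; rewrite gt_eqF.
Qed.

(** The velocity is a combination of the velocities of the two branches with nonnegative
    coefficients, not both zero, and [along] is positive on both. *)
Let smooth_inside t : `|centered (t - t0)| < d1 -> smooth_at cv t.
Proof.
move=> ud; set u := centered (t - t0).
have shifted p q : smooth p -> smooth q -> smooth (fun r => splice p q t0 blunt (u + (r - t))).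
  move=> sp sq; apply: (@smooth_comp _ (splice p q t0 blunt)); first exact: smooth_splice.
  by apply: smoothD; [exact: smooth_cst|apply: smoothB; [exact: smooth_id|exact: smooth_cst]].
have slope_at p q : smooth p -> smooth q -> derive1 (fun r => splice p q t0 blunt (u + (r - t))) t =
    derive1 p (t0 - blunt (- u)) * derive1 blunt (- u) + derive1 q (t0 + blunt u) * derive1 blunt u.
  move=> sp sq.
  have dl : is_derive t 1 (fun r => u + (r - t)) 1.
    have := is_deriveD (is_derive_cst u t 1) (is_deriveB (is_derive_id t 1) (is_derive_cst t t 1)).
    by congr is_derive; ring.
  have H := @is_derive1_comp _ (splice p q t0 blunt) _ t _ _
    (is_derive_splice t0 (u + (t - t)) sp sq smooth_blunt) dl.
  by rewrite derive1E (@derive_val _ _ _ _ _ _ _ H) subrr addr0 mulr1.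
apply: (smooth_at_intro (shifted _ _ sx1 sx2) (shifted _ _ sy1 sy2)).
  have n : \forall t' \near t, centered (t' - t0) = u + (t' - t0 - (t - t0)).
    apply: (@continuous_shift_near _ t0 t _ (centered_near _)).
    by apply: lt_trans ud _; move: d1_small => ?; lra.
  have n2 : \forall t' \near t, `|t' - t| < d1 - `|u|.
    by apply/nbhs_ballP; exists (d1 - `|u|) => /=; [rewrite subr_gt0|move=> t'; rewrite /ball/= distrC].
  near=> t'.
  have E : centered (t' - t0) = u + (t' - t).
    rewrite (_ : t' - t = t' - t0 - (t - t0)); last by ring.
    by near: t'.
  have l : `|t' - t| < d1 - `|u| by near: t'.
  rewrite cv_inside E//; apply: le_trans (ler_normD _ _) _; lra.
rewrite /velocity !slope_at// => -[Ex Ey].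
have pos : 0 < a * (derive1 x1 (t0 - blunt (- u)) * derive1 blunt (- u) + derive1 x2 (t0 + blunt u) * derive1 blunt u) +
   b * (derive1 y1 (t0 - blunt (- u)) * derive1 blunt (- u) + derive1 y2 (t0 + blunt u) * derive1 blunt u).
  have ran w : `|w| < d1 -> 0 <= blunt w <= d1.
    rewrite ltr_norml => /andP[w1 w2]; have [h|h] := leP w d.
      by have /andP[-> /= h2] := cornering_range cblunt h; exact: le_trans h2 (ltW d_lt).
    by rewrite (cornering_high cblunt (ltW h)) (ltW w2) (le_trans (ltW d_gt0) (ltW h)).
  have Nud : `|- u| < d1 by rewrite normrN.
  have /andP[m0 m1] := ran _ Nud; have /andP[n0 n1] := ran _ ud.
  have f1 : 0 < a * derive1 x1 (t0 - blunt (- u)) + b * derive1 y1 (t0 - blunt (- u)).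
    by apply: forward1; apply/andP; split; lra.
  have f2 : 0 < a * derive1 x2 (t0 + blunt u) + b * derive1 y2 (t0 + blunt u).
    by apply: forward2; apply/andP; split; lra.
  rewrite (_ : _ + _ = (a * derive1 x1 (t0 - blunt (- u)) + b * derive1 y1 (t0 - blunt (- u))) * derive1 blunt (- u) +
    (a * derive1 x2 (t0 + blunt u) + b * derive1 y2 (t0 + blunt u)) * derive1 blunt u); last by ring.
  have gt w : - d < w -> 0 < derive1 blunt w.
    move=> dw; rewrite derive1_blunt; apply: derive1_bend_gt0.
    have e : d^-1 * - d = -1 by rewrite mulrN mulVf// gt_eqF.
    by rewrite -e ltr_pM2l ?invr_gt0.
  have ge w : 0 <= derive1 blunt w by rewrite derive1_blunt; exact: derive1_bend_ge0.
  have [h|h] := ltP (- d) u.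
    by apply: ltr_wpDl; [rewrite mulr_ge0 ?ge ?(ltW f1)|rewrite mulr_gt0 ?gt].
  apply: ltr_pwDl; last by rewrite mulr_ge0 ?ge ?(ltW f2).
  by rewrite mulr_gt0 ?gt//; move: d_gt0 => ?; lra.
by move: pos; rewrite Ex Ey !mulr0 addr0 ltxx.
Unshelve. all: by end_near. Qed.

Let smooth_cv t : smooth_at D t -> smooth_at cv t.
Proof.
move=> sm; have [h|h] := ltP d `|centered (t - t0)|.
  exact: smooth_at_near (cv_outside h) sm.
exact: (smooth_inside (le_lt_trans h d_lt)).
Qed.

Let cv_immersion : piecewise_smooth_immersion cv.
Proof.
have [_ imm fin] := curve_immersion D; split; first exact: cv_periodic.
- move=> t; have [h|h] := ltP d `|centered (t - t0)|.
    exact: immersed_at_near (cv_outside h) (imm t).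
  exact/smooth_at_immersed/smooth_inside/(le_lt_trans h d_lt).
- apply: sub_finite_set fin => t /= [t1 ns]; split=> // sm.
  by apply: ns; exact: smooth_cv.
Qed.

Let crossing_far t : at_crossing D t -> d < `|centered (t - t0)|.
Proof.
move=> cr; apply: lt_trans d_lt _; rewrite ltNge; apply/negP => h.
apply: (quiet (t := t0 + centered (t - t0))); first by rewrite addrAC subrr add0r.
apply: at_crossing_same cr.
have := same_pointD t0 (same_point_sym (centered_same (t - t0))).
by rewrite subrK addrC.
Qed.

(** The isotopy is a bijection of the plane that moves only points near the corner, where
    there is no crossing: crossings and levels are the same as before. *)
Lemma rounded : exists D' : diagram R,
  [/\ planar_isotopic D D', forall s t, crossing_pair D' s t <-> crossing_pair D s t,
      forall t, level D' t = level D t, forall t, smooth_at D t -> smooth_at D' t & smooth_at D' t0].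
Proof.
have [H [phi [psi [iso lphi lpsi [i1 i2] HE]]]] := corner_isotopy.
have d_half : d < 2^-1 by move: d_lt d1_small => *; lra.
pose f := twist t0 phi; pose f' := twist t0 psi.
have ff' : cancel f' f := twistK t0 d_half lpsi lphi i2.
have moved t : cv (f t) = H 1 (D t).
  rewrite HE; have [_ _ small] := lphi; case: leP => h.
    by rewrite /cv (centered_twist t0 d_half _ lphi) small.
  by rewrite /f (twist_far lphi (ltW h)) /cv leNgt h.
have Hinj p q : H 1 p = H 1 q -> p = q.
  have [_ hom _] := iso; have [|_ [g [_ gH _]]] := hom 1; first by rewrite ler01 lexx.
  exact: (can_inj gH).
have back t : cv t = H 1 (D (f' t)) by rewrite -moved ff'.
have same_back s t : same_point (f' s) (f' t) -> same_point s t.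
  by move=> /(twist_same t0 phi); rewrite -/f !ff'.
have fixed t : at_crossing D t -> f t = t by move=> /crossing_far h; exact: twist_far lphi (ltW h).
have sym (c : R -> plane) s t : crossing_pair c s t -> crossing_pair c t s.
  by move=> [n E]; split=> // /same_point_sym.
have crr s t : crossing_pair D s t -> at_crossing D t by move=> cr; exists s.
have crl s t : crossing_pair D s t -> at_crossing D s by move=> /sym/crr.
have crP s t : crossing_pair cv s t <-> crossing_pair D s t.
  split=> [[n]|[n E]].
    rewrite !back => /Hinj E; have cr : crossing_pair D (f' s) (f' t) by split=> // /same_back.
    have := fixed _ (crl _ _ cr); have := fixed _ (crr _ _ cr).
    by rewrite !ff' => -> ->.
  have cr : crossing_pair D s t by [].
  have := nbhs_singleton (cv_outside (crossing_far (crl _ _ cr))).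
  have := nbhs_singleton (cv_outside (crossing_far (crr _ _ cr))).
  by move=> /= E1 E2; split=> //; rewrite -E1 -E2.
have gen : generic cv.
  have [triple fin tr] := curve_generic D; split.
  - move=> r s t; rewrite !back => /Hinj E1 /Hinj E2.
    by have [/same_back|/same_back|/same_back] := triple _ _ _ E1 E2;
      [exact: Or31|exact: Or32|exact: Or33].
  - apply: sub_finite_set fin => t /= [t1 [s cr]]; split=> //; exists s; exact: (crP _ _).1 cr.
  - move=> s t /crP cr; have [sms smt v] := tr _ _ cr.
    have ns := cv_outside (crossing_far (crl _ _ cr)).
    have nt := cv_outside (crossing_far (crr _ _ cr)).
    split; [exact: smooth_cv|exact: smooth_cv|].
    by rewrite -(vel_near ns) -(vel_near nt).
have opp s t : crossing_pair cv s t -> level D t = other_passage (level D s).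
  by move=> /crP; exact: level_opposite.
exists (Diagram cv_immersion gen (level_periodic D) opp); split=> //.
- exists H, f; split=> //; first exact: (twist_homeo t0 d_half lphi lpsi).
  by move=> t /fixed ->.
- apply: smooth_inside; rewrite subrr (@centeredE _ _ 0).
  + by rewrite normr0 (lt_trans d_gt0).
  + exact: same_point_refl.
  + by rewrite normr0 invr_gt0.
Qed.

End Rounding.

Section Smoothing.
Variable R : realType.
Local Notation plane := (R * R)%type.
Implicit Types (D : diagram R) (s t u r : R).

Lemma immersed_continuous (c : R -> plane) t : immersed_at c t -> {for t, continuous c}.
Proof.
move=> [e [x1 [y1 [x2 [y2 [e0 [sx1 sy1 c1 _] [sx2 sy2 c2 _] _]]]]]].
have tI1 : t - e <= t <= t by apply/andP; split; lra.
have tI2 : t <= t <= t + e by apply/andP; split; lra.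
have [Ex Ey] : x1 t = x2 t /\ y1 t = y2 t by have := c1 _ tI1; rewrite (c2 _ tI2) => -[-> ->].
have n : \forall u \near t, c u = (x1 (Num.min u t) + x2 (Num.max u t) - x1 t, y1 (Num.min u t) + y2 (Num.max u t) - y1 t).
  apply: (segment_near e0) => u /andP[u1 u2]; have [h|h] := leP u t.
    by rewrite -Ex -Ey !addrK c1// h ltW.
  by rewrite [x1 t + _]addrC [y1 t + _]addrC !addrK c2// (ltW h) (ltW u2).
have cont f g : smooth f -> smooth g -> {for t, continuous (fun u => f (Num.min u t) + g (Num.max u t) - f t)}.
  move=> sf sg; apply: cvgB; last exact: cvg_cst.
  apply: cvgD.
    apply: (@cvg_comp _ _ _ (fun u => Num.min u t) f); last exact: smooth_continuous.
    by apply: (@continuous_min _ _ (fun u => u) (fun=> t)); [exact: cvg_id|exact: cvg_cst].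
  apply: (@cvg_comp _ _ _ (fun u => Num.max u t) g); last exact: smooth_continuous.
  by apply: (@continuous_max _ _ (fun u => u) (fun=> t)); [exact: cvg_id|exact: cvg_cst].
apply: continuous_near n _; exact: (cvg_pair (cont _ _ sx1 sx2) (cont _ _ sy1 sy2)).
Qed.

Lemma diagram_continuous D : continuous D.
Proof. by move=> t; have [_ imm _] := curve_immersion D; exact: immersed_continuous. Qed.

(** The scalar product with [v] serves if it is positive on [w]; otherwise a determinant
    against [v - w] does, unless [w] is a negative multiple of [v]. *)
Lemma positive_functional (v w : plane) : v <> (0, 0) -> w <> (0, 0) -> ~ opposite_directions v w ->
  exists a b, 0 < a * v.1 + b * v.2 /\ 0 < a * w.1 + b * w.2.
Proof.
case: v w => [v1 v2] [w1 w2] v0 w0 nop /=.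
have sq_pos (x y : R) : (x, y) <> (0, 0) -> 0 < x * x + y * y.
  move=> xy; rewrite lt_neqAle addr_ge0 ?andbT -?expr2 ?sqr_ge0//; apply/eqP => /esym/eqP.
  rewrite paddr_eq0 ?sqr_ge0// !sqrf_eq0 => /andP[/eqP Ex /eqP Ey].
  by apply: xy; rewrite Ex Ey.
have V := sq_pos _ _ v0; have [dot|dot] := ltP 0 (v1 * w1 + v2 * w2).
  by exists v1, v2.
have [det|det|det] := ltgtP 0 (v1 * w2 - v2 * w1).
- by exists (w2 - v2), (v1 - w1); split; lra.
- by exists (v2 - w2), (w1 - v1); split; lra.
case: nop; pose k := - (v1 * w1 + v2 * w2) / (v1 * v1 + v2 * v2).
have Vn : v1 * v1 + v2 * v2 != 0 by rewrite gt_eqF.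
have E1 : w1 = - (k * v1).
  apply: (mulfI Vn); rewrite /k.
  transitivity (v1 * (v1 * w1 + v2 * w2) - v2 * (v1 * w2 - v2 * w1)); first by ring.
  by rewrite -det; field.
have E2 : w2 = - (k * v2).
  apply: (mulfI Vn); rewrite /k.
  transitivity (v2 * (v1 * w1 + v2 * w2) + v1 * (v1 * w2 - v2 * w1)); first by ring.
  by rewrite -det; field.
exists k; last by rewrite /= -E1 -E2.
rewrite lt_neqAle divr_ge0 ?oppr_ge0 ?(ltW V)// andbT; apply/eqP => k0.
by apply: w0; rewrite E1 E2 -k0 !mul0r oppr0.
Qed.

(** The curve meets the corner only once, and the complementary arc is compact. *)
Lemma distance_from_corner D t0 a b d : 0 < a ^+ 2 + b ^+ 2 -> 0 < d -> ~ at_crossing D t0 ->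
  exists2 rho, 0 < rho & forall t, d <= `|centered (t - t0)| ->
    rho <= `|along a b (D t) - along a b (D t0)| + `|across a b (D t) - across a b (D t0)|.
Proof.
move=> N0 d0 ncr.
pose N t := `|along a b (D t) - along a b (D t0)| + `|across a b (D t) - across a b (D t0)|.
have cN : continuous N.
  move=> t; have cD := @diagram_continuous D t.
  apply: cvgD; apply: cvg_norm; apply: cvgB; try exact: cvg_cst.
    exact: (@cvg_comp _ _ _ D (along a b) _ _ _ cD (@continuous_along _ _ _ _)).
  exact: (@cvg_comp _ _ _ D (across a b) _ _ _ cD (@continuous_across _ _ _ _)).
have [|rho rho0 rhoP] := @thin_cover R R _ (fun e t => e <= N t) (@segment_compact R (t0 + d) (t0 + 1 - d)).
  move=> t /=; rewrite in_itv /= => /andP[t1 t2].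
  have Nt : 0 < N t.
    rewrite lt_neqAle addr_ge0// andbT; apply/eqP => /esym/eqP.
    rewrite paddr_eq0// !normr_eq0 !subr_eq0 => /andP[/eqP E1 /eqP E2].
    have E := coordinates_inj N0 E1 E2; apply: ncr; exists t; split=> // tt.
    have := same_point_lt1 tt (_ : `|t - t0| < 1); rewrite ltr_norml => H.
    by have := H (_ : -1 < t - t0 < 1); lra.
  exists (N t / 2); first by rewrite divr_gt0.
  have n : \forall t' \near t, N t / 2 < N t'.
    by apply: (cvgr_gt _ (cN t)); lra.
  by near=> t' => e /andP[_ h]; apply/ltW/(lt_trans h); near: t'.
exists rho => // t dt; set u := centered (t - t0) in dt.
have tu : same_point t (t0 + u).
  have := same_pointD t0 (same_point_sym (centered_same (t - t0))).
  by rewrite subrK addrC.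
have := centered_bound (t - t0); rewrite -/u => /andP[u1 u2].
have [r [r1 r2 tr]] : exists r, [/\ t0 + d <= r, r <= t0 + 1 - d & same_point t r].
  move: dt; rewrite ler_normr => /orP[h|h].
    by exists (t0 + u); split=> //; lra.
  exists (t0 + u + 1); split; [lra|lra|].
  by apply: (same_point_trans tu); apply/same_point_sym; exact: (same_pointDz (t0 + u) 1).
rewrite (periodic_same (curve_periodic D) tr); apply: (rhoP rho r); first by rewrite rho0 lexx.
by rewrite /= in_itv /= r1 r2.
Unshelve. all: by end_near. Qed.

Lemma round_corner D t0 : ~ at_crossing D t0 -> exists D' : diagram R,
  [/\ planar_isotopic D D', forall s t, crossing_pair D' s t <-> crossing_pair D s t,
      forall t, level D' t = level D t, forall t, smooth_at D t -> smooth_at D' t & smooth_at D' t0].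
Proof.
move=> ncr; have [_ imm _] := curve_immersion D.
have [e [x1 [y1 [x2 [y2 [e0 [sx1 sy1 c1 v1] [sx2 sy2 c2 v2] nop]]]]]] := imm t0.
have tI1 : t0 - e <= t0 <= t0 by apply/andP; split; lra.
have tI2 : t0 <= t0 <= t0 + e by apply/andP; split; lra.
have [a [b [fw1 fw2]]] := positive_functional (v1 _ tI1) (v2 _ tI2) nop.
have N0 : 0 < a ^+ 2 + b ^+ 2.
  rewrite lt_neqAle addr_ge0 ?sqr_ge0// andbT; apply/eqP => /esym/eqP.
  rewrite paddr_eq0 ?sqr_ge0// !sqrf_eq0 => /andP[/eqP Ea /eqP Eb].
  by move: fw1; rewrite Ea Eb !mul0r addr0 ltxx.
have forward x y : smooth x -> smooth y -> 0 < a * derive1 x t0 + b * derive1 y t0 ->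
    \forall r \near t0, 0 < a * derive1 x r + b * derive1 y r.
  move=> sx sy fw.
  have cf : {for t0, continuous (fun r => a * derive1 x r + b * derive1 y r)}.
    apply: cvgD; apply: cvgM; try exact: cvg_cst.
      exact: (@smooth_continuous _ _ (smooth_derive1 sx) t0).
    exact: (@smooth_continuous _ _ (smooth_derive1 sy) t0).
  exact: (cvgr_gt _ cf _ fw).
have [r1 r10 fwd1] := near_segment (forward _ _ sx1 sy1 fw1).
have [r2 r20 fwd2] := near_segment (forward _ _ sx2 sy2 fw2).
have [q q0 iso] := crossing_isolated D t0.
pose d1 := Num.min (Num.min e q) (Num.min (Num.min r1 r2) 4^-1) / 2.
have mn : 0 < Num.min (Num.min e q) (Num.min (Num.min r1 r2) (4^-1 : R)).
  by rewrite !lt_min e0 q0 r10 r20 invr_gt0 ltr0n.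
have d10 : 0 < d1 by rewrite divr_gt0.
have [[le1 le2] le3 le4 le5] : [/\ 2 * d1 <= e /\ 2 * d1 <= q, 2 * d1 <= r1, 2 * d1 <= r2 & 2 * d1 <= 4^-1].
  by rewrite /d1 mulrCA divff ?mulr1//; split; rewrite ?ge_min ?lexx ?orbT//; split; rewrite !ge_min lexx ?orbT.
have [rho rho0 far] := distance_from_corner N0 d10 ncr.
have D1 := c1 _ tI1; have D2 := c2 _ tI2.
have close (f : R -> R) : continuous f -> forall h, 0 < h -> \forall r \near t0, `|f r - f t0| < h.
  move=> cf h h0; have /cvgrPdist_lt/(_ _ h0) n := cf t0.
  by near=> r; rewrite distrC; near: r; exact: n.
have ca x y : smooth x -> smooth y -> continuous (fun r => along a b (x r, y r)).
  move=> sx sy r; apply: cvgD; (apply: cvgM; first exact: cvg_cst); [exact: smooth_continuous sx _|exact: smooth_continuous sy _].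
have cc x y : smooth x -> smooth y -> continuous (fun r => across a b (x r, y r)).
  move=> sx sy r; apply: cvgM; last exact: cvg_cst.
  by apply: cvgB; (apply: cvgM; first exact: cvg_cst); [exact: smooth_continuous sy _|exact: smooth_continuous sx _].
have rho4 : 0 < rho / 4 by rewrite divr_gt0.
have rho32 : 0 < rho / 32 by rewrite divr_gt0.
have [d' d'0 near] : exists2 d', 0 < d' & forall r, t0 - d' <= r <= t0 + d' ->
    [/\ `|along a b (x1 r, y1 r) - along a b (D t0)| < rho / 4,
        `|along a b (x2 r, y2 r) - along a b (D t0)| < rho / 4,
        `|across a b (x1 r, y1 r) - across a b (D t0)| < rho / 32 &
        `|across a b (x2 r, y2 r) - across a b (D t0)| < rho / 32].
  have n1 := close _ (ca _ _ sx1 sy1) _ rho4; have n2 := close _ (ca _ _ sx2 sy2) _ rho4.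
  have n3 := close _ (cc _ _ sx1 sy1) _ rho32; have n4 := close _ (cc _ _ sx2 sy2) _ rho32.
  rewrite -D1 in n1 n3; rewrite -D2 in n2 n4.
  by apply: near_segment; near=> r; split; near: r.
have m0 : 0 < Num.min d' (d1 / 2) by rewrite lt_min d'0 divr_gt0.
have m1 : Num.min d' (d1 / 2) <= d' by rewrite ge_min lexx.
have m2 : Num.min d' (d1 / 2) <= d1 / 2 by rewrite ge_min lexx orbT.
clear mn; clearbody d1.
apply: (@rounded R D x1 y1 x2 y2 t0 a b (Num.min d' (d1 / 2)) d1 rho) => //.
- lra.
- lra.
- by move=> r /andP[? ?]; apply: c1; apply/andP; clear near far; split; lra.
- by move=> r /andP[? ?]; apply: c2; apply/andP; clear near far; split; lra.
- by move=> r /andP[? ?]; apply: fwd1; apply/andP; clear near far; split; lra.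
- by move=> r /andP[? ?]; apply: fwd2; apply/andP; clear near far; split; lra.
- move=> t td cr; have E : t = t0 by apply: iso cr; lra.
  by rewrite E in cr.
- by move=> r /andP[? ?]; apply: near; apply/andP; split; lra.
Unshelve. all: by end_near. Qed.

Lemma smooth_at_shift (c : R -> plane) t : (forall t, c (t + 1) = c t) -> smooth_at c t ->
  forall k : int, smooth_at c (t + k%:~R).
Proof.
move=> per /smooth_at_regular[x [y [sx sy cE v0]]] k.
have sub f : smooth f -> smooth (fun r => f (r - k%:~R)).
  move=> sf; apply: (@smooth_comp _ f); first exact: sf.
  by apply: smoothB; [exact: smooth_id|exact: smooth_cst].
have dsub f r : smooth f -> derive1 (fun r => f (r - k%:~R)) r = derive1 f (r - k%:~R).
  move=> sf; have H := @is_derive1_comp _ f _ r _ _ (smooth_is_derive sf _)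
    (is_deriveB (is_derive_id r 1) (is_derive_cst (k%:~R : R) r 1)).
  by rewrite derive1E (@derive_val _ _ _ _ _ _ _ H) subr0 mulr1.
apply: (smooth_at_intro (sub _ sx) (sub _ sy)); last first.
  by rewrite /velocity !dsub// addrK.
have [e e0 eP] := near_segment cE.
apply: (segment_near e0) => u /andP[u1 u2].
have := eP (u - k%:~R); rewrite -[c (u - _)](periodic_int per _ k) subrK; apply.
by apply/andP; split; lra.
Qed.

(** There are finitely many corners, none at a crossing; they are rounded one by one. *)
Lemma smooth_representative D : exists D' : diagram R, [/\ equivalent D D', forall t, smooth_at D' t,
  forall s t, crossing_pair D' s t <-> crossing_pair D s t & forall t, level D' t = level D t].
Proof.
have [_ _ /finite_seqP[ts tsE]] := curve_immersion D.
have sharp t : ~ smooth_at D t -> exists2 t', t' \in ts & same_point t t'.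
  move=> ns; have tf : same_point t (fracpart t).
    by apply/same_pointP; exists (Num.floor t); rewrite /fracpart subrK.
  exists (fracpart t) => //; have : [set` ts] (fracpart t); last by [].
  rewrite -tsE; split.
    have /andP[] := floor_itv t; rewrite intrD /fracpart => *.
    by apply/andP; split; lra.
  move=> sm; apply: ns; have [k ->] := (same_pointP _ _).1 tf.
  by apply: smooth_at_shift sm k; exact: curve_periodic.
elim: ts D sharp {tsE} => [|p ts IH] D sharp.
  by exists D; split=> //; [exact: rst_refl|move=> t; apply: contrapT => /sharp[]].
have drop (D' : diagram R) : (forall t, smooth_at D t -> smooth_at D' t) -> smooth_at D' p ->
    forall t, ~ smooth_at D' t -> exists2 t', t' \in ts & same_point t t'.
  move=> keep sp t ns; have [|t' t'I tt] := sharp t; first by move=> /keep.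
  move: t'I; rewrite inE => /orP[/eqP E|t'I]; last by exists t'.
  case: ns; rewrite E in tt; have [k ->] := (same_pointP _ _).1 tt.
  by apply: smooth_at_shift sp k; exact: curve_periodic.
have [sp|nsp] := pselect (smooth_at D p); first exact: (IH D (drop D (fun _ => id) sp)).
have ncr : ~ at_crossing D p.
  by move=> [s cr]; have [_ _ tr] := curve_generic D; have [_ sm _] := tr _ _ cr.
have [D1 [iso cr1 lv1 keep sp]] := round_corner ncr.
have [D2 [eq2 sm2 cr2 lv2]] := IH D1 (drop D1 keep sp).
exists D2; split=> //.
- by apply: rst_trans eq2; apply: rst_step; exact: Or41.
- by move=> s t; rewrite cr2.
- by move=> t; rewrite lv2.
Qed.

End Smoothing.

(** * Exchanging adjacent crossings *)

Section Exchange.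
Variables (R : realType) (D : diagram R).
Hypothesis D_smooth : forall t, smooth_at D t.
Implicit Types (s t p q z eps : R).

Definition linked p q s t : Prop :=
  same_point s p /\ same_point t q \/ same_point s q /\ same_point t p.

Definition near_point eps z s : Prop := exists2 u, `|u - z| < eps & same_point s u.

Lemma crossing_sym (c : R -> R * R) s t : crossing_pair c s t -> crossing_pair c t s.
Proof. by move=> [n E]; split=> // /same_point_sym. Qed.

Lemma near_self eps z s : 0 < eps -> same_point s z -> near_point eps z s.
Proof. by move=> e0 sz; exists z; rewrite ?subrr ?normr0. Qed.

(** Either strand can be pushed over the other crossing, and the condition on levels holds
    for at least one of the two choices. New crossings are close to both [x'] and [y']. *)
Lemma exchange x y x' y' eps : crossing_pair D y y' -> crossing_pair D x x' ->
  D y <> D x -> y < x < y + 1 -> (forall t, y < t < x -> ~ at_crossing D t) -> 0 < eps ->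
  exists (D' : diagram R) p q, [/\ equivalent D D', forall t, smooth_at D' t &
    [/\ y - eps < p, p < q & q < x + eps] /\
    [/\ crossing_pair D' p x',
     forall s t, crossing_pair D' s t ->
      [\/ crossing_pair D s t, linked p x' s t, linked q y' s t |
          near_point eps x' s /\ near_point eps y' t \/ near_point eps y' s /\ near_point eps x' t] &
     forall s, at_crossing D' s ->
      [\/ same_point s p \/ same_point s q,
          [/\ at_crossing D s, ~ same_point s x & ~ same_point s y] |
          near_point eps x' s \/ near_point eps y' s]]].
Proof.
move=> cy cx Dyx /andP[yx x1] empty eps0.
have [lv|lv] := pselect (level D x' = Virtual \/ level D y' <> Virtual).
  have short : `|x - y| < 1 by rewrite gtr0_norm ?subr_gt0// ltrBlDl.
  have gap t : Num.min y x < t < Num.max y x -> ~ at_crossing D t.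
    by rewrite min_l ?max_r ?(ltW yx)//; exact: empty.
  have [D1 [p [eq1 pI _ cp crP]]] := slide D_smooth cy cx Dyx short gap eps0 lv.
  have [D2 [eq2 sm2 cr2 _]] := smooth_representative D1.
  have [p1 p2] : y - eps < p /\ p < y by case: pI => [[_ /andP[]]|[]] //; rewrite ltNge (ltW yx).
  exists D2, p, y; split; [exact: rst_trans eq1 eq2|exact: sm2|split; split].
  - exact: p1.
  - exact: p2.
  - by rewrite (lt_trans yx)// ltrDl.
  - exact/cr2.
  - move=> s t /cr2/crP[[H _ _]|H|H|[u [v [uy vx H]]]].
    + exact: Or41.
    + by apply: Or42; left.
    + by apply: Or42; right.
    + apply: Or44; case: H => -[H H']; [right|left]; split; by [exists u|exists v].
  - move=> t [s /cr2/crP[[H _ tx]|[_ H]|[_ H]|[u [v [uy vx H]]]]].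
    + have [ty|ty] := pselect (same_point t y); first by apply: Or31; right.
      by apply: Or32; split=> //; exists s.
    + by apply: Or33; left; exact: near_self.
    + by apply: Or31; left.
    + by apply: Or33; case: H => -[_ H]; [left; exists v|right; exists u].
(* The roles of the two strands are interchanged. *)
have {}lv : level D y' = Virtual \/ level D x' <> Virtual.
  by left; apply: contrapT => h; apply: lv; right.
have short : `|y - x| < 1 by rewrite distrC gtr0_norm ?subr_gt0// ltrBlDl.
have gap t : Num.min x y < t < Num.max x y -> ~ at_crossing D t.
  by rewrite min_r ?max_l ?(ltW yx)//; exact: empty.
have [D1 [q [eq1 qI cp _ crP]]] := slide D_smooth cx cy (nesym Dyx) short gap eps0 lv.
have [D2 [eq2 sm2 cr2 _]] := smooth_representative D1.
have [q1 q2] : x < q /\ q < x + eps by case: qI => [[]|[_ /andP[]]] //; rewrite ltNge (ltW yx).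
exists D2, x, q; split; [exact: rst_trans eq1 eq2|exact: sm2|split; split].
- by rewrite (lt_trans _ yx)// ltrBlDr ltrDl.
- exact: q1.
- exact: q2.
- exact/cr2.
- move=> s t /cr2/crP[[H _ _]|H|H|[u [v [ux vy H]]]].
  + exact: Or41.
  + by apply: Or43; left.
  + by apply: Or43; right.
  + apply: Or44; case: H => -[H H']; [left|right]; split; by [exists u|exists v].
- move=> t [s /cr2/crP[[H _ ty]|[_ H]|[_ H]|[u [v [ux vy H]]]]].
  + have [tx|tx] := pselect (same_point t x); first by apply: Or31; left.
    by apply: Or32; split=> //; exists s.
  + by apply: Or33; right; exact: near_self.
  + by apply: Or31; right.
  + by apply: Or33; case: H => -[_ H]; [right; exists v|left; exists u].
Qed.

End Exchange.

(** * Arcs without self-crossings *)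

Section Arcs.
Variable R : realType.
Implicit Types (D : diagram R) (s t u v w z a b : R) (bs : seq R).

Definition simple D a b : Prop :=
  forall s t, a <= s <= b -> a <= t <= b -> ~ crossing_pair D s t.

Fixpoint arcs D a bs : Prop :=
  if bs is b :: bs' then [/\ a < b, simple D a b, ~ at_crossing D b & arcs D b bs'] else True.

Lemma simple_sub D a b a' b' : a <= a' -> b' <= b -> simple D a b -> simple D a' b'.
Proof.
move=> aa bb sab s t /andP[s1 s2] /andP[t1 t2]; apply: sab; apply/andP; split;
  by [apply: le_trans aa _|apply: le_trans bb].
Qed.

Lemma arcs_le D a bs : arcs D a bs -> forall b, b \in a :: bs -> a <= b <= last a bs.
Proof.
elim: bs a => [|c bs IH] a /=; first by move=> _ b; rewrite inE => /eqP ->; rewrite lexx.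
move=> [ac _ _ /IH H] b; have /andP[_ cl] := H c (mem_head _ _).
rewrite inE => /orP[/eqP ->|/H/andP[cb ->]]; first by rewrite lexx (le_trans (ltW ac)).
by rewrite (le_trans (ltW ac)).
Qed.

Lemma arcs_noncrossing D a bs : arcs D a bs -> forall b, b \in bs -> ~ at_crossing D b.
Proof. by elim: bs a => //= c bs IH a [_ _ nc /IH H] b; rewrite inE => /orP[/eqP ->|/H]. Qed.

Lemma arcs_rcons D a bs b : arcs D a (rcons bs b) <->
  [/\ arcs D a bs, last a bs < b, simple D (last a bs) b & ~ at_crossing D b].
Proof.
elim: bs a => [|c bs IH] a /=; first by split=> [[]|[]].
split=> [[? ? ? /IH[]]|[[? ? ? ?] ? ? ?]] //; split=> //; exact/IH.
Qed.

Lemma arcs_keep D D' a bs :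
  (forall u v, u \in a :: bs -> v \in bs -> a <= u -> v <= last a bs -> simple D u v -> simple D' u v) ->
  (forall b, b \in bs -> ~ at_crossing D b -> ~ at_crossing D' b) ->
  arcs D a bs -> arcs D' a bs.
Proof.
elim: bs a => //= c bs IH a ks kc [ac sac nc acs]; have le := arcs_le acs.
have /andP[_ cl] := le c (mem_head _ _).
split=> //.
- by apply: ks sac => //; rewrite ?mem_head.
- by apply: kc nc; rewrite mem_head.
- apply: IH acs => [u v uI vI cu vl suv|b bI nb].
    by apply: ks suv => //; [rewrite inE uI orbT|rewrite inE vI orbT|exact: le_trans (ltW ac) cu].
  by apply: kc nb; rewrite inE bI orbT.
Qed.

(** A parameter that moves along the circle without meeting the ends of an arc stays in
    this arc. *)
Lemma arc_shift u v s w z : u <= s <= v -> same_point s w ->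
  (forall r, Num.min w z <= r <= Num.max w z -> ~ same_point u r /\ ~ same_point v r) ->
  exists2 s', u <= s' <= v & same_point s' z.
Proof.
move=> /andP[us sv] sw avoid; exists (s + (z - w)); last first.
  by have := same_pointD (z - w) sw; rewrite [w + _]addrC subrK.
have shifted e : same_point e (w + (e - s)).
  by have := same_pointD (e - s) sw; rewrite [s + _]addrC subrK.
rewrite !leNgt; apply/andP; split; apply/negP => h.
  have [|n _] := avoid (w + (u - s)); last exact: (n (shifted u)).
  by rewrite ge_min le_max; apply/andP; split; apply/orP; [right|left]; lra.
have [|_ n] := avoid (w + (v - s)); last exact: (n (shifted v)).
by rewrite ge_min le_max; apply/andP; split; apply/orP; [left|right]; lra.
Qed.

Lemma below_all (ds : seq R) : (forall d, d \in ds -> 0 < d) ->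
  exists2 e, 0 < e & forall d, d \in ds -> e <= d.
Proof.
elim: ds => [|d ds IH] pos; first by exists 1.
have [|e e0 eP] := IH; first by move=> x xd; apply: pos; rewrite inE xd orbT.
exists (Num.min d e); first by rewrite lt_min e0 pos ?mem_head.
by move=> x; rewrite inE ge_min => /orP[/eqP ->|/eP ->]; rewrite ?lexx ?orbT.
Qed.

Lemma same_point_gap b z w : same_point b w -> `|centered (b - z)| <= `|w - z|.
Proof.
move=> bw; rewrite leNgt; apply/negP => h.
have sp : same_point (b - z) (w - z) by exact: same_pointD.
have := centeredE sp (lt_le_trans h (centered_half _)) => E.
by rewrite E ltxx in h.
Qed.

Lemma gap_gt0 b z : ~ same_point b z -> 0 < `|centered (b - z)|.
Proof.
move=> n; rewrite normr_gt0; apply/eqP => E; apply: n.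
have := centered_same (b - z); rewrite E => /(same_pointD z).
by rewrite add0r subrK => /same_point_sym.
Qed.

Lemma crossing_between D a b t t' : crossing_pair D t t' -> ~ at_crossing D a -> ~ at_crossing D b ->
  a <= t <= b -> a < t < b.
Proof.
move=> cr na nb /andP[at_ tb]; rewrite !lt_neqAle at_ tb !andbT.
have ct : at_crossing D t by exists t'; exact: crossing_sym.
by apply/andP; split; apply/eqP => E; [apply: na; rewrite E|apply: nb; rewrite -E].
Qed.

Section Merge.

(** The first two arcs, from [t0] to [t1] and from [t1] to [t2], are those to be merged. *)
Record subdivision D t0 t1 t2 (mid : seq R) : Prop := Subdivision {
  cut_lt01 : t0 < t1 ; cut_lt12 : t1 < t2 ;
  cut_simple01 : simple D t0 t1 ; cut_simple12 : simple D t1 t2 ;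
  cut_nc0 : ~ at_crossing D t0 ; cut_nc1 : ~ at_crossing D t1 ; cut_nc2 : ~ at_crossing D t2 ;
  cut_arcs : arcs D t2 mid ;
  cut_last : last t2 mid < t0 + 1 ;
  cut_simple_last : simple D (last t2 mid) (t0 + 1)
}.

Definition meets_next D t0 t1 t2 t : Prop :=
  t0 <= t <= t1 /\ exists2 t', t1 <= t' <= t2 & crossing_pair D t t'.

(** The list may also contain parameters that are not crossings, so that it need not be
    updated exactly. *)
Definition covers D t0 t1 (l : seq R) : Prop :=
  forall t, t0 <= t <= t1 -> at_crossing D t -> t \in l.

Lemma cut_order D t0 t1 t2 mid : subdivision D t0 t1 t2 mid ->
  [/\ t0 < t1, t1 < t2, t2 <= last t2 mid & last t2 mid < t0 + 1].
Proof.
by case=> h1 h2 _ _ _ _ _ h3 h4 _; split=> //; have /andP[] := arcs_le h3 (mem_head t2 mid).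
Qed.

Lemma merge_disjoint D t0 t1 t2 mid l : subdivision D t0 t1 t2 mid -> covers D t0 t1 l ->
  (forall t, t \in l -> ~ meets_next D t0 t1 t2 t) -> arcs D t0 (t2 :: rcons mid (t0 + 1)).
Proof.
move=> C cov none; case: (C) => h1 h2 s1 s2 n0 n1 n2 h3 h4 s3; split.
- exact: lt_trans h1 h2.
- have no u v : t0 <= u <= t1 -> t1 <= v <= t2 -> ~ crossing_pair D u v.
    move=> uI vI cr; apply: (none u); first by apply: cov => //; exists v; exact: crossing_sym.
    by split=> //; exists v.
  move=> u v /andP[u0 u2] /andP[v0 v2] cr.
  have [hu|hu] := leP u t1; have [hv|hv] := leP v t1.
  + by apply: (s1 u v) => //; apply/andP.
  + by apply: (no u v) => //; apply/andP; split=> //; exact: ltW.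
  + by apply: (no v u); [apply/andP|apply/andP; split=> //; exact: ltW|exact: crossing_sym].
  + by apply: (s2 u v) => //; apply/andP; split=> //; exact: ltW.
- exact: n2.
- apply/arcs_rcons; split=> // cr; apply: n0; apply: at_crossing_same cr.
  exact: (same_pointDz t0 1).
Qed.

(** The common end of the first and the last arc moves past [x]. The last arc gains a
    crossing with the second arc, which is not a crossing with itself since there are at
    least three arcs. *)
Lemma shift_start D t0 t1 t2 mid x r : subdivision D t0 t1 t2 mid -> covers D t0 t1 (x :: r) ->
  sorted <%R (x :: r) -> meets_next D t0 t1 t2 x ->
  exists t0', subdivision D t0' t1 t2 mid /\ covers D t0' t1 r.
Proof.
move=> C cov srt [xI [x' x'I cx]].
have [h01 h12 h2l hl] := cut_order C.
have /andP[x0 x1] := crossing_between cx (cut_nc0 C) (cut_nc1 C) xI.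
have /andP[x'1 x'2] := crossing_between (crossing_sym cx) (cut_nc1 C) (cut_nc2 C) x'I.
have [y [xy y1 yr]] : exists y, [/\ x < y, y <= t1 & forall z, z \in r -> y <= z].
  have pw : forall z, z \in r -> x < z.
    by move=> z zr; have := order_path_min lt_trans srt => /allP/(_ z zr).
  case: r srt {cov} pw => [|y r] srt pw; first by exists t1.
  exists (Num.min y t1); rewrite lt_min x1 pw ?mem_head//; split=> //.
    by rewrite ge_min lexx orbT.
  move=> z; rewrite inE ge_min => /orP[/eqP ->|zr]; first by rewrite lexx.
  move: srt => /= /andP[_ srt]; have := order_path_min lt_trans srt => /allP/(_ z zr) /ltW ->.
  by [].
pose t0' := (x + y) / 2; have [l1 l2] : x < t0' /\ t0' < y by rewrite /t0'; split; lra.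
have only t : t0 <= t -> t <= t0' -> at_crossing D t -> t = x.
  move=> tt0 tt1 cr; have := cov t _ cr; rewrite inE => H.
  have /orP[/eqP //|/yr] : (t == x) || (t \in r) by apply: H; apply/andP; split; lra.
  by lra.
exists t0'; split; last first.
  move=> t /andP[tt0 tt1] cr; have := cov t _ cr; rewrite inE => H.
  have /orP[/eqP E|//] : (t == x) || (t \in r) by apply: H; apply/andP; split; lra.
  by lra.
have nc0 : ~ at_crossing D t0'.
  move=> cr; have tt0 : t0 <= t0' by lra.
  by have := only _ tt0 (lexx _) cr; lra.
case: (C) => _ _ s1 s2 n0 n1 n2 h3 h4 s3; split=> //.
- by lra.
- by apply: simple_sub s1; lra.
- by lra.
have key u v : last t2 mid <= u -> u <= t0' + 1 -> last t2 mid <= v -> v <= t0' + 1 -> t0 + 1 < u ->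
    ~ crossing_pair D u v.
  move=> ul u0 vl v0 ul0 cr.
  have uu : same_point (u - 1) u.
    by apply/same_point_sym; have := same_pointDz (u - 1) 1; rewrite subrK.
  have crx : u - 1 = x.
    apply: only; [lra|lra|]; apply: (at_crossing_same (same_point_sym uu)).
    by exists v; exact: crossing_sym.
  have [triple _ _] := curve_generic D; have [nuv Euv] := cr; have [nxx Exx] := cx.
  rewrite crx in uu; have Exu := periodic_same (curve_periodic D) uu.
  have Evx : D v = D x by rewrite Exu Euv.
  have [H|H|H] := triple v x x' Evx Exx.
  + by apply: nuv; exact: same_point_trans (same_point_sym uu) (same_point_sym H).
  + exact: nxx.
  + have e : `|v - x'| < 1 by rewrite ltr_norml; apply/andP; split; lra.
    by have := same_point_lt1 H e; lra.
move=> u v /andP[u1 u2] /andP[v1 v2] cr.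
have [hu|hu] := leP u (t0 + 1); last by apply: (key u v).
have [hv|hv] := leP v (t0 + 1); last by apply: (key v u) => //; exact: crossing_sym.
by apply: (s3 u v) => //; apply/andP.
Qed.

End Merge.
End Arcs.

(** * Merging arcs *)

Section Reduction.
Variable R : realType.
Implicit Types (D : diagram R) (s t u v w x y z a b : R) (bs mid l r : seq R).

Lemma between_interval (a b w z e : R) : a < w < b -> a < z < b ->
  Num.min w z <= e <= Num.max w z -> a < e < b.
Proof.
by move=> /andP[? ?] /andP[? ?]; case: (leP w z) => _ /andP[? ?]; apply/andP; split; lra.
Qed.

(** The arcs remain free of self-crossings: new crossings involve a strand of the second
    arc, near [x'], and one near [y'] which lies neither in the second arc, by assumption,
    nor in the first one. All displacements are smaller than the distance [eps] to the
    ends of the arcs and to other crossings of the first arc. *)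
Lemma exchange_crossings D (t0 t1 t2 : R) mid l y x r : (forall t, smooth_at D t) ->
  subdivision D t0 t1 t2 mid -> covers D t0 t1 (l ++ y :: x :: r) -> sorted <%R (l ++ y :: x :: r) ->
  meets_next D t0 t1 t2 x -> ~ meets_next D t0 t1 t2 y -> t0 <= y <= t1 -> at_crossing D y ->
  exists D' p q, [/\ equivalent D D', forall t, smooth_at D' t, subdivision D' t0 t1 t2 mid &
    [/\ covers D' t0 t1 (l ++ p :: q :: r), sorted <%R (l ++ p :: q :: r) & meets_next D' t0 t1 t2 p]].
Proof.
move=> sm C cov srt [xI [x' x'I cx]] ny yI [y' /crossing_sym cy].
have [h01 h12 h2l hl] := cut_order C.
have /andP[x0 x1] := crossing_between cx (cut_nc0 C) (cut_nc1 C) xI.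
have /andP[y0 y1] := crossing_between cy (cut_nc0 C) (cut_nc1 C) yI.
have /andP[x'1 x'2] := crossing_between (crossing_sym cx) (cut_nc1 C) (cut_nc2 C) x'I.
have [lr [pl [yx [yr [xr pr]]]]] : allrel <%R l (y :: x :: r) /\ pairwise <%R l /\ y < x /\
    all (<%R y) r /\ all (<%R x) r /\ pairwise <%R r.
  have : pairwise <%R (l ++ y :: x :: r) by rewrite -(sorted_pairwise lt_trans).
  by rewrite pairwise_cat => /and3P[-> -> /= /and3P[/andP[-> ->] -> ->]].
have ly z : z \in l -> z < y by move=> zl; apply: (allrelP lr) => //; rewrite mem_head.
have rx z : z \in r -> x < z by move=> zr; exact: (allP xr).
have per := curve_periodic D.
have Dyx : D y <> D x.
  move=> E; apply: (cut_simple01 C yI xI); split=> // H.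
  have e : `|y - x| < 1 by rewrite ltr_norml; apply/andP; split; lra.
  by have := same_point_lt1 H e; lra.
have empty t : y < t < x -> ~ at_crossing D t.
  move=> /andP[yt tx] cr; have : t \in l ++ y :: x :: r by apply: cov cr; apply/andP; split; lra.
  rewrite mem_cat !inE => /orP[/ly|/or3P[/eqP E|/eqP E|/rx]]; lra.
pose B := [:: t0, t1, t2 & rcons mid (t0 + 1)].
have nc1 : ~ at_crossing D (t0 + 1).
  by move=> cr; apply: (cut_nc0 C); apply: at_crossing_same cr; exact: (same_pointDz t0 1).
have Bmid b : b \in t2 :: rcons mid (t0 + 1) -> t2 <= b <= t0 + 1.
  rewrite inE mem_rcons inE => bI.
  have [->|bn] := eqVneq b (t0 + 1); first by apply/andP; split; lra.
  have bm : b \in t2 :: mid by rewrite inE; move: bI; rewrite (negbTE bn).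
  by have /andP[? ?] := arcs_le (cut_arcs C) bm; apply/andP; split; lra.
have Bnc b : b \in B -> ~ at_crossing D b.
  rewrite !inE => /or3P[/eqP ->|/eqP ->|/orP[/eqP ->|]];
    [exact: (cut_nc0 C)|exact: (cut_nc1 C)|exact: (cut_nc2 C)|].
  rewrite mem_rcons inE => /orP[/eqP ->//|]; exact: (arcs_noncrossing (cut_arcs C)).
have Bin b w : b \in B -> t0 < w < t1 -> ~ same_point b w.
  move=> bB /andP[w0 w1] bw.
  have bI : b = t0 \/ t1 <= b <= t0 + 1.
    move: bB; rewrite 2!inE => /or3P[/eqP ->|/eqP ->|/Bmid/andP[? ?]]; [by left|right|right];
      by apply/andP; split; lra.
  have e : `|b - w| < 1.
    by rewrite ltr_norml; case: bI => [->|/andP[? ?]]; apply/andP; split; lra.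
  by have := same_point_lt1 bw e; case: bI => [->|/andP[? ?]]; lra.
pose Z := [:: y; x; y'; x'].
have Zcr z : z \in Z -> at_crossing D z.
  rewrite !inE => /or4P[]/eqP ->; [exists y'|exists x'|exists y|exists x] => //; exact: crossing_sym.
have [yZ xZ y'Z x'Z] : [/\ y \in Z, x \in Z, y' \in Z & x' \in Z] by rewrite !inE !eqxx !orbT.
have t0B : t0 \in B by rewrite mem_head.
have t1B : t1 \in B by rewrite !inE eqxx orbT.
have t2B : t2 \in B by rewrite !inE eqxx !orbT.
have t3B : t0 + 1 \in B by rewrite !inE mem_rcons mem_head !orbT.
have midB b : b \in mid -> b \in B by move=> bm; rewrite !inE mem_rcons inE bm !orbT.
have lastB : last t2 mid \in B.
  by have := mem_last t2 mid; rewrite inE => /orP[/eqP ->|/midB].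
clearbody B Z.
(* Distances of [y] and [x] to the other listed parameters, and of the four crossing
   parameters to the ends of the arcs. *)
have [|eps eps0 epsP] := @below_all R ([seq y - z | z <- l] ++ [seq z - x | z <- r] ++
    [seq `|centered (b - z)| | b <- B, z <- Z]).
  move=> d; rewrite !mem_cat => /or3P[/mapP[z zl ->]|/mapP[z zr ->]|h].
  - by rewrite subr_gt0 ly.
  - by rewrite subr_gt0 rx.
  - have [[b z] /= [bB zZ ->]] := allpairsP h.
    by apply: gap_gt0 => bz; apply: (Bnc _ bB); apply: at_crossing_same (Zcr _ zZ); exact: same_point_sym.
have el z : z \in l -> z <= y - eps.
  by move=> zl; have := epsP (y - z); rewrite !mem_cat (map_f (fun z => y - z))//= => /(_ isT); lra.
have er z : z \in r -> x + eps <= z.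
  by move=> zr; have := epsP (z - x); rewrite !mem_cat (map_f (fun z => z - x))// orbT => /(_ isT); lra.
have eB b z w : b \in B -> z \in Z -> `|w - z| < eps -> ~ same_point b w.
  move=> bB zZ wz bw; have := epsP `|centered (b - z)|; rewrite !mem_cat.
  rewrite (allpairs_f (fun b z => `|centered (b - z)|))// !orbT => /(_ isT).
  by have := same_point_gap z bw; lra.
clear epsP.
have BJ b w : b \in B -> y - eps < w < x + eps -> ~ same_point b w.
  move=> bB /andP[w1 w2]; have [h|h] := ltP w y.
    by apply: (eB b y) => //; rewrite ltr_norml; clear -w1 w2 h eps0 yx; apply/andP; split; lra.
  have [h'|h'] := ltP x w.
    by apply: (eB b x) => //; rewrite ltr_norml; clear -w1 w2 h h' eps0 yx; apply/andP; split; lra.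
  by apply: Bin => //; rewrite (lt_le_trans y0 h) (le_lt_trans h' x1).
have inA w : y - eps < w < x + eps -> t0 < w < t1.
  move=> /andP[w1 w2]; rewrite !ltNge; apply/andP; split; apply/negP => h.
    by apply: (BJ t0 t0); [exact: t0B|clear -h w1 w2 y0 y1 yx x1 eps0; apply/andP; split; lra|exact: same_point_refl].
  by apply: (BJ t1 t1); [exact: t1B|clear -h w1 w2 y0 y1 yx x1 eps0; apply/andP; split; lra|exact: same_point_refl].
have x_close : y < x < y + 1.
  by rewrite yx /=; clear -x1 y0 h01 h12 h2l hl; lra.
have [D' [p [q [eqD smD [[p1 pq q2] [cp crP atP]]]]]] := exchange sm cy cx Dyx x_close empty eps0.
have pJ : y - eps < p < x + eps by rewrite p1 (lt_trans pq q2).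
have qJ : y - eps < q < x + eps by rewrite q2 (lt_trans p1 pq).
have xJ : y - eps < x < x + eps by clear -yx eps0; apply/andP; split; lra.
have yJ : y - eps < y < x + eps by clear -yx eps0; apply/andP; split; lra.
have slideJ u v s w z : u \in B -> v \in B -> u <= s <= v -> same_point s w ->
    y - eps < w < x + eps -> y - eps < z < x + eps -> exists2 s', u <= s' <= v & same_point s' z.
  move=> uB vB sI sw wJ zJ; apply: (arc_shift sI sw) => e eI.
  by have eJ := between_interval wJ zJ eI; split; exact: BJ.
have slideZ u v s z : u \in B -> v \in B -> u <= s <= v -> z \in Z -> near_point eps z s ->
    exists2 s', u <= s' <= v & same_point s' z.
  move=> uB vB sI zZ [w wz sw]; apply: (arc_shift sI sw) => e eI.
  have ez : `|e - z| < eps.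
    by apply: (@min_max_close _ w z) eI => //; rewrite subrr normr0.
  by split; apply: (eB _ z).
have move_pair u v t s' : u <= s' <= v -> u <= t <= v -> simple D u v ->
    forall a b, crossing_pair D a b -> same_point s' a -> same_point t b -> False.
  move=> s'I tI sD a b [nab Eab] sa tb; apply: (sD s' t) => //; split.
    move=> H; apply: nab; exact: same_point_trans (same_point_sym sa) (same_point_trans H tb).
  by rewrite (periodic_same per sa) (periodic_same per tb).
have keep u v : u \in B -> v \in B ->
    (forall w, u <= w <= v -> ~ same_point w x') \/ (forall w, u <= w <= v -> ~ same_point w y') ->
    simple D u v -> simple D' u v.
  move=> uB vB miss sD s t sI tI /crP[cr|lk|lk|nr].
  - exact: (sD s t).
  - have lk' a b : u <= a <= v -> u <= b <= v -> same_point a p -> same_point b x' -> False.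
      move=> aI bI ap bx; have [a' a'I ax] := slideJ _ _ _ _ x uB vB aI ap pJ xJ.
      exact: (move_pair _ _ _ _ a'I bI sD _ _ cx ax bx).
    by case: lk => -[]; [exact: lk'|move=> ? ?; exact: (lk' t s)].
  - have lk' a b : u <= a <= v -> u <= b <= v -> same_point a q -> same_point b y' -> False.
      move=> aI bI ap bx; have [a' a'I ax] := slideJ _ _ _ _ y uB vB aI ap qJ yJ.
      exact: (move_pair _ _ _ _ a'I bI sD _ _ cy ax bx).
    by case: lk => -[]; [exact: lk'|move=> ? ?; exact: (lk' t s)].
  - have near2 a b : u <= a <= v -> u <= b <= v -> near_point eps x' a -> near_point eps y' b -> False.
      move=> aI bI /(slideZ _ _ _ _ uB vB aI x'Z)[a' a'I ax] /(slideZ _ _ _ _ uB vB bI y'Z)[b' b'I bY].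
      by case: miss => m; [exact: (m a')|exact: (m b')].
    by case: nr => -[]; [exact: near2|move=> ? ?; exact: (near2 t s)].
have keep_nc b : b \in B -> ~ at_crossing D' b.
  move=> bB /atP[[H|H]|[H _ _]|[[w wx H]|[w wy H]]].
  - exact: (BJ b p).
  - exact: (BJ b q).
  - exact: (Bnc b).
  - exact: (eB b x' w) H.
  - exact: (eB b y' w) H.
have missA z z' w : t0 <= z <= t1 -> crossing_pair D z z' -> t0 <= w <= t1 -> ~ same_point w z'.
  move=> zI cz wI wz; apply: (move_pair _ _ w z zI wI (cut_simple01 C) _ _ cz) => //.
  exact: same_point_refl.
have missX w : t1 <= w <= t2 -> ~ same_point w y'.
  move=> wI wy; apply: ny; split=> //; exists w => //; have [n E] := cy; split.
    by move=> H; apply: n; exact: same_point_trans H wy.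
  by rewrite (periodic_same per wy).
have missrest u v w : t2 <= u -> v <= t0 + 1 -> u <= w <= v -> ~ same_point w x'.
  move=> u2 v0 /andP[uw wv] wx.
  have e : `|w - x'| < 1.
    by rewrite ltr_norml; clear -uw wv u2 v0 x'1 x'2 h01; apply/andP; split; lra.
  by have := same_point_lt1 wx e; clear -uw u2 x'2; lra.
exists D', p, q; split=> //.
  split=> //.
  - by apply: keep (cut_simple01 C) => //; left => w wI; exact: missA xI cx wI.
  - by apply: keep (cut_simple12 C) => //; right.
  - exact: keep_nc.
  - exact: keep_nc.
  - exact: keep_nc.
  - apply: arcs_keep (cut_arcs C) => [u v uI vI u2 vl|b /midB bB _]; last exact: keep_nc.
    apply: keep; [|exact: midB|left => w; apply: missrest u2 _; exact: le_trans vl (ltW hl)].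
    by move: uI; rewrite inE => /orP[/eqP ->|/midB].
  - by apply: keep (cut_simple_last C) => //; left => w; exact: missrest.
split.
- move=> t tI /atP[H|[cr tx ty]|H].
  + have tp w : y - eps < w < x + eps -> same_point t w -> t = w.
      move=> /inA/andP[H1 H2] tw; apply: same_point_lt1 tw _; move: tI => /andP[H3 H4].
      by rewrite ltr_norml; clear -h01 h12 h2l hl H1 H2 H3 H4; apply/andP; split; lra.
    by rewrite mem_cat !inE; case: H => /tp ->; rewrite ?eqxx ?orbT.
  + have := cov t tI cr; rewrite !mem_cat !inE => /orP[->//|/or3P[/eqP E|/eqP E|->]].
    * by case: ty; rewrite E; exact: same_point_refl.
    * by case: tx; rewrite E; exact: same_point_refl.
    * by rewrite !orbT.
  + exfalso; case: H => H.
      have [s sI sx] := slideZ t0 t1 t x' t0B t1B tI x'Z H.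
      exact: (missA x x' s).
    have [s sI sx] := slideZ t0 t1 t y' t0B t1B tI y'Z H.
    exact: (missA y y' s).
- have pr_r z : z \in r -> p < z by move=> /er; apply: lt_le_trans; exact: lt_trans pq q2.
  have qr_r z : z \in r -> q < z by move=> /er; exact: lt_le_trans.
  have lp z : z \in l -> z < p by move=> /el zl; exact: le_lt_trans zl p1.
  rewrite (sorted_pairwise lt_trans) pairwise_cat; apply/and3P; split.
  + apply/allrelP => u v uI; rewrite !inE => /or3P[/eqP ->|/eqP ->|vr]; first exact: lp.
      exact: lt_trans (lp _ uI) pq.
    exact: lt_trans (lp _ uI) (pr_r _ vr).
  + exact: pl.
  + rewrite /= pq pr andbT; apply/andP; split; apply/allP; [exact: pr_r|exact: qr_r].
- split; first by have /andP[H1 H2] := inA p pJ; rewrite !ltW.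
  by exists x'.
Qed.

End Reduction.

Section Conclusion.
Variable R : realType.
Implicit Types (D : diagram R) (s t u v w x y z a b : R) (bs mid l r : seq R).

Lemma equivalent_refl D : equivalent D D.
Proof. exact: rst_refl. Qed.

(** Some crossing [x] of the first arc with the second is moved towards the start of the
    first arc by exchanges, and then given to the last arc. Hence the inner induction on
    the number of parameters before [x], and the outer one on the number of parameters in
    the first arc. *)
Lemma merge_arcs n l D (t0 t1 t2 : R) mid : (size l <= n)%N -> (forall t, smooth_at D t) ->
  subdivision D t0 t1 t2 mid -> covers D t0 t1 l -> sorted <%R l ->
  exists D' a bs, [/\ equivalent D D', forall t, smooth_at D' t, arcs D' a bs &
    last a bs = a + 1 /\ size bs = (size mid).+2].
Proof.
elim: n l D t0 t1 t2 mid => [|n IHn] l D t0 t1 t2 mid ln sm C cov srt.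
  exists D, t0, (t2 :: rcons mid (t0 + 1)); split=> //=.
  - exact: equivalent_refl.
  - by apply: merge_disjoint C cov _ => t; move: ln; rewrite leqn0 size_eq0 => /eqP ->.
  - by rewrite last_rcons size_rcons.
have [none|] := pselect (forall t, t \in l -> ~ meets_next D t0 t1 t2 t).
  exists D, t0, (t2 :: rcons mid (t0 + 1)); split=> //=.
  - exact: equivalent_refl.
  - exact: merge_disjoint C cov none.
  - by rewrite last_rcons size_rcons.
move=> /existsNP[x] /not_implyP[xl /contrapT mx].
have [l1 [r lE]] : exists l1 r, l = l1 ++ x :: r.
  by have [l1 r] := splitPr xl; exists l1, r.
have [k] := ubnP (size l1).
elim: k l1 x r l D lE ln sm C cov srt mx {xl} => // k IHk l1 x r l D lE ln sm C cov srt mx lk.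
rewrite {}lE in ln cov srt.
have drop D1 x1 l2 r1 y : (forall t, smooth_at D1 t) -> subdivision D1 t0 t1 t2 mid ->
    (size (l2 ++ y :: x1 :: r1) <= n.+1)%N -> sorted <%R (l2 ++ y :: x1 :: r1) ->
    covers D1 t0 t1 (l2 ++ x1 :: r1) ->
    exists D' a bs, [/\ equivalent D1 D', forall t, smooth_at D' t, arcs D' a bs &
      last a bs = a + 1 /\ size bs = (size mid).+2].
  move=> sm1 C1 sz st1 cov1; apply: (IHn (l2 ++ x1 :: r1)) C1 cov1 _ => //.
    by move: sz; rewrite !size_cat /= !addnS.
  move: st1; rewrite !(sorted_pairwise lt_trans) !pairwise_cat !allrel_consr /=.
  by move=> /and3P[/andP[_ ->] -> /andP[_ ->]].
case/lastP: l1 lk ln cov srt => [|l1 y] lk ln cov srt.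
  have [t0' [C' cov']] := shift_start C cov srt mx.
  apply: (IHn r) C' cov' _ => //.
  by move: srt => /= /path_sorted.
rewrite cat_rcons in ln cov srt; rewrite size_rcons ltnS in lk.
have [yI|nyI] := pselect (t0 <= y <= t1 /\ at_crossing D y); last first.
  apply: (drop D x l1 r y) => // t tI cr; have := cov t tI cr.
  rewrite !mem_cat !inE => /orP[->//|/orP[/eqP E|->]]; last by rewrite orbT.
  by case: nyI; rewrite -E.
have [my|my] := pselect (meets_next D t0 t1 t2 y).
  exact: (IHk l1 y (x :: r) _ D erefl).
have [D1 [p [q [eq1 sm1 C1 [cov1 srt1 mp]]]]] := exchange_crossings sm C cov srt mx my yI.1 yI.2.
have [|D' [a [bs [eq2 sm2 ar sz]]]] := IHk l1 p (q :: r) _ D1 erefl _ sm1 C1 cov1 srt1 mp lk.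
  by move: ln; rewrite !size_cat.
by exists D', a, bs; split=> //; exact: rst_trans eq1 eq2.
Qed.

Lemma crossings_between D a b : b <= a + 1 -> exists l, sorted <%R l /\
  forall t, t \in l <-> a < t < b /\ at_crossing D t.
Proof.
move=> ba; have [_ fin _] := curve_generic D.
suff : finite_set [set t | a < t < b /\ at_crossing D t].
  move=> /finite_seqP[l lE]; exists (sort <=%R (undup l)); split.
    by rewrite sort_lt_sorted undup_uniq.
  move=> t; rewrite mem_sort mem_undup.
  by have -> : (t \in l) = ([set` l] t) :> Prop by []; rewrite -lE.
apply: (@sub_finite_set _ _ ((fun u => a + fracpart (u - a)) @` [set t | 0 <= t < 1 /\ at_crossing D t])).
  move=> t [/andP[at_ tb] cr].
  have tf : same_point t (fracpart t).
    by apply/same_pointP; exists (Num.floor t); rewrite /fracpart subrK.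
  exists (fracpart t).
    split; last exact: at_crossing_same tf cr.
    have /andP[] := floor_itv t; rewrite intrD /fracpart => *.
    by apply/andP; split; lra.
  rewrite -(@fracpart_same _ (t - a)); first by rewrite addrC subrK.
    by apply/andP; split; lra.
  exact: same_pointD.
exact: finite_image.
Qed.

(** An arc that passes through one crossing only once has no self-crossing. *)
Lemma initial_arcs D l a b : sorted <%R l -> (forall t, t \in l <-> a < t < b /\ at_crossing D t) ->
  a < b -> ~ at_crossing D a -> ~ at_crossing D b -> exists2 bs, arcs D a bs & last a bs = b.
Proof.
elim: l a => [|x l IH] a srt lE ab na nb.
  exists [:: b] => //=; split=> // s t sI tI cr.
  have cs : at_crossing D s by exists t; exact: crossing_sym.
  have sI' := crossing_between cr na nb sI.
  by have := (lE s).2 (conj sI' cs).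
have /lE[/andP[ax xb] cx] : x \in x :: l by rewrite mem_head.
case: l srt lE IH => [|y l] srt lE IH.
  exists [:: b] => //=; split=> // s t sI tI cr.
  have cs : at_crossing D s by exists t; exact: crossing_sym.
  have ct : at_crossing D t by exists s.
  have sI' := crossing_between cr na nb sI; have tI' := crossing_between (crossing_sym cr) na nb tI.
  have := (lE s).2 (conj sI' cs); have := (lE t).2 (conj tI' ct); rewrite !inE => /eqP E /eqP E'.
  by case: cr => n _; apply: n; rewrite E E'; exact: same_point_refl.
have /lE[/andP[ay yb] cy] : y \in [:: x, y & l] by rewrite !inE eqxx orbT.
move: (srt) => /= /andP[xy srt'].
pose m := (x + y) / 2; have [xm my] : x < m /\ m < y by rewrite /m; split; lra.
have later z : z \in y :: l -> m < z.
  rewrite inE => /orP[/eqP ->//|zl]; have := order_path_min lt_trans srt' => /allP/(_ z zl).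
  exact: lt_trans.
have nm : ~ at_crossing D m.
  move=> cr; have mI : a < m < b by apply/andP; split; lra.
  have := (lE m).2 (conj mI cr); rewrite inE => /orP[/eqP E|/later]; first by rewrite E ltxx in xm.
  by rewrite ltxx.
have lE' t : t \in y :: l <-> m < t < b /\ at_crossing D t.
  split=> [tl|[/andP[mt tb] cr]].
    have := lE t; rewrite inE tl orbT => -[/(_ isT)[/andP[_ ->] cr] _].
    by rewrite later.
  have tI : a < t < b by apply/andP; split=> //; lra.
  by have := (lE t).2 (conj tI cr); rewrite inE => /orP[/eqP E|//]; move: mt xm; rewrite E => ? ?; lra.
have mb : m < b by lra.
have [bs arcs_bs last_bs] := IH m srt' lE' mb nm nb.
exists (m :: bs) => //=; split=> //; first by lra.
move=> s t sI tI cr.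
have only u : a <= u <= m -> at_crossing D u -> u = x.
  move=> uI cu; have [v cv] := cu.
  have /andP[u0 u1] := crossing_between (crossing_sym cv) na nm uI.
  have uI' : a < u < b by apply/andP; split; lra.
  by have := (lE u).2 (conj uI' cu); rewrite inE => /orP[/eqP//|/later]; lra.
have Es : s = x by apply: only => //; exists t; exact: crossing_sym.
have Et : t = x by apply: only => //; exists s.
by case: cr => n _; apply: n; rewrite Es Et; exact: same_point_refl.
Qed.

(** While there are at least three arcs, their number can be lowered. *)
Lemma two_arcs n D a bs : (size bs <= n)%N -> (forall t, smooth_at D t) ->
  arcs D a bs -> last a bs = a + 1 -> exists D' a b,
  [/\ equivalent D D', forall t, smooth_at D' t, a < b < a + 1,
      ~ at_crossing D' a /\ ~ at_crossing D' b & simple D' a b /\ simple D' b (a + 1)].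
Proof.
elim: n D a bs => [|n IH] D a bs.
  by rewrite leqn0 size_eq0 => /eqP -> _ _ /= E; exfalso; lra.
move=> sz sm ar la.
have na : ~ at_crossing D a.
  have : a + 1 \in bs by case: bs ar la {sz} => [_ /= E|b bs _ /= <-]; [exfalso; lra|exact: mem_last].
  move=> /(arcs_noncrossing ar) na1 cr; apply: na1.
  by apply: at_crossing_same cr; apply/same_point_sym; exact: (same_pointDz a 1).
case: bs sz ar la => [|b [|b' bs]] sz ar la; first by exfalso; move: la => /=; lra.
- move: ar la => /= [ab sab nb _] E; rewrite E in sab ab.
  (* A single arc without self-crossings is cut at its midpoint. *)
  have nh : ~ at_crossing D (a + 2^-1).
    move=> [s [ns Es]]; pose s' := a + fracpart (s - a).
    have ss : same_point s s'.
      have tf : same_point (s - a) (fracpart (s - a)).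
        by apply/same_pointP; exists (Num.floor (s - a)); rewrite /fracpart subrK.
      by have := same_pointD a tf; rewrite subrK addrC.
    have /andP[] := floor_itv (s - a); rewrite intrD => f0 f1.
    apply: (sab s' (a + 2^-1)).
    + by rewrite /s' /fracpart; apply/andP; split; lra.
    + by apply/andP; split; lra.
    + split; first by move=> H; apply: ns; exact: same_point_trans ss H.
      by rewrite -(periodic_same (curve_periodic D) ss).
  exists D, a, (a + 2^-1); split=> //; first exact: equivalent_refl.
    by apply/andP; split; lra.
  by split; apply: simple_sub sab; lra.
case: bs sz ar la => [|b'' bs] sz ar la.
  move: ar la => /= [ab sab nb [bb sbb _ _]] E; rewrite E in sbb bb.
  exists D, a, b; split=> //; first exact: equivalent_refl.
  by apply/andP.
have [mid [c mcE]] : exists mid c, b'' :: bs = rcons mid c.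
  by exists (belast b'' bs), (last b'' bs); exact: lastI.
rewrite mcE in sz ar la.
have cE : c = a + 1 by move: la; rewrite /= last_rcons.
rewrite cE in ar sz; case: ar => ab sab nb [bb sbb nb' /arcs_rcons[am lm slm _]].
have C : subdivision D a b b' mid by split.
have ba1 : b <= a + 1 by apply/ltW/(lt_le_trans bb); have /andP[_ ?] := arcs_le am (mem_head b' mid); lra.
have [l [srt lE]] := crossings_between D ba1.
have cov : covers D a b l.
  move=> t tI cr; apply/lE; split=> //; have [t' ct] := cr.
  exact: crossing_between (crossing_sym ct) na nb tI.
have [D1 [a1 [bs1 [eq1 sm1 ar1 [la1 sz1]]]]] := merge_arcs (leqnn _) sm C cov srt.
have [|D2 [a2 [b2 [eq2 sm2 I2 n2 s2]]]] := IH D1 a1 bs1 _ sm1 ar1 la1.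
  by rewrite sz1; move: sz; rewrite /= size_rcons !ltnS.
by exists D2, a2, b2; split=> //; exact: rst_trans eq1 eq2.
Qed.

End Conclusion.

Theorem corollary1 (R : realType) (K : set (diagram R)) (hK : virtual_knot K) :
  exists D : diagram R, K D /\ semimeander D.
Proof.
have [D0 KE] := hK.
have [D1 [eq1 sm1 _ _]] := smooth_representative D0.
have [d d0 iso] := crossing_isolated D1 0.
pose a := d / 2.
have na : ~ at_crossing D1 a.
  move=> cr; have E : a = 0.
    by apply: iso cr; rewrite subr0 gtr0_norm /a; lra.
  by move: E; rewrite /a; lra.
have na1 : ~ at_crossing D1 (a + 1).
  by move=> cr; apply: na; apply: at_crossing_same cr; exact: (same_pointDz a 1).
have [l [srt lE]] := crossings_between D1 (lexx (a + 1)).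
have a1 : a < a + 1 by rewrite ltrDl.
have [bs ar la] := initial_arcs srt lE a1 na na1.
have [D2 [u [v [eq2 sm2 uv [nu nv] [s1 s2]]]]] := two_arcs (leqnn _) sm1 ar la.
have [sx sy vel] := smooth_coordinates sm2.
exists D2; split; first by rewrite KE; exact: rst_trans eq1 eq2.
have arc p q : smooth_arc D2 p q.
  exists (fun t => (D2 t).1), (fun t => (D2 t).2); split=> // t _.
  by case: (D2 t).
by exists u, v; split=> // s t sI tI cr; [case: (s1 s t)|case: (s2 s t)].
Qed.
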